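(* Let $\Phi=\{\phi_i\}_{i\in\mathcal I}$ be a complex contracting iterated function system on the unit interval $[0,1]$ and let $\mathbf p=(p_1,\ldots,p_N)$ be a probability vector. Given $g\in\mathcal C_\Phi$, define for $m\ge 1$ $$t_m:=\sum_{\mathbf i\in\mathcal I^m} p_{\mathbf i}\,\frac{1}{1-\phi_{\mathbf i}'(z_{\mathbf i})},\qquad \tau_m:=\sum_{\mathbf i\in\mathcal I^m} p_{\mathbf i}\,\frac{g(z_{\mathbf i})+g(z_{\sigma\mathbf i})+\cdots+g(z_{\sigma^{m-1}\mathbf i})}{1-\phi_{\mathbf i}'(z_{\mathbf i})}.$$ For $n\ge 1$ define $$\alpha_n:=\sum_{l=1}^n\frac{(-1)^l}{l!}\sum_{n_1+\cdots+n_l=n}\ \sum_{j=1}^l\frac{\tau_{n_j}}{n_j}\prod_{1\le m\le l,\ m\ne j}\frac{t_{n_m}}{n_m},\qquad a_n:=\sum_{l=1}^n\frac{(-1)^l}{l!}\sum_{n_1+\cdots+n_l=n}\ \prod_{i=1}^l\frac{t_{n_i}}{n_i},$$ where the inner sums run over all $l$-tuples $(n_1,\ldots,n_l)$ of positive integers with the indicated sum, and put $\alpha_0:=0$, $a_0:=1$. Then for $$\mu_k(g):=\frac{\sum_{n=0}^k\alpha_n}{\sum_{n=0}^k n a_n},\qquad k=1,2,\ldots,$$ and $\mu$ the stationary probability measure associated to $\Phi$ and $\mathbf p$, $$\left|\int_0^1 g\,d\mu-\mu_k(g)\right|<C\exp(-\lambda k^2)$$ for some constants $C,\lambda>0$ which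 are independent of $k$.
   Context: Let $\mathcal I=\{1,\ldots,N\}$ with $N\ge 2$. An iterated function system on $[0,1]$ is a family $\Phi=\{\phi_i\}_{i\in\mathcal I}$ of Lipschitz contractions $\phi_i:[0,1]\to[0,1]$. A probability vector is $\mathbf p=(p_1,\ldots,p_N)$ with $0<p_i<1$ and $\sum_i p_i=1$. The stationary probability measure $\mu=\mu^{(\Phi,\mathbf p)}$ associated to $\Phi$ and $\mathbf p$ is the unique probability measure with $\int\varphi\,d\mu=\sum_{i\in\mathcal I}p_i\int\varphi\circ\phi_i\,d\mu$ for every continuous $\varphi:[0,1]\to\mathbb R$. $\Phi$ is complex contracting if there is a non-empty, bounded, connected, open set $\mathcal D\subset\mathbb C$ with $[0,1]\subset\mathcal D$ such that each $\phi_i$ extends holomorphically to $\mathcal D$, each $\phi_i'$ is continuous on the boundary of $\mathcal D$, and $\sup_{i\in\mathcal I}\sup_{z\in\mathcal D}|\phi_i'(z)|<1$. A complex domain $D\subset\mathcal D$ is admissible for $\Phi$ if $[0,1]\subset D$, each $\phi_i$ extends holomorphically to $D$, and $\overline{\phi_i(D)}\subset D$ for each $i$. (Such domains exist whenever $\Phi$ is complex contracting.) $\mathcal C_\Phi$ is the set of functions $g:[0,1]\to\mathbb R$ for which there is an admissible domain $D$ such that $g$ has an extension to a bounded holomorphic function on $D$. For $\mathbf i=i_1\cdots i_n\in\mathcal I^n$: $\phi_{\mathbf i}:=\phi_{i_1}\circ\cdots\circ\phi_{i_n}$; $p_{\mathbf i}:=\prod_{j=1}^n p_{i_j}$; $\sigma^k\mathbf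 i:=i_{k+1}\cdots i_n i_1\cdots i_k$ for $1\le k\le n-1$ (cyclic shift); and $z_{\mathbf i}\in[0,1]$ is the fixed point of $\phi_{\mathbf i}$. *)

(* Defs.v *)
From HB Require Import structures.
From mathcomp Require Import all_boot all_order all_algebra.
From mathcomp Require Import all_classical all_reals all_analysis.
From mathcomp Require Import complex.

Set Implicit Arguments.
Unset Strict Implicit.
Unset Printing Implicit Defensive.

Import Order.TTheory GRing.Theory Num.Theory numFieldNormedType.Exports.

Local Open Scope classical_set_scope.
Local Open Scope complex_scope.
Local Open Scope ring_scope.

(* R[i] packaged as a numClosedFieldType, so that MathComp-Analysis' norm
   topology and derivatives over a numFieldType apply to it. *)
Definition Cplx (R : realType) : numClosedFieldType := R[i].

Section Defs.
Variable R : realType.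
Local Notation C := (Cplx R).
Local Notation I01 := (`[0%R, 1%R]%classic : set R).

(* Maps on [0,1] are represented by total functions R -> R; nothing below
   depends on their values outside [0,1]. *)

Definition I01C : set C := (fun x : R => (x%:C : C)) @` I01.

(* Derivability over the field C, i.e. complex differentiability; only used
   for open D. *)
Definition holomorphic_on (D : set C) (F : C -> C) : Prop :=
  forall z, D z -> derivable F z 1.

Definition holomorphic_extension (D : set C) (f : R -> R) (F : C -> C) : Prop :=
  holomorphic_on D F /\ forall x : R, I01 x -> F x%:C = (f x)%:C.

Section IFS.
Variable N : nat.
Implicit Types (phi : 'I_N -> R -> R) (p : 'I_N -> R) (g : R -> R).
Implicit Types (calD D : set C).

Definition is_ifs phi : Prop :=
  forall i, set_fun I01 I01 (phi i) /\
    exists2 k : R, k < 1 & k.-lipschitz_I01 (phi i).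

Definition probability_vector p : Prop :=
  (forall i, 0 < p i < 1) /\ \sum_i p i = 1.

(* [h i] is the continuous extension of the derivative to the closure of calD,
   since the derivative itself is only defined on the open set calD. *)
Definition complex_contracting_on phi calD : Prop :=
  [/\ calD !=set0, bounded_set calD, connected calD, open calD & I01C `<=` calD] /\
  exists F : 'I_N -> C -> C,
    [/\ forall i, holomorphic_extension calD (phi i) (F i),
        exists h : 'I_N -> C -> C, forall i,
          {within closure calD, continuous (h i)} /\
          (forall z, calD z -> h i z = derive1 (F i) z)
      & (ereal_sup [set ((Normc.normc (derive1 (F i) z) : R)%:E)
                       | i in [set: 'I_N] & z in calD] < 1%:E)%E].

(* Non-emptiness of D follows from I01C `<=` D. *)
Definition admissible phi calD D : Prop :=
  [/\ open D, connected D, D `<=` calD, I01C `<=` D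
    & exists F : 'I_N -> C -> C, forall i,
        holomorphic_extension D (phi i) (F i) /\ closure (F i @` D) `<=` D].

Definition in_C_Phi phi calD g : Prop :=
  exists2 D, admissible phi calD D &
    exists2 G : C -> C, holomorphic_extension D g G & bounded_set (G @` D).

Definition stationary phi p (mu : probability (measurableTypeR R) R) : Prop :=
  mu I01 = 1%E /\
  forall f : R -> R, {within I01, continuous f} ->
    (\int[mu]_(x in I01) f x =
     \sum_(i < N) p i * \int[mu]_(x in I01) f (phi i x))%R.

Definition phiw phi (w : seq 'I_N) : R -> R :=
  foldr (fun i f => phi i \o f) id w.

Definition pw p (w : seq 'I_N) : R := \prod_(i <- w) p i.

Definition fixpt phi (w : seq 'I_N) : R :=
  xget 0 [set x | I01 x /\ phiw phi w x = x].

(* Derivative of a function on [0,1]; one-sided at the endpoints. *)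
Definition derive01 (f : R -> R) (x : R) : R :=
  lim ((f y - f x) / (y - x) @[y --> within I01 x^']).

Definition dphiw phi (w : seq 'I_N) : R := derive01 (phiw phi w) (fixpt phi w).

Definition t_ phi p (m : nat) : R :=
  \sum_(w : m.-tuple 'I_N) pw p w * (1 / (1 - dphiw phi w)).

Definition tau_ phi p g (m : nat) : R :=
  \sum_(w : m.-tuple 'I_N)
    pw p w * ((\sum_(k < m) g (fixpt phi (rot k w))) / (1 - dphiw phi w)).

(* l-tuples of positive integers with sum n; their entries are at most n. *)
Definition is_composition (n l : nat) (s : l.-tuple 'I_n.+1) : bool :=
  [forall j, (0 < tnth s j)%N] && (\sum_(j < l) tnth s j == n)%N.

Definition alpha_ phi p g (n : nat) : R :=
  \sum_(1 <= l < n.+1) (-1) ^+ l / l`!%:R *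
    \sum_(s : l.-tuple 'I_n.+1 | is_composition s)
      \sum_(j < l) tau_ phi p g (tnth s j) / (tnth s j)%:R *
        \prod_(m < l | m != j) (t_ phi p (tnth s m) / (tnth s m)%:R).

Definition a_ phi p (n : nat) : R :=
  if n is 0 then 1 else
  \sum_(1 <= l < n.+1) (-1) ^+ l / l`!%:R *
    \sum_(s : l.-tuple 'I_n.+1 | is_composition s)
      \prod_(j < l) (t_ phi p (tnth s j) / (tnth s j)%:R).

(* The value is 0 by convention when the denominator vanishes, which can
   happen for individual k. *)
Definition mu_ phi p g (k : nat) : R :=
  (\sum_(0 <= n < k.+1) alpha_ phi p g n) /
  (\sum_(0 <= n < k.+1) n%:R * a_ phi p n).

End IFS.
End Defs.

(* Main.v *)
(** The closed r-neighbourhoods K r of [0,1] are convex, and the extended maps send K del into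
    K (kap * del), since their derivatives are bounded by kap < 1.  On functions holomorphic near
    K del, the transfer operator L f = sum_i p_i (f o F_i) is nuclear: writing f (F_i z) by
    Cauchy's formula on a polygon around K (kap * del) with short edges, and expanding the Cauchy
    kernel in a geometric series at the midpoint of each edge, gives L as a sum of rank-one
    operators.  In this system L becomes an infinite matrix with entries bounded by
    b r^a r^b for some r < 1.  For its truncations M_Q, the traces tr (M_Q^m) tend to t_m, and
    inserting multiplication by g gives tau_m / m; both limits are residues at the fixed points.

    Newton's identities for det (1 - z M_Q) are the recursions that the a_n and alpha_n satisfy by
    the composition formula, so a_n and alpha_n are limits of determinant coefficients, which
    Leibniz' formula bounds by (be)^n r^(n(n-1)/2).

    Finally t_m = 1 + O(kap^m), tau_m / m = mu(g) + O(kap^m).  The generating function of the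
    a_n is therefore (1 - z) q(z) with q holomorphic and non-vanishing near 1, whence
    sum_n n a_n = - q(1), which is non-zero, and sum_n alpha_n = - mu(g) q(1).  The tails of both
    series are superexponentially small. *)

(* The given domain need be neither convex nor simply connected, so everything is moved to the sets
   [K r], where chords, triangles and primitives stay inside. The radii [kap * del < r0 < r < del]
   are kept apart: the polygon lies in [K r] and surrounds [K r0], which contains all images of
   [K del]; its distance to [K r0] against the length of its edges gives the geometric ratio. The
   value $2\pi i$ is never computed: the winding integral is only shown to be non-zero and is
   divided out.

   No infinite determinant is formed. The coefficient bounds are uniform in the truncation [Q], and
   Newton's recursion fixes the coefficients in the limit, so [a_n] and [alpha_n] inherit bounds
   from finite matrices. Decay of the entries in both indices is what survives matrix products with
   constants independent of [Q].

   That $q(1)\neq 0$ is seen on series: the partial sums of the coefficients of $1/q$ stay bounded,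
   and their products with those of $q$ tend to 1. The quotient [mu_] may have a small or zero
   denominator for finitely many [k]; these only enlarge the constant. *)
Require Import Defs.
From mathcomp Require Import all_boot all_order all_algebra all_fingroup.
From mathcomp Require Import all_classical all_reals all_analysis.
From mathcomp Require Import complex ring lra zify measurable_realfun.

Set Implicit Arguments.
Unset Strict Implicit.
Unset Printing Implicit Defensive.

Import Order.TTheory GRing.Theory Num.Theory numFieldNormedType.Exports.

Local Open Scope classical_set_scope.
Local Open Scope complex_scope.
Local Open Scope ring_scope.

(** * The modulus and derivative of a complex function *)

Section Modulus.
Variable R : realType.
Local Notation C := (Cplx R).
Implicit Types (x y z w : C) (r e : R).

(** The norm of a numeric field takes its values in that field, here in [Cplx R]; [nm] is the
    real-valued modulus, so that estimates live in an ordered field. *)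
Definition nm (z : C) : R := Normc.normc z.

Lemma normC_nm z : `|z| = (nm z)%:C :> C.
Proof. by case: z => a b; rewrite /nm [LHS]normc_def. Qed.

Lemma nm_ge0 z : 0 <= nm z.
Proof. by case: z => a b; rewrite /nm /= sqrtr_ge0. Qed.

Lemma nm0 : nm 0 = 0. Proof. exact: Normc.normc0. Qed.
Lemma nm1 : nm 1 = 1. Proof. exact: Normc.normc1. Qed.
Lemma nmM x y : nm (x * y) = nm x * nm y. Proof. exact: Normc.normcM. Qed.
Lemma nmV x : nm x^-1 = (nm x)^-1. Proof. exact: Normc.normcV. Qed.
Lemma nmf x y : nm (x / y) = nm x / nm y. Proof. by rewrite nmM nmV. Qed.
Lemma nmN x : nm (- x) = nm x.
Proof. by case: x => a b; rewrite /nm /= !sqrrN. Qed.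
Lemma nmB x y : nm (x - y) = nm (y - x). Proof. by rewrite -nmN opprB. Qed.
Lemma nmD x y : nm (x + y) <= nm x + nm y.
Proof. exact: le_normcD. Qed.
Lemma nm_eq0 x : (nm x == 0) = (x == 0).
Proof.
by apply/eqP/eqP => [|->]; [exact: Normc.eq0_normc|exact: nm0].
Qed.
Lemma nm_gt0 x : (0 < nm x) = (x != 0).
Proof. by rewrite lt_def nm_ge0 nm_eq0 andbT. Qed.
Lemma nmX x n : nm (x ^+ n) = nm x ^+ n.
Proof. by elim: n => [|n IH]; rewrite ?expr0 ?nm1// !exprS nmM IH. Qed.
Lemma nm_real r : nm r%:C = `|r|.
Proof. by rewrite /nm /= expr0n /= addr0 sqrtr_sqr. Qed.
Lemma nm_sum I (s : seq I) (P : pred I) (F : I -> C) :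
  nm (\sum_(i <- s | P i) F i) <= \sum_(i <- s | P i) nm (F i).
Proof.
elim/big_rec2: _ => [|i u v _ h]; first by rewrite nm0.
by apply: (le_trans (nmD _ _)); rewrite lerD2l.
Qed.
Lemma nm_tri y x z : nm (x - z) <= nm (x - y) + nm (y - z).
Proof. by apply: le_trans (nmD _ _); rewrite addrA subrK. Qed.
Lemma nm_subD x y : nm x - nm y <= nm (x - y).
Proof. by rewrite lerBlDr; apply: le_trans (nmD _ _); rewrite subrK. Qed.
Lemma Re_le_nm z : `|complex.Re z| <= nm z.
Proof.
case: z => a b; rewrite /nm /= -sqrtr_sqr ler_wsqrtr// lerDl.
exact: sqr_ge0.
Qed.
Lemma Im_le_nm z : `|complex.Im z| <= nm z.
Proof.
case: z => a b; rewrite /nm /= -sqrtr_sqr ler_wsqrtr// lerDr.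
exact: sqr_ge0.
Qed.
Lemma nm_le_ReIm z : nm z <= `|complex.Re z| + `|complex.Im z|.
Proof.
case: z => a b; rewrite /nm /=.
rewrite -[leRHS]ger0_norm ?addr_ge0// -sqrtr_sqr ler_wsqrtr//.
rewrite sqrrD !real_normK ?num_real// -addrA lerD2l lerDr mulrn_wge0//.
Qed.
Lemma nm_sqr z : nm z ^+ 2 = complex.Re z ^+ 2 + complex.Im z ^+ 2.
Proof. by case: z => a b; rewrite /nm /= sqr_sqrtr// addr_ge0 ?sqr_ge0. Qed.
Lemma nm_leE z r : 0 <= r ->
  (nm z <= r) = (complex.Re z ^+ 2 + complex.Im z ^+ 2 <= r ^+ 2).
Proof. by move=> r0; rewrite -nm_sqr ler_pXn2r// nnegrE// nm_ge0. Qed.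
Lemma nm_geE z r : 0 <= r ->
  (r <= nm z) = (r ^+ 2 <= complex.Re z ^+ 2 + complex.Im z ^+ 2).
Proof. by move=> r0; rewrite -nm_sqr ler_pXn2r// nnegrE// nm_ge0. Qed.
Lemma nm_le_eps z r : (forall e, 0 < e -> nm z <= r + e) -> nm z <= r.
Proof. by move=> h; apply/ler_addgt0Pr => e e0; apply: h. Qed.

Definition cder (F : C -> C) z d := forall e, 0 < e -> exists2 del, 0 < del &
  forall w, nm (w - z) < del -> nm (F w - F z - d * (w - z)) <= e * nm (w - z).

Lemma posC (e : C) : 0 < e -> e = (complex.Re e)%:C /\ 0 < complex.Re e.
Proof.
case: e => a b e0; have := e0 : (0 : R[i]) < a +i* b.
by rewrite ltcE /= => /andP[/eqP -> ->].
Qed.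

Lemma near0P (P : C -> Prop) :
  (\forall h \near (0 : C)^', P h) <->
  exists2 del : R, 0 < del & forall h, h != 0 -> nm h < del -> P h.
Proof.
split.
- rewrite /dnbhs near_withinE => /nbhs_ballP [del /posC[-> del0] h].
  exists (complex.Re del) => // k k0 kd; apply: h => //.
  by rewrite -ball_normE /= sub0r normrN normC_nm ltcR.
- move=> [del del0 h]; rewrite /dnbhs near_withinE; apply/nbhs_ballP.
  exists (del%:C); first by rewrite /= ltcR.
  move=> k; rewrite -ball_normE /= sub0r normrN normC_nm ltcR => kd k0.
  exact: h.
Qed.

Lemma is_derive_cder F z d : is_derive z (1 : C) F d <-> cder F z d.
Proof.
have key e : 0 < e -> forall h, h != 0 ->
    (`|d - h^-1 *: (F (h *: 1 + z) - F z)| <= e%:C :> C) =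
    (nm (F (h + z) - F z - d * h) <= e * nm h).
  move=> e0 h h0; have h1 : h *: (1 : C) = h by exact: mulr1.
  rewrite h1 normC_nm lecR -ler_pdivrMr ?nm_gt0// -nmf.
  rewrite nmB; congr (nm _ <= _).
  by rewrite mulrBl mulfK// [_ *: _]mulrC.
split.
- case=> dF dE e e0.
  have eC : 0 < e%:C :> C by rewrite [_ < _]ltcR.
  have H : \forall h \near (0 : C)^',
      `|d - h^-1 *: (F (h *: 1 + z) - F z)| <= e%:C :> C.
    by have := @cvgr_dist_le _ _ _ _ _ _ _ dF _ eC; rewrite -dE; exact.
  move/near0P: H => [del del0 h].
  exists del => // w wd; have [->|wz] := eqVneq w z.
    by rewrite !subrr mulr0 subr0 nm0 mulr0.
  have wz0 : w - z != 0 by rewrite subr_eq0.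
  have := h _ wz0 wd.
  rewrite key//.
  by rewrite subrK.
- move=> h.
  suff H : (fun h => h^-1 *: (F (h *: 1 + z) - F z)) @ (0 : C)^' --> d.
    by apply: DeriveDef; [apply/cvg_ex; exists d|exact: cvg_lim].
  apply/cvgrPdist_le => e /posC [-> e0]; apply/near0P.
  have [del del0 {}h] := h _ e0; exists del => // k k0 kd.
  by rewrite /= key//; have := h (k + z); rewrite addrK => /(_ kd).
Qed.

Lemma derivable_cder F z : derivable F z (1 : C) <-> exists d, cder F z d.
Proof.
split; first by move=> /derivableP/is_derive_cder h; exists ('D_1 F z).
by case=> d /is_derive_cder [].
Qed.

Lemma cder_unique F z d d' : cder F z d -> cder F z d' -> d = d'.
Proof. by move=> /is_derive_cder[_ <-] /is_derive_cder[_ <-]. Qed.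

Lemma cder_ext F G z d r : 0 < r ->
  (forall w, nm (w - z) < r -> F w = G w) -> cder F z d -> cder G z d.
Proof.
move=> r0 FG dF e e0; have [del del0 h] := dF _ e0.
exists (Num.min del r); first by rewrite lt_min del0.
move=> w; rewrite lt_min => /andP[wd wr].
by rewrite -FG// -FG ?subrr ?nm0//; exact: h.
Qed.

Lemma cder_cont F z d : cder F z d -> forall e, 0 < e -> exists2 del, 0 < del &
  forall w, nm (w - z) < del -> nm (F w - F z) <= e.
Proof.
move=> dF e e0; have [del del0 h] := dF _ ltr01.
have M0 : 0 < 1 + nm d by rewrite ltr_pwDl// nm_ge0.
exists (Num.min del (e / (1 + nm d))).
  by rewrite lt_min del0 divr_gt0.
move=> w; rewrite lt_min => /andP[wd we].
rewrite -[F w - F z](subrK (d * (w - z))).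
apply: (le_trans (nmD _ _)); rewrite nmM.
apply: (@le_trans _ _ ((1 + nm d) * nm (w - z))).
  by rewrite mulrDl lerD2r; apply: h.
by rewrite mulrC -ler_pdivlMr// ltW.
Qed.

Lemma cder_cst (a : C) z : cder (fun=> a) z 0.
Proof. by apply/is_derive_cder; exact: is_derive_cst. Qed.
Lemma cder_id z : cder (fun w => w) z 1.
Proof. by apply/is_derive_cder; exact: is_derive_id. Qed.
Lemma cderD F G z d d' : cder F z d -> cder G z d' ->
  cder (fun w => F w + G w) z (d + d').
Proof. by move=> /is_derive_cder ? /is_derive_cder ?; apply/is_derive_cder; exact: is_deriveD. Qed.
Lemma cderN F z d : cder F z d -> cder (fun w => - F w) z (- d).
Proof. by move=> /is_derive_cder ?; apply/is_derive_cder; exact: is_deriveN. Qed.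
Lemma cderB F G z d d' : cder F z d -> cder G z d' ->
  cder (fun w => F w - G w) z (d - d').
Proof. by move=> dF /cderN; exact: cderD. Qed.
Lemma cderM F G z d d' : cder F z d -> cder G z d' ->
  cder (fun w => F w * G w) z (F z * d' + G z * d).
Proof. by move=> /is_derive_cder ? /is_derive_cder ?; apply/is_derive_cder; exact: is_deriveM. Qed.
Lemma cder_sum I (s : seq I) (F : I -> C -> C) z d :
  (forall i, cder (F i) z (d i)) ->
  cder (fun w => \sum_(i <- s) F i w) z (\sum_(i <- s) d i).
Proof.
move=> h; elim: s => [|i s IH].
  rewrite big_nil; have -> : (fun w => \sum_(i <- [::]) F i w) = fun=> 0.
    by apply/funext => w; rewrite big_nil.
  exact: cder_cst.
rewrite big_cons; have -> : (fun w => \sum_(j <- i :: s) F j w) =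
    fun w => F i w + \sum_(j <- s) F j w.
  by apply/funext => w; rewrite big_cons.
exact: cderD.
Qed.
Lemma cderV F z d : F z != 0 -> cder F z d ->
  cder (fun w => (F w)^-1) z (- d / F z ^+ 2).
Proof.
move=> Fz /is_derive_cder [dF dE]; apply/is_derive_cder; split.
  exact: derivableV.
by rewrite deriveV// dE; rewrite /GRing.scale/= mulNr mulrC mulNr.
Qed.
Lemma cderX F z d n : cder F z d -> cder (fun w => F w ^+ n) z
  (n%:R * F z ^+ n.-1 * d).
Proof.
elim: n => [|n IH] dF; first by rewrite mul0r mul0r; exact: cder_cst.
have := cderM dF (IH dF); congr cder.
  by apply/funext => w; rewrite exprS.
case: n {IH} => [|n]; first by rewrite /= !mul0r mulr0 add0r expr0 !mul1r.
by rewrite /= exprS; ring.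
Qed.

Lemma cder_comp F G z d d' : cder F z d -> cder G (F z) d' ->
  cder (fun w => G (F w)) z (d' * d).
Proof.
move=> dF dG e e0.
have M0 : 0 < 1 + nm d by rewrite ltr_pwDl// nm_ge0.
have N0 : 0 < 1 + nm d' by rewrite ltr_pwDl// nm_ge0.
have [del1 del10 h1] := dG (e / 2 / (1 + nm d)) (divr_gt0 (divr_gt0 e0 (ltr0Sn _ 1)) M0).
pose e2 := Num.min 1 (e / 2 / (1 + nm d')).
have e20 : 0 < e2 by rewrite lt_min ltr01 !divr_gt0.
have [del2 del20 h2] := dF e2 e20.
have [del3 del30 h3] := cder_cont dF (divr_gt0 del10 (ltr0Sn _ 1) : 0 < del1 / 2).
exists (Num.min del2 del3); first by rewrite lt_min del20.
move=> w; rewrite lt_min => /andP[w2 w3].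
have {}h2 := h2 _ w2.
have L : nm (F w - F z) <= (1 + nm d) * nm (w - z).
  rewrite -[F w - F z](subrK (d * (w - z))) (le_trans (nmD _ _))// nmM mulrDl.
  rewrite lerD2r (le_trans h2)// ler_wpM2r ?nm_ge0// ge_min lexx//.
have {}h3 : nm (F w - F z) < del1.
  by apply: (le_lt_trans (h3 _ w3)); rewrite ltr_pdivrMr// ltr_pMr// ltr1n.
have {}h1 := h1 _ h3.
have -> : G (F w) - G (F z) - d' * d * (w - z) =
   (G (F w) - G (F z) - d' * (F w - F z)) + d' * (F w - F z - d * (w - z)).
  by ring.
apply: (le_trans (nmD _ _)); rewrite nmM.
rewrite [e in leRHS](splitr e) mulrDl; apply: lerD.
  apply: (le_trans h1); rewrite mulrAC ler_pdivrMr// -[leRHS]mulrA ler_wpM2l//.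
    by rewrite divr_ge0// ltW.
  by rewrite mulrC.
have : nm (F w - F z - d * (w - z)) <= e / 2 / (1 + nm d') * nm (w - z).
  by apply: (le_trans h2); rewrite ler_wpM2r ?nm_ge0// ge_min lexx orbT.
rewrite mulrAC ler_pdivlMr// mulrC => h; apply: le_trans h.
by rewrite ler_wpM2r ?nm_ge0// lerDr.
Qed.
End Modulus.

(** * Integrals along segments *)

Section Segments.
Variable R : realType.
Local Notation C := (Cplx R).
Implicit Types (x y z w a b c : C) (r e s t : R).

Definition rd (f : R -> R) t d := forall e, 0 < e -> exists2 del, 0 < del &
  forall s, `|s - t| < del -> `|f s - f t - d * (s - t)| <= e * `|s - t|.

Lemma is_derive_rd f t d : is_derive t (1 : R) f d <-> rd f t d.
Proof.
have key e : 0 < e -> forall h, h != 0 ->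
    (`|d - h^-1 *: (f (h *: 1 + t) - f t)| <= e) =
    (`|f (h + t) - f t - d * h| <= e * `|h|).
  move=> e0 h h0; have h1 : h *: (1 : R) = h by exact: mulr1.
  rewrite h1 -ler_pdivrMr ?normr_gt0// -normf_div.
  rewrite distrC; congr (`|_| <= _).
  by rewrite mulrBl mulfK// [_ *: _]mulrC.
have near0 (P : R -> Prop) : (\forall h \near (0 : R)^', P h) <->
    exists2 del : R, 0 < del & forall h, h != 0 -> `|h| < del -> P h.
  split.
  - rewrite /dnbhs near_withinE => /nbhs_ballP [del del0 h].
    exists del => // k k0 kd; apply: h => //.
    by rewrite -ball_normE /= sub0r normrN.
  - move=> [del del0 h]; rewrite /dnbhs near_withinE; apply/nbhs_ballP.
    exists del => // k; rewrite -ball_normE /= sub0r normrN => kd k0.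
    exact: h.
split.
- case=> df dE e e0.
  have H : \forall h \near (0 : R)^',
      `|d - h^-1 *: (f (h *: 1 + t) - f t)| <= e.
    by have := @cvgr_dist_le _ _ _ _ _ _ _ df _ e0; rewrite -dE; exact.
  move/near0: H => [del del0 h].
  exists del => // s sd; have [->|st] := eqVneq s t.
    by rewrite !subrr mulr0 subr0 normr0 mulr0.
  have st0 : s - t != 0 by rewrite subr_eq0.
  by have := h _ st0 sd; rewrite key// subrK.
- move=> h.
  suff H : (fun h => h^-1 *: (f (h *: 1 + t) - f t)) @ (0 : R)^' --> d.
    by apply: DeriveDef; [apply/cvg_ex; exists d|exact: cvg_lim].
  apply/cvgrPdist_le => e e0; apply/near0.
  have [del del0 {}h] := h _ e0; exists del => // k k0 kd.
  by rewrite /= key//; have := h (k + t); rewrite addrK => /(_ kd).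
Qed.

Definition rcder (U : R -> C) t d := forall e, 0 < e -> exists2 del, 0 < del &
  forall s, `|s - t| < del ->
    nm (U s - U t - d * (s - t)%:C) <= e * `|s - t|.

Lemma rcder_Re U t d c : rcder U t d ->
  rd (fun s => complex.Re (c * U s)) t (complex.Re (c * d)).
Proof.
move=> dU e e0; have N0 : 0 < 1 + nm c by rewrite ltr_pwDl// nm_ge0.
have [del del0 h] := dU _ (divr_gt0 e0 N0); exists del => // s sd.
have -> : complex.Re (c * U s) - complex.Re (c * U t) - complex.Re (c * d) * (s - t)
    = complex.Re (c * (U s - U t - d * (s - t)%:C)).
  by case: (U s) (U t) (d) (c) => ? ? [? ?] [? ?] [? ?] /=; ring.
apply: (le_trans (Re_le_nm _)); rewrite nmM.
have := h _ sd; rewrite mulrAC ler_pdivlMr// mulrC; apply: le_trans.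
by rewrite ler_wpM2r ?nm_ge0// lerDr.
Qed.

Lemma rcder_intro (u v : R -> R) t du dv : rd u t du -> rd v t dv ->
  rcder (fun s => u s +i* v s) t (du +i* dv).
Proof.
move=> hu hv e e0; have e20 : 0 < e / 2 by rewrite divr_gt0.
have [d1 d10 h1] := hu _ e20; have [d2 d20 h2] := hv _ e20.
exists (Num.min d1 d2); first by rewrite lt_min d10.
move=> s; rewrite lt_min => /andP[s1 s2].
apply: (le_trans (nm_le_ReIm _)); rewrite [e in leRHS]splitr mulrDl.
apply: lerD.
  rewrite (_ : complex.Re _ = u s - u t - du * (s - t)); first exact: h1.
  by rewrite /=; ring.
rewrite (_ : complex.Im _ = v s - v t - dv * (s - t)); first exact: h2.
by rewrite /=; ring.
Qed.

Lemma rcderD U V t d d' c : rcder U t d -> rcder V t d' ->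
  rcder (fun s => c * U s + V s) t (c * d + d').
Proof.
move=> hu hv e e0; have e20 : 0 < e / 2 by rewrite divr_gt0.
have N0 : 0 < 1 + nm c by rewrite ltr_pwDl// nm_ge0.
have [d1 d10 h1] := hu _ (divr_gt0 e20 N0); have [d2 d20 h2] := hv _ e20.
exists (Num.min d1 d2); first by rewrite lt_min d10.
move=> s; rewrite lt_min => /andP[s1 s2].
have -> : c * U s + V s - (c * U t + V t) - (c * d + d') * (s - t)%:C =
  c * (U s - U t - d * (s - t)%:C) + (V s - V t - d' * (s - t)%:C) by ring.
apply: (le_trans (nmD _ _)); rewrite [e in leRHS]splitr mulrDl.
apply: lerD; last exact: h2.
rewrite nmM; have := h1 _ s1; rewrite mulrAC ler_pdivlMr// mulrC.
by apply: le_trans; rewrite ler_wpM2r ?nm_ge0// lerDr.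
Qed.

Lemma rcder_affine U t d (al be : R) : rcder U (al * t + be) d ->
  rcder (fun s => U (al * s + be)) t (al%:C * d).
Proof.
move=> hu e e0; have N0 : 0 < 1 + `|al| by rewrite ltr_pwDl.
have [del del0 h] := hu _ (divr_gt0 e0 N0); exists (del / (1 + `|al|)).
  by rewrite divr_gt0.
have E s : al * s + be - (al * t + be) = al * (s - t) by ring.
move=> s sd; have sd' : `|al * (s - t)| < del.
  rewrite normrM; apply: (@le_lt_trans _ _ ((1 + `|al|) * `|s - t|)).
    by rewrite ler_wpM2r// lerDr.
  by rewrite mulrC -ltr_pdivlMr.
have := h (al * s + be); rewrite E => /(_ sd') {}h.
rewrite (_ : _ * d * _ = d * (al * (s - t))%:C); last by rewrite rmorphM; ring.
apply: le_trans h _; rewrite normrM mulrAC ler_pdivrMr//.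
by rewrite -[leRHS]mulrA ler_wpM2l ?(ltW e0)// mulrC ler_wpM2l// lerDr.
Qed.

Definition pt a b t : C := a + t%:C * (b - a).

Lemma pt0 a b : pt a b 0 = a. Proof. by rewrite /pt mul0r addr0. Qed.
Lemma pt1 a b : pt a b 1 = b. Proof. by rewrite /pt mul1r addrC subrK. Qed.

Lemma rcder_line P a b t d : cder P (pt a b t) d ->
  rcder (fun s => P (pt a b s)) t (d * (b - a)).
Proof.
move=> hP e e0; have N0 : 0 < 1 + nm (b - a) by rewrite ltr_pwDl// nm_ge0.
have [del del0 h] := hP _ (divr_gt0 e0 N0).
exists (del / (1 + nm (b - a))); first by rewrite divr_gt0.
have E s : pt a b s - pt a b t = (s - t)%:C * (b - a).
  by rewrite /pt rmorphB; ring.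
have F s : nm (pt a b s - pt a b t) <= (1 + nm (b - a)) * `|s - t|.
  by rewrite E nmM nm_real mulrC ler_wpM2r// lerDr.
move=> s sd; have sd' : nm (pt a b s - pt a b t) < del.
  by apply: (le_lt_trans (F s)); rewrite mulrC -ltr_pdivlMr.
rewrite (_ : _ * _ * _ = d * (pt a b s - pt a b t)); last by rewrite E; ring.
apply: (le_trans (h _ sd')); rewrite mulrAC ler_pdivrMr// -[leRHS]mulrA ler_wpM2l ?(ltW e0)// mulrC.
exact: F.
Qed.

Lemma rd_cont f t d : rd f t d -> {for t, continuous f}.
Proof.
move=> /is_derive_rd[h _]; apply: differentiable_continuous.
exact/derivable1_diffP.
Qed.

(** The mean value theorem has no equality form for complex curves. It is applied to the real
    function [Re (D^* * U s)], whose increment is [|D|^2]; this gives [|D|^2 <= |D| M]. *)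
Lemma curve_MVI U u M : (forall t, 0 <= t <= 1 -> rcder U t (u t)) ->
  (forall t, 0 <= t <= 1 -> nm (u t) <= M) -> nm (U 1 - U 0) <= M.
Proof.
move=> hU hM; set D := U 1 - U 0.
pose phi s := complex.Re (D^* * U s); pose dphi s := complex.Re (D^* * u s).
have dP s : 0 <= s <= 1 -> rd phi s (dphi s) by move=> /hU; exact: rcder_Re.
have [||s s01 E] := @MVT_segment R phi dphi 0 1 ler01.
- by move=> x /andP[]; rewrite !bnd_simp => x0 x1; apply/is_derive_rd/dP; rewrite !ltW.
- apply: continuous_in_subspaceT => x; rewrite inE/= in_itv/= => /dP.
  exact: rd_cont.
have conjn : nm (D^*) = nm D by case: (D) => ? ?; rewrite /nm /= sqrrN.
have E1 : phi 1 - phi 0 = nm D ^+ 2.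
  rewrite nm_sqr /phi /D; case: (U 1) (U 0) => ? ? [? ?] /=; ring.
have : nm D ^+ 2 <= nm D * M.
  rewrite -E1 E subr0 mulr1 /dphi (le_trans (ler_norm _))//.
  rewrite (le_trans (Re_le_nm _))// nmM conjn ler_wpM2l ?nm_ge0// hM//.
have [->|D0] := eqVneq D 0.
  move=> _; rewrite nm0; apply: le_trans (hM 0 _); rewrite ?nm_ge0//.
  by rewrite lexx ler01.
by rewrite expr2 ler_pM2l// nm_gt0.
Qed.

(** The integral over a segment, as the increment of an antiderivative of the pulled back
    function. *)
Definition segi (f : C -> C) a b I := exists2 U : R -> C,
  (forall t, 0 <= t <= 1 -> rcder U t (f (pt a b t) * (b - a))) & I = U 1 - U 0.

(** The value is 0 when there is no antiderivative; otherwise [segi_uniq] makes the choice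
    immaterial. *)
Definition seg f a b : C := xget 0 (segi f a b).

Lemma segi_bound f a b I M : segi f a b I ->
  (forall t, 0 <= t <= 1 -> nm (f (pt a b t)) <= M) -> nm I <= M * nm (b - a).
Proof.
move=> [U hU ->] hM; apply: curve_MVI hU _ => t t01.
by rewrite nmM ler_wpM2r ?nm_ge0// hM.
Qed.

Lemma segi_lin c f g a b I J : segi f a b I -> segi g a b J ->
  segi (fun z => c * f z + g z) a b (c * I + J).
Proof.
move=> [U hU ->] [V hV ->]; exists (fun s => c * U s + V s); last by ring.
move=> t t01; rewrite mulrDl -mulrA; apply: rcderD; [exact: hU|exact: hV].
Qed.

Lemma segi_ext f g a b I : (forall t, 0 <= t <= 1 -> f (pt a b t) = g (pt a b t)) ->
  segi f a b I -> segi g a b I.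
Proof. by move=> fg [U hU ->]; exists U => // t t01; rewrite -fg//; exact: hU. Qed.

Lemma segi_uniq f a b I J : segi f a b I -> segi f a b J -> I = J.
Proof.
move=> hI hJ; apply/eqP; rewrite eq_sym -subr_eq0 -nm_eq0 eq_le nm_ge0 andbT.
have := segi_bound (M := 0) (segi_lin (-1) hI hJ).
rewrite mulN1r mul0r addrC; apply=> t _.
by rewrite mulN1r addNr nm0.
Qed.

Lemma segE f a b I : segi f a b I -> seg f a b = I.
Proof.
move=> h; rewrite /seg; case: xgetP => [J _ /segi_uniq|/(_ I)//]; exact.
Qed.

Lemma segi_seg f a b I : segi f a b I -> segi f a b (seg f a b).
Proof. by move=> h; rewrite (segE h). Qed.

Lemma segi_FTC P f a b : (forall t, 0 <= t <= 1 -> cder P (pt a b t) (f (pt a b t))) ->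
  segi f a b (P b - P a).
Proof.
move=> h; exists (fun t => P (pt a b t)); last by rewrite pt0 pt1.
by move=> t t01; apply: rcder_line; exact: h.
Qed.

Lemma segi_cst (c : C) a b : segi (fun=> c) a b (c * (b - a)).
Proof.
rewrite mulrBr; apply: (segi_FTC (P := fun z => c * z)) => t _.
by have := cderM (cder_cst c (pt a b t)) (cder_id (pt a b t)); rewrite mulr0 addr0 mulr1.
Qed.

Lemma segi_half f a b U : let m := pt a b (1 / 2) in
  (forall t, 0 <= t <= 1 -> rcder U t (f (pt a b t) * (b - a))) ->
  segi f a m (U (1 / 2) - U 0) /\ segi f m b (U 1 - U (1 / 2)).
Proof.
move=> m hU; have h2 : (1 / 2)%:C = 2^-1 :> C by rewrite div1r fmorphV rmorph_nat.
split.
- exists (fun s => U (1 / 2 * s + 0)); last by rewrite mulr1 mulr0 !addr0.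
  move=> t t01.
  have -> : f (pt a m t) * (m - a) = (1 / 2)%:C * (f (pt a b (1 / 2 * t + 0)) * (b - a)).
    have -> : pt a m t = pt a b (1 / 2 * t + 0).
      by rewrite addr0 /m /pt rmorphM; ring.
    by rewrite /m /pt; ring.
  by apply: rcder_affine; apply: hU; lra.
- exists (fun s => U (1 / 2 * s + 1 / 2)); last first.
    by rewrite mulr1 mulr0 add0r; congr (U _ - _); field.
  move=> t t01.
  have -> : f (pt m b t) * (b - m) = (1 / 2)%:C * (f (pt a b (1 / 2 * t + 1 / 2)) * (b - a)).
    have -> : pt m b t = pt a b (1 / 2 * t + 1 / 2).
      have E : (1 / 2 * t + 1 / 2)%:C = 2^-1 * t%:C + 2^-1 :> C.
        by rewrite -h2 rmorphD; congr (_ + _); exact: rmorphM.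
      by rewrite /m /pt E h2; field.
    by rewrite /m /pt h2; field.
  by apply: rcder_affine; apply: hU; lra.
Qed.

Lemma segi_rev f a b I : segi f a b I -> segi f b a (- I).
Proof.
move=> [U hU ->]; exists (fun s => U (-1 * s + 1)); last first.
  by rewrite mulr1 mulr0 add0r addNr opprB.
move=> t t01.
have -> : f (pt b a t) * (a - b) = (-1)%:C * (f (pt a b (-1 * t + 1)) * (b - a)).
  have -> : pt b a t = pt a b (-1 * t + 1).
    by rewrite /pt rmorphD rmorphM rmorphN rmorph1; ring.
  by rewrite rmorphN rmorph1; ring.
by apply: rcder_affine; apply: hU; lra.
Qed.

Lemma antiderivative (u : R -> R) : continuous u ->
  exists U : R -> R, forall t, 0 <= t <= 1 -> rd U t (u t).
Proof.
(* Integrating from -1, inside [-1, 2], makes 0 and 1 interior points, so the derivative is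
   two-sided there, as [rd] demands. *)
move=> cu; exists (fun x : R => \int[lebesgue_measure]_(t in `[-1, x]) u t) => t /andP[t0 t1].
have [||||df dE] := @continuous_FTC1_closed R u (-1) t 2.
- by lra.
- apply: continuous_compact_integrable; first exact: segment_compact.
  exact: continuous_subspaceT.
- by lra.
- exact: cu.
by apply/is_derive_rd; split; [exact: df|rewrite -derive1E; exact: dE].
Qed.

(** A 1-Lipschitz retraction onto [0,1]. It extends data on [0,1] continuously to the line, gives
    the point of [0,1] nearest to [z] as [clamp (Re z)], and later moves the centres of the discs
    that shape the contour. *)
Definition clamp (t : R) := Num.max 0 (Num.min 1 t).

Lemma clamp01 t : 0 <= clamp t <= 1.
Proof. by rewrite /clamp le_max lexx /= ge_max ler01 /= ge_min lexx. Qed.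

Lemma clamp_id t : 0 <= t <= 1 -> clamp t = t.
Proof. by move=> /andP[t0 t1]; rewrite /clamp; rewrite (min_idPr _)// (max_idPr _). Qed.

Lemma clamp_lip s t : `|clamp s - clamp t| <= `|s - t|.
Proof.
have h1 : s - t <= `|s - t| := ler_norm _.
have h2 : t - s <= `|s - t| by rewrite distrC ler_norm.
rewrite /clamp ler_norml; apply/andP.
case: (leP 1 s) => hs; case: (leP 1 t) => ht; rewrite ?(max_idPr (@ler01 R)).
- by split; lra.
- by case: (leP 0 t) => h; split; lra.
- by case: (leP 0 s) => h; split; lra.
- by case: (leP 0 t) => h; case: (leP 0 s) => h'; split; lra.
Qed.

Lemma clamp_cont f a b : (forall t, 0 <= t <= 1 -> exists d, cder f (pt a b t) d) ->
  forall t e, 0 < e -> exists2 del, 0 < del & forall s, `|s - t| < del ->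
    nm (f (pt a b (clamp s)) - f (pt a b (clamp t))) < e.
Proof.
move=> h t e e0; have [d dE] := h _ (clamp01 t).
have N0 : 0 < 1 + nm (b - a) by rewrite ltr_pwDl// nm_ge0.
have e20 : 0 < e / 2 by rewrite divr_gt0.
have [del del0 hd] := cder_cont dE e20.
exists (del / (1 + nm (b - a))); first by rewrite divr_gt0.
move=> s sd; apply: (@le_lt_trans _ _ (e / 2)); last first.
  by rewrite ltr_pdivrMr// ltr_pMr ?ltr1n.
apply: hd; have -> : pt a b (clamp s) - pt a b (clamp t) = (clamp s - clamp t)%:C * (b - a).
  by rewrite /pt rmorphB; ring.
rewrite nmM nm_real; apply: (@le_lt_trans _ _ (`|s - t| * (1 + nm (b - a)))).
  by rewrite ler_pM// ?clamp_lip ?nm_ge0// lerDr.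
by rewrite -ltr_pdivlMr.
Qed.

Lemma seg_bounded f a b : (forall t, 0 <= t <= 1 -> exists d, cder f (pt a b t) d) ->
  exists2 M, 0 <= M & forall t, 0 <= t <= 1 -> nm (f (pt a b t)) <= M.
Proof.
move=> h; pose u t := nm (f (pt a b (clamp t))).
have cu : continuous u.
  move=> t; apply/cvgrPdist_lt => e e0; have [del del0 hd] := clamp_cont h t e0.
  apply/nbhs_ballP; exists del => //= s; rewrite /ball /= distrC => sd.
  apply: le_lt_trans (hd s sd); rewrite /u ler_norml.
  have := nm_subD (f (pt a b (clamp s))) (f (pt a b (clamp t))).
  have := nm_subD (f (pt a b (clamp t))) (f (pt a b (clamp s))).
  by rewrite [nm (_ - f (pt a b (clamp s)))]nmB => h1 h2; apply/andP; split; lra.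
have [c _ hc] := EVT_max (@ler01 R) (continuous_subspaceT cu).
exists (u c) => [|t t01]; first exact: nm_ge0.
by have := hc t; rewrite in_itv/= {1}/u clamp_id//; exact.
Qed.

(** Differentiability is used through continuity along the segment only: real and imaginary part of
    the pulled-back integrand, extended by [clamp], have antiderivatives. *)
Lemma segi_exists f a b :
  (forall t, 0 <= t <= 1 -> exists d, cder f (pt a b t) d) ->
  segi f a b (seg f a b).
Proof.
move=> h; pose u t := f (pt a b (clamp t)) * (b - a).
have cu t e : 0 < e -> exists2 del, 0 < del &
    forall s, `|s - t| < del -> nm (u s - u t) < e.
  apply: (@clamp_cont (fun z => f z * (b - a))) => {}t /h [d dE].
  by eexists; exact: (cderM dE (cder_cst (b - a) (pt a b t))).
have cRe : continuous (fun t => complex.Re (u t)).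
  move=> t; apply/cvgrPdist_lt => e e0; have [del del0 hd] := cu t e e0.
  apply/nbhs_ballP; exists del => //= s; rewrite /ball /= distrC => sd.
  have := hd s sd; rewrite nmB; apply: le_lt_trans.
  have := Re_le_nm (u t - u s); case: (u t) (u s) => ? ? [? ?]; exact.
have cIm : continuous (fun t => complex.Im (u t)).
  move=> t; apply/cvgrPdist_lt => e e0; have [del del0 hd] := cu t e e0.
  apply/nbhs_ballP; exists del => //= s; rewrite /ball /= distrC => sd.
  have := hd s sd; rewrite nmB; apply: le_lt_trans.
  have := Im_le_nm (u t - u s); case: (u t) (u s) => ? ? [? ?]; exact.
have [U hU] := antiderivative cRe; have [V hV] := antiderivative cIm.
apply: (@segi_seg _ _ _ (U 1 +i* V 1 - (U 0 +i* V 0))).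
exists (fun t => U t +i* V t) => // t t01.
have -> : f (pt a b t) * (b - a) = complex.Re (u t) +i* complex.Im (u t).
  by rewrite /u clamp_id//; case: (_ * _).
by apply: rcder_intro; [exact: hU|exact: hV].
Qed.

End Segments.

(** * Goursat's theorem near the unit interval *)

Section Goursat.
Variable R : realType.
Local Notation C := (Cplx R).
Implicit Types (x y z w a b c : C) (r e s t : R).

Definition K r z := exists2 x : R, 0 <= x <= 1 & nm (z - x%:C) <= r.

Lemma K_convex r a b t : K r a -> K r b -> 0 <= t <= 1 -> K r (pt a b t).
Proof.
move=> [x x01 hx] [y y01 hy] /andP[t0 t1].
have t1' : 0 <= 1 - t by rewrite subr_ge0.
exists (x + t * (y - x)); first by apply/andP; split; nra.
have -> : pt a b t - (x + t * (y - x))%:C = (1 - t)%:C * (a - x%:C) + t%:C * (b - y%:C).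
  by rewrite /pt rmorphD rmorphM !rmorphB rmorph1; ring.
apply: (le_trans (nmD _ _)); rewrite !nmM !nm_real !ger0_norm//.
have := ler_wpM2l t0 hy; have := ler_wpM2l t1' hx; lra.
Qed.

Lemma K_real r (x : R) : 0 <= r -> 0 <= x <= 1 -> K r x%:C.
Proof. by move=> r0 x01; exists x => //; rewrite subrr nm0. Qed.

Lemma K_sub r r' z : r <= r' -> K r z -> K r' z.
Proof. by move=> rr' [x x01 h]; exists x => //; apply: le_trans rr'. Qed.

Lemma K_near r e z w : K r z -> nm (w - z) <= e -> K (r + e) w.
Proof.
move=> [x x01 h] wz; exists x => //; apply: (le_trans (nm_tri z _ _)).
by rewrite addrC lerD.
Qed.

(** The distance from [z] to [0,1] is attained at [clamp (Re z)], which does not depend on the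
    approximating point; so the bound passes to the limit. *)
Lemma K_closed r z : (forall e, 0 < e -> exists2 w, K r w & nm (z - w) <= e) -> K r z.
Proof.
move=> h; exists (clamp (complex.Re z)); first exact: clamp01.
apply: nm_le_eps => e e0; have [w [x x01 hx] hw] := h _ e0.
apply: (@le_trans _ _ (nm (z - x%:C))); last first.
  by apply: (le_trans (nm_tri w _ _)); rewrite addrC lerD.
rewrite nm_leE ?nm_ge0// nm_sqr; case: z {h hw} => u v /=.
rewrite lerD2r -[leLHS]real_normK ?num_real// -[leRHS]real_normK ?num_real//.
rewrite ler_pXn2r ?nnegrE//.
have := clamp_lip; have /andP[] := x01 => x0 x1 _.
rewrite /clamp; case: (leP 1 u) => hu; rewrite ?(max_idPr (@ler01 R)).
  by rewrite !ger0_norm; lra.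
by case: (leP 0 u) => h; rewrite ?subrr ?normr0// !ler0_norm; lra.
Qed.

(** At boundary points of [K r] too, differentiability is in the plane and not relative to [K r]. *)
Definition hol r (f : C -> C) := forall z, K r z -> exists d, cder f z d.

Lemma hol_sub r r' f : r <= r' -> hol r' f -> hol r f.
Proof. by move=> rr' h z /(K_sub rr')/h. Qed.

Lemma hol_segi r f a b : hol r f -> K r a -> K r b -> segi f a b (seg f a b).
Proof. by move=> h ha hb; apply: segi_exists => t t01; apply/h/K_convex. Qed.

Definition mid a b := pt a b (1 / 2).

Lemma mid_half a b : (mid a b - a = (b - a) / 2) * (b - mid a b = (b - a) / 2).
Proof.
have h2 : (1 / 2)%:C = 2^-1 :> C by rewrite div1r fmorphV rmorph_nat.
by rewrite /mid /pt h2; split; field.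
Qed.

Lemma K_mid r a b : K r a -> K r b -> K r (mid a b).
Proof. by move=> ha hb; apply: K_convex => //; lra. Qed.

Lemma seg_mid r f a b : hol r f -> K r a -> K r b ->
  seg f a b = seg f a (mid a b) + seg f (mid a b) b.
Proof.
move=> hf ha hb; have [U hU E] := hol_segi hf ha hb.
have [h1 h2] := segi_half hU; rewrite (segE h1) (segE h2) E; ring.
Qed.

Lemma seg_rev r f a b : hol r f -> K r a -> K r b -> seg f b a = - seg f a b.
Proof. by move=> hf ha hb; apply/segE/segi_rev/(hol_segi hf). Qed.

Definition tri f a b c := seg f a b + seg f b c + seg f c a.

(** Each side of the medial triangle is run through twice, in opposite directions, and cancels. *)
Lemma tri_split r f a b c : hol r f -> K r a -> K r b -> K r c ->
  tri f a b c = tri f a (mid a b) (mid c a) + tri f (mid a b) b (mid b c) +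
                tri f (mid c a) (mid b c) c + tri f (mid a b) (mid b c) (mid c a).
Proof.
move=> hf ha hb hc; rewrite /tri.
have [h1 h2 h3] := And3 (K_mid ha hb) (K_mid hb hc) (K_mid hc ha).
rewrite (seg_mid hf ha hb) (seg_mid hf hb hc) (seg_mid hf hc ha).
rewrite (seg_rev hf h1 h3) (seg_rev hf h2 h1) (seg_rev hf h3 h2); ring.
Qed.

Definition per (T : C * C * C) :=
  nm (T.1.2 - T.1.1) + nm (T.2 - T.1.2) + nm (T.1.1 - T.2).

Definition tri3 f (T : C * C * C) := tri f T.1.1 T.1.2 T.2.

Definition K3 r (T : C * C * C) := [/\ K r T.1.1, K r T.1.2 & K r T.2].

(** One of the four subtriangles carries at least a quarter of the integral. The last clause bounds
    the move of the first vertex, so that the first vertices of the nested triangles converge. *)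
Lemma Goursat_step r f T : hol r f -> K3 r T -> exists T',
  [/\ K3 r T', nm (tri3 f T) <= 4 * nm (tri3 f T'), per T' = per T / 2 &
      nm (T'.1.1 - T.1.1) <= per T].
Proof.
case: T => [[a b] c] hf [/= ha hb hc]; rewrite /tri3/per/=.
have [h1 h2 h3] := And3 (K_mid ha hb) (K_mid hb hc) (K_mid hc ha).
have two : nm (2^-1 : C) = 2^-1.
  have -> : 2^-1 = (2^-1)%:C :> C by rewrite fmorphV rmorph_nat.
  by rewrite nm_real ger0_norm.
have [E1 E2 E3] : [/\ mid b c - mid a b = (c - a) / 2,
    mid c a - mid b c = (a - b) / 2 & mid a b - mid c a = (b - c) / 2].
  have h2' : (1 / 2)%:C = 2^-1 :> C by rewrite div1r fmorphV rmorph_nat.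
  by rewrite /mid /pt h2'; split; field.
have [n1 n2 n3] := And3 (nm_ge0 (b - a)) (nm_ge0 (c - b)) (nm_ge0 (a - c)).
have Eab := nmB a b; have Ebc := nmB b c; have Eca := nmB c a.
have Emab : nm (mid a b - a) = nm (b - a) / 2 by rewrite mid_half nmM two.
have Emab' : nm (b - mid a b) = nm (b - a) / 2 by rewrite mid_half nmM two.
have Embc : nm (mid b c - b) = nm (c - b) / 2 by rewrite mid_half nmM two.
have Embc' : nm (c - mid b c) = nm (c - b) / 2 by rewrite mid_half nmM two.
have Emca : nm (mid c a - c) = nm (a - c) / 2 by rewrite mid_half nmM two.
have Emca' : nm (a - mid c a) = nm (a - c) / 2 by rewrite mid_half nmM two.
have F1 : nm (mid b c - mid a b) = nm (a - c) / 2 by rewrite E1 nmM two Eca.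
have F2 : nm (mid c a - mid b c) = nm (b - a) / 2 by rewrite E2 nmM two Eab.
have F3 : nm (mid a b - mid c a) = nm (c - b) / 2 by rewrite E3 nmM two Ebc.
have S := tri_split hf ha hb hc.
set t1 := tri f a (mid a b) (mid c a) in S; set t2 := tri f (mid a b) b (mid b c) in S.
set t3 := tri f (mid c a) (mid b c) c in S; set t4 := tri f (mid a b) (mid b c) (mid c a) in S.
have [B|B1] := lerP (nm (tri f a b c)) (4 * nm t1).
  exists (a, mid a b, mid c a); rewrite /= subrr nm0; split=> //.
    by rewrite [nm (mid c a - _)]nmB F3 Emab Emca'; lra.
  by rewrite !addr_ge0.
have [B|B2] := lerP (nm (tri f a b c)) (4 * nm t2).
  exists (mid a b, b, mid b c); rewrite /=; split=> //.
    by rewrite [nm (mid a b - mid b c)]nmB F1 Emab' Embc; lra.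
  by rewrite Emab; lra.
have [B|B3] := lerP (nm (tri f a b c)) (4 * nm t3).
  exists (mid c a, mid b c, c); rewrite /=; split=> //.
    by rewrite [nm (mid b c - mid c a)]nmB F2 Embc' Emca; lra.
  by rewrite nmB Emca'; lra.
exists (mid a b, mid b c, mid c a); rewrite /=; split=> //.
- have := nmD (t1 + t2 + t3) t4; have := nmD (t1 + t2) t3.
  by have := nmD t1 t2; rewrite -S; lra.
- by rewrite F1 F2 F3; lra.
- by rewrite Emab; lra.
Qed.

(** The sequence [u n - 2P/2^n] increases and stays below the decreasing [u n + 2P/2^n]; its
    supremum is the limit and comes with the rate. *)
Lemma real_geom_limit (u : nat -> R) P :
  (forall n, `|u n.+1 - u n| <= P / 2 ^+ n) ->
  exists l, forall n, `|u n - l| <= 2 * P / 2 ^+ n.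
Proof.
move=> h; pose v n := u n - 2 * P / 2 ^+ n; pose w n := u n + 2 * P / 2 ^+ n.
have half n : P / 2 ^+ n.+1 = P / 2 ^+ n / 2.
  by rewrite exprS; field; rewrite expf_neq0.
have half2 n : 2 * P / 2 ^+ n.+1 = P / 2 ^+ n.
  by rewrite exprS; field; rewrite expf_neq0.
have dbl n : 2 * P / 2 ^+ n = 2 * (P / 2 ^+ n) by rewrite mulrA.
have vS n : v n <= v n.+1.
  by have := h n; rewrite /v half2 dbl ler_norml => /andP[]; lra.
have wS n : w n.+1 <= w n.
  by have := h n; rewrite /w half2 dbl ler_norml => /andP[]; lra.
have vm m n : (m <= n)%N -> v m <= v n.
  by move=> /subnKC <-; elim: (n - m)%N => [|k IH]; rewrite ?addn0// addnS (le_trans IH).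
have wm m n : (m <= n)%N -> w n <= w m.
  by move=> /subnKC <-; elim: (n - m)%N => [|k IH]; rewrite ?addn0// addnS (le_trans _ IH).
have P0 : 0 <= P by have := h 0; rewrite expr0 divr1; apply: le_trans.
have vw m n : v m <= w n.
  apply: (le_trans (vm m (maxn m n) (leq_maxl _ _))).
  apply: (le_trans _ (wm n (maxn m n) (leq_maxr _ _))).
  have : 0 <= 2 * P / 2 ^+ maxn m n by rewrite divr_ge0 ?mulr_ge0 ?exprn_ge0.
  by rewrite /v /w; lra.
pose S := range v; have S0 : S !=set0 by exists (v 0); exists 0.
exists (sup S) => n.
have A : v n <= sup S.
  by apply: ub_le_sup; [exists (w 0) => _ [m _ <-]|exists n].
have B : sup S <= w n by apply: ge_sup => // _ [m _ <-].
by move: A B; rewrite /v /w ler_norml; lra.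
Qed.

Lemma geom_limit (u : nat -> C) P :
  (forall n, nm (u n.+1 - u n) <= P / 2 ^+ n) ->
  exists l, forall n, nm (u n - l) <= 4 * P / 2 ^+ n.
Proof.
move=> h.
have [|x hx] := @real_geom_limit (fun n => complex.Re (u n)) P.
  move=> n; apply: le_trans (h n); apply: le_trans (Re_le_nm _).
  by case: (u n) (u n.+1) => ? ? [].
have [|y hy] := @real_geom_limit (fun n => complex.Im (u n)) P.
  move=> n; apply: le_trans (h n); apply: le_trans (Im_le_nm _).
  by case: (u n) (u n.+1) => ? ? [].
exists (x +i* y) => n; apply: (le_trans (nm_le_ReIm _)).
have := lerD (hx n) (hy n); rewrite -mulrDl -mulrDl -natrD.
by case: (u n).
Qed.

(** The affine part has the primitive [c w + d (w - z)^2 / 2], so only the remainder has to be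
    estimated. *)
Lemma seg_affine f a b z c d e : segi f a b (seg f a b) ->
  (forall t, 0 <= t <= 1 -> nm (f (pt a b t) - (c + d * (pt a b t - z))) <= e) ->
  nm (seg f a b - (c * b + d * (b - z) ^+ 2 / 2 - (c * a + d * (a - z) ^+ 2 / 2)))
    <= e * nm (b - a).
Proof.
move=> hf he; pose A w := c * w + d * (w - z) ^+ 2 / 2.
have dA w : cder A w (c + d * (w - z)).
  have /(cderX 2) h1 := cderB (cder_id w) (cder_cst z w).
  have := cderD (cderM (cder_cst c w) (cder_id w))
    (cderM (cderM (cder_cst d w) h1) (cder_cst 2^-1 w)).
  by congr cder; rewrite /=; field.
have hA : segi (fun w => c + d * (w - z)) a b (A b - A a).
  by apply: (segi_FTC (P := A)) => t _; exact: dA.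
rewrite addrC -mulN1r; apply: (segi_bound (segi_lin (-1) hA hf)) => t t01.
by rewrite mulN1r addrC; exact: he.
Qed.

Lemma Goursat r f a b c : hol r f -> K r a -> K r b -> K r c -> tri f a b c = 0.
Proof.
move=> hf ha hb hc; pose step T := xget T [set T' |
  [/\ K3 r T', nm (tri3 f T) <= 4 * nm (tri3 f T'), per T' = per T / 2 &
      nm (T'.1.1 - T.1.1) <= per T]].
have stepP T : K3 r T -> [/\ K3 r (step T), nm (tri3 f T) <= 4 * nm (tri3 f (step T)),
    per (step T) = per T / 2 & nm ((step T).1.1 - T.1.1) <= per T].
  by move=> hT; rewrite /step; case: xgetP => [T' ->//|] nT; have [T' /nT] := Goursat_step hf hT.
pose T n := iter n step (a, b, c).
have KT n : K3 r (T n) by elim: n => //= n /stepP[].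
set P := per (a, b, c).
have perT n : per (T n) = P / 2 ^+ n.
  elim: n => [|n IH]; first by rewrite expr0 divr1.
  have [_ _ -> _] := stepP _ (KT n); rewrite IH exprS; field.
  by rewrite expf_neq0.
have triT n : nm (tri f a b c) <= 4 ^+ n * nm (tri3 f (T n)).
  elim: n => [|n IH]; first by rewrite expr0 mul1r.
  have [_ h _ _] := stepP _ (KT n); apply: (le_trans IH).
  by rewrite exprSr -mulrA ler_wpM2l// exprn_ge0.
have [z hz] : exists z, forall n, nm ((T n).1.1 - z) <= 4 * P / 2 ^+ n.
  by apply: geom_limit => n; have [_ _ _] := stepP _ (KT n); rewrite perT.
have P0 : 0 <= P by rewrite !addr_ge0 ?nm_ge0.
have small e Q : 0 < e -> 0 <= Q -> exists n, Q / 2 ^+ n < e.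
  move=> e0 Q0; have [n hn] : exists n : nat, Q / e < n%:R.
    by exists (Num.bound (Q / e)); apply: archi_boundP; rewrite divr_ge0// ltW.
  exists n; rewrite ltr_pdivrMr ?exprn_gt0// mulrC -ltr_pdivrMr//.
  by apply: (lt_le_trans hn); rewrite -natrX ler_nat ltnW// ltn_expl.
have Kz : K r z.
  apply: K_closed => e e0; have [n hn] := small e (4 * P) e0 (mulr_ge0 (ler0n _ _) P0).
  exists (T n).1.1; first by case: (KT n).
  by rewrite nmB; apply: (le_trans (hz n)); apply: ltW.
have [d dE] := hf _ Kz.
apply/eqP; rewrite -nm_eq0 eq_le nm_ge0 andbT; apply: nm_le_eps => e e0; rewrite add0r.
(* With [h = P / 2^n], points of the [n]-th triangle lie within [5 h] of [z]: [4 h] from its first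
   vertex to the limit and [h] for the perimeter. The integral is then at most [e' * 5 h * h], and
   the factor [4^n] turns this into [5 P^2 e']. *)
have E0 : 0 < 1 + 5 * P * P by rewrite ltr_pwDl// !mulr_ge0.
pose e' := e / (1 + 5 * P * P); have e'0 : 0 < e' by rewrite divr_gt0.
have [del del0 hd] := dE _ e'0.
have [n hn] := small del (5 * P) del0 (mulr_ge0 (ler0n _ _) P0).
apply: (le_trans (triT n)).
have Kn := KT n; have := hz n; have := perT n; case: (T n) Kn => [[p q] s] [/= kp kq ks].
rewrite /per/tri3/tri/= => pq pz.
have [n1 n2 n3] := And3 (nm_ge0 (q - p)) (nm_ge0 (s - q)) (nm_ge0 (p - s)).
set h := P / 2 ^+ n in pq; have h0 : 0 <= h by rewrite -pq !addr_ge0.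
have E5 : 5 * P / 2 ^+ n = 5 * h by rewrite mulrA.
have E4 : 4 * P / 2 ^+ n = 4 * h by rewrite mulrA.
rewrite E4 in pz; rewrite E5 in hn.
have near x y t : 0 <= t <= 1 -> nm (x - p) + nm (y - x) <= h ->
   nm (f (pt x y t) - (f z + d * (pt x y t - z))) <= e' * (5 * h).
  move=> /andP[t0 t1] hxy; have B : nm (pt x y t - z) <= 5 * h.
    have -> : pt x y t - z = t%:C * (y - x) + (x - p) + (p - z) by rewrite /pt; ring.
    apply: (le_trans (nmD _ _)); have := nmD (t%:C * (y - x)) (x - p).
    rewrite nmM nm_real ger0_norm//.
    have : t * nm (y - x) <= 1 * nm (y - x) by rewrite ler_wpM2r ?nm_ge0.
    by lra.
  rewrite opprD addrA; apply: (le_trans (hd _ _)); first exact: le_lt_trans hn.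
  by rewrite ler_wpM2l// ltW.
have c1 : nm (p - p) + nm (q - p) <= h by rewrite subrr nm0; lra.
have c2 : nm (q - p) + nm (s - q) <= h by lra.
have c3 : nm (s - p) + nm (p - s) <= h.
  by have := nm_tri q s p; lra.
have b1 := seg_affine (hol_segi hf kp kq) (fun t t01 => near p q t t01 c1).
have b2 := seg_affine (hol_segi hf kq ks) (fun t t01 => near q s t t01 c2).
have b3 := seg_affine (hol_segi hf ks kp) (fun t t01 => near s p t t01 c3).
pose A w := f z * w + d * (w - z) ^+ 2 / 2.
rewrite -!/(A _) in b1 b2 b3.
(* The increments of the primitive [A] of the affine part cancel around the triangle. *)
have -> : seg f p q + seg f q s + seg f s p = (seg f p q - (A q - A p)) +
  (seg f q s - (A s - A q)) + (seg f s p - (A p - A s)) by ring.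
apply: (@le_trans _ _ (4 ^+ n * (e' * (5 * h) * h))).
  rewrite ler_wpM2l ?exprn_ge0//; apply: (le_trans (nmD _ _)).
  have := nmD (seg f p q - (A q - A p)) (seg f q s - (A s - A q)).
  by rewrite -[X in _ <= _ * X]pq !mulrDr; lra.
have -> : 4 ^+ n * (e' * (5 * h) * h) = e' * (5 * P * P).
  rewrite /h (_ : 4 = 2 * 2 :> R); last by rewrite -natrM.
  by rewrite exprMn; field; rewrite expf_neq0.
rewrite /e' mulrAC ler_pdivrMr// ler_wpM2l ?(ltW e0)//; lra.
Qed.

(** The primitive is the integral from 0: [K r] is convex, and by [Goursat] its increment from [z]
    to [w] is the integral over the chord. The smaller radius [r'] leaves room for every [w] near
    [z]. *)
Lemma Goursat_primitive r r' f : 0 <= r' < r -> hol r f ->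
  exists P, forall z, K r' z -> cder P z (f z).
Proof.
move=> /andP[r'0 r'r] hf; exists (fun z => seg f 0 z) => z hz e e0.
have [d dE] := hf _ (K_sub (ltW r'r) hz).
have [del del0 hd] := cder_cont dE e0.
exists (Num.min del (r - r')); first by rewrite lt_min del0 subr_gt0.
move=> w; rewrite lt_min => /andP[w1 w2].
have Kz := K_sub (ltW r'r) hz.
have Kw : K r w by have := K_near hz (ltW w2); rewrite addrC subrK.
have K0 : K r 0 by apply: (@K_real r 0); rewrite ?lexx ?ler01 ?(le_trans r'0 (ltW r'r)).
have := Goursat hf K0 Kz Kw; rewrite /tri (seg_rev hf K0 Kw) => /eqP.
rewrite subr_eq0 => /eqP <-.
rewrite [X in X - _](_ : _ = seg f z w); last by ring.
rewrite addrC -mulN1r.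
apply: (segi_bound (segi_lin (-1) (segi_cst (f z) z w) (hol_segi hf Kz Kw))).
move=> t /andP[t0 t1]; rewrite mulN1r addrC.
apply: hd; apply: le_lt_trans w1.
rewrite (_ : pt z w t - z = t%:C * (w - z)); last by rewrite /pt; ring.
by rewrite nmM nm_real ger0_norm// ler_piMl ?nm_ge0.
Qed.

End Goursat.

(** * Cauchy's formula on a polygon *)

Section Contour.
Variable R : realType.
Local Notation C := (Cplx R).
Implicit Types (x y z w a b c : C) (r d e s t : R) (n : nat) (v : nat -> C).

Definition onp n v (ze : C) := exists2 k, (k < n)%N &
  exists2 t : R, 0 <= t <= 1 & ze = pt (v k) (v k.+1) t.

Definition pint n v (f : C -> C) : C := \sum_(k < n) seg f (v k) (v k.+1).

Definition plen n v : R := \sum_(k < n) nm (v k.+1 - v k).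

Definition pdiff n v (f : C -> C) := forall ze, onp n v ze -> exists f' : C, cder f ze f'.

Lemma plen_ge0 n v : 0 <= plen n v.
Proof. by apply: sumr_ge0 => k _; exact: nm_ge0. Qed.

Lemma pdiff_segi n v f k : pdiff n v f -> (k < n)%N ->
  segi f (v k) (v k.+1) (seg f (v k) (v k.+1)).
Proof. by move=> h kn; apply: segi_exists => t t01; apply: h; exists k => //; exists t. Qed.

Lemma pint_lin n v c f g : pdiff n v f -> pdiff n v g ->
  pint n v (fun z => c * f z + g z) = c * pint n v f + pint n v g.
Proof.
move=> hf hg; rewrite /pint mulr_sumr -big_split; apply: eq_bigr => k _.
by apply: segE; apply: segi_lin; apply: pdiff_segi => //.
Qed.

Lemma pint_ext n v f g : pdiff n v f -> (forall ze, onp n v ze -> f ze = g ze) ->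
  pint n v f = pint n v g.
Proof.
move=> hf fg; apply: eq_bigr => k _; apply/esym/segE.
apply: segi_ext (pdiff_segi hf (ltn_ord k)) => t t01.
by apply: fg; exists (k : nat) => //; exists t.
Qed.

Lemma pint_bound n v f M : pdiff n v f -> (forall ze, onp n v ze -> nm (f ze) <= M) ->
  nm (pint n v f) <= M * plen n v.
Proof.
move=> hf hM; rewrite /plen mulr_sumr; apply: (le_trans (nm_sum _ _ _)).
apply: ler_sum => k _; apply: segi_bound (pdiff_segi hf (ltn_ord k)) _ => t t01.
by apply: hM; exists (k : nat) => //; exists t.
Qed.

Lemma pint_FTC n v P f : v n = v 0 -> (forall ze, onp n v ze -> cder P ze (f ze)) ->
  pint n v f = 0.
Proof.
move=> v0 h; rewrite /pint.
under eq_bigr => k _.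
  rewrite (segE (I := P (v k.+1) - P (v k))); last first.
    by apply: segi_FTC => t t01; apply: h; exists (k : nat) => //; exists t.
  over.
rewrite -(big_mkord xpredT (fun k => P (v k.+1) - P (v k))).
by rewrite (telescope_sumr (fun k => P (v k)))//= v0 subrr.
Qed.

Lemma pdiff_bounded n v f : pdiff n v f ->
  exists2 M, 0 <= M & forall ze, onp n v ze -> nm (f ze) <= M.
Proof.
move=> h.
have /choice[M hM] : forall k : nat, exists M, (k < n)%N -> 0 <= M /\
    forall t, 0 <= t <= 1 -> nm (f (pt (v k) (v k.+1) t)) <= M.
  move=> k; have [kn|kn] := ltnP k n; last by exists 0.
  have [|M M0 hM] := @seg_bounded R f (v k) (v k.+1); last by exists M.
  by move=> t t01; apply: h; exists k => //; exists t.
exists (\sum_(k < n) M k); first by apply: sumr_ge0 => k _; case: (hM k).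
move=> _ [k kn [t t01 ->]]; apply: (@le_trans _ _ (M k)); first by apply: (hM k kn).2.
rewrite (bigD1 (Ordinal kn))//= lerDl; apply: sumr_ge0 => j _.
by case: (hM j).
Qed.

Lemma pdiffM n v f g : pdiff n v f -> pdiff n v g -> pdiff n v (fun z => f z * g z).
Proof.
by move=> hf hg ze h; have [d1 h1] := hf _ h; have [d2 h2] := hg _ h; eexists; exact: (cderM h1 h2).
Qed.

Lemma pdiff_lin n v c f g : pdiff n v f -> pdiff n v g -> pdiff n v (fun z => c * f z + g z).
Proof.
move=> hf hg ze h; have [d1 h1] := hf _ h; have [d2 h2] := hg _ h; eexists.
exact: (cderD (cderM (cder_cst c ze) h1) h2).
Qed.

Lemma cder_invB z w : w - z != 0 ->
  cder (fun u => (u - z)^-1) w (- ((w - z)^-1 * (w - z)^-1)).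
Proof.
move=> wz; have h : cder (fun u => u - z) w 1.
  by have := cderB (cder_id w) (cder_cst z w); rewrite subr0.
by have := @cderV _ (fun u => u - z) _ _ wz h; rewrite expr2 invfM mulN1r.
Qed.

Lemma pdiff_cauchy n v z d : 0 < d -> (forall ze, onp n v ze -> d <= nm (ze - z)) ->
  pdiff n v (fun ze => (ze - z)^-1).
Proof.
move=> d0 hd ze h; eexists; apply: cder_invB; by rewrite -nm_gt0 (lt_le_trans d0)// hd.
Qed.

(** Differentiation under the integral through the exact remainder
    [(w - z)^2 / ((ze - w) (ze - z)^2)] of the kernel, which is at most [2 / d^3] times [|w - z|^2]
    once [|w - z| < d / 2]. *)
Lemma cauchy_kernel n v phi z d : 0 < d -> pdiff n v phi ->
  (forall ze, onp n v ze -> d <= nm (ze - z)) ->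
  cder (fun z => pint n v (fun ze => phi ze * (ze - z)^-1)) z
       (pint n v (fun ze => phi ze * ((ze - z)^-1 * (ze - z)^-1))).
Proof.
move=> d0 hphi hd e e0; have [M M0 hM] := pdiff_bounded hphi.
pose B := M * (2 / d * d^-1 * d^-1) * plen n v.
have B0 : 0 <= B.
  by rewrite !mulr_ge0 ?plen_ge0 ?invr_ge0 ?(ltW d0).
have B1 : 0 < 1 + B by rewrite ltr_pwDl.
exists (Num.min (d / 2) (e / (1 + B))); first by rewrite lt_min !divr_gt0.
move=> w; rewrite lt_min => /andP[w1 w2].
have d20 : 0 < d / 2 by rewrite divr_gt0.
have hw ze : onp n v ze -> d / 2 <= nm (ze - w).
  by move=> /hd h; have := nm_tri w ze z; lra.
have [p1 p2] : pdiff n v (fun ze => phi ze * (ze - z)^-1) /\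
    pdiff n v (fun ze => phi ze * (ze - w)^-1).
  by split; apply: pdiffM => //; [exact: pdiff_cauchy hd|exact: pdiff_cauchy hw].
have p3 : pdiff n v (fun ze => phi ze * ((ze - z)^-1 * (ze - z)^-1)).
  by apply: pdiffM => //; apply: pdiffM; exact: pdiff_cauchy hd.
rewrite -[X in nm X](_ : pint n v (fun ze => - (w - z) * (phi ze * ((ze - z)^-1 * (ze - z)^-1))
   + ((-1) * (phi ze * (ze - z)^-1) + phi ze * (ze - w)^-1)) = _); last first.
  by rewrite !pint_lin//; [ring|exact: pdiff_lin].
apply: (@le_trans _ _ (M * (2 / d * d^-1 * d^-1) * nm (w - z) ^+ 2 * plen n v)); last first.
  rewrite mulrAC -/B expr2 mulrA ler_wpM2r ?nm_ge0//.
  rewrite (le_trans (_ : _ <= (1 + B) * nm (w - z)))//.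
    by rewrite ler_wpM2r ?nm_ge0// lerDr.
  by rewrite mulrC -ler_pdivlMr// ltW.
apply: pint_bound; first by apply: pdiff_lin => //; exact: pdiff_lin.
move=> ze hz; have := hd ze hz; have := hw ze hz => a1 a2.
have z1 : ze - z != 0 by rewrite -nm_gt0 (lt_le_trans d0).
have z2 : ze - w != 0 by rewrite -nm_gt0 (lt_le_trans d20).
rewrite (_ : _ + _ = phi ze * ((ze - w)^-1 * (ze - z)^-1 * (ze - z)^-1) * (w - z) ^+ 2); last first.
  by field; rewrite z1 z2.
rewrite nmM nmX ler_wpM2r ?exprn_ge0 ?nm_ge0// nmM ler_pM ?nm_ge0 ?hM//.
rewrite !nmM !nmV ler_pM ?mulr_ge0 ?invr_ge0 ?nm_ge0//.
  rewrite ler_pM ?invr_ge0 ?nm_ge0//.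
    by rewrite -[2 / d]invf_div lef_pV2 ?posrE ?(lt_le_trans d20).
  by rewrite lef_pV2 ?posrE ?(lt_le_trans d0).
by rewrite lef_pV2 ?posrE ?(lt_le_trans d0).
Qed.

(** The factor $1/(2\pi i)$ is left out, since only non-vanishing is used. *)
Definition winding n v z := pint n v (fun ze => (ze - z)^-1).

(** Non-vanishing is asked at the point 1/2 alone; [winding_cst] carries it to all of [K r0]. *)
Definition contour r0 r d n v :=
  [/\ v n = v 0, forall k, (k <= n)%N -> K r (v k),
      0 < d /\ (forall ze z, onp n v ze -> K r0 z -> d <= nm (ze - z)) &
      winding n v (2^-1) != 0].

Section Cauchy.
Variables (r0 r d : R) (n : nat) (v : nat -> C).
Hypotheses (r00 : 0 <= r0) (r0r : r0 < r) (cv : contour r0 r d n v).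

Lemma onp_K ze : onp n v ze -> K r ze.
Proof.
case: cv => _ hK _ _ [k kn [t t01 ->]]; apply: K_convex => //; apply: hK => //.
exact: ltnW.
Qed.

Let d0 : 0 < d. Proof. by case: cv => _ _ []. Qed.
Let dd ze z : onp n v ze -> K r0 z -> d <= nm (ze - z).
Proof. by case: cv => _ _ [_ h] _; exact: h. Qed.

Lemma hol_pdiff f r1 : r <= r1 -> hol r1 f -> pdiff n v f.
Proof. by move=> rr hf ze /onp_K/(K_sub rr)/hf. Qed.

(** The derivative in [z] is the integral of [(ze - z)^-2], which has the primitive [- (ze - z)^-1]
    along the closed polygon and so is 0; and [K r0] is convex. *)
Lemma winding_cst z : K r0 z -> winding n v z = winding n v 2^-1.
Proof.
move=> hz.
have h2 : K r0 (2^-1 : C).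
  have -> : 2^-1 = (2^-1)%:C :> C by rewrite fmorphV rmorph_nat.
  by apply: K_real => //; lra.
have dW w : K r0 w -> cder (winding n v) w 0.
  move=> hw; have p1 : pdiff n v (fun=> 1) by move=> ze _; exists 0; exact: cder_cst.
  have := cauchy_kernel d0 p1 (fun ze h => dd h hw); congr cder.
    by apply/funext => u; rewrite /winding; congr (pint n v _); apply/funext => ze; exact: mul1r.
  case: cv => v0 _ _ _.
  apply: (@pint_FTC _ _ (fun ze => - (ze - w)^-1)) => // ze hze.
  have z1 : ze - w != 0 by rewrite -nm_gt0 (lt_le_trans d0)// dd.
  by have := cderN (cder_invB z1); rewrite opprK mul1r.
apply/eqP; rewrite -subr_eq0 -nm_eq0 eq_le nm_ge0 andbT.
rewrite -(mul0r (nm (z - 2^-1))).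
apply: (segi_bound (segi_FTC (P := winding n v) (f := fun=> 0) _)) => t t01.
  exact/dW/K_convex.
by rewrite nm0.
Qed.

(** This stands in for the removable singularity theorem. As the derivative [f] of [P] is itself
    differentiable at [z], [P] has a second-order expansion there, and the filled-in quotient has
    derivative [f'(z) / 2]. *)
Lemma second_order P f z r1 r2 : r1 < r2 -> (forall w, K r2 w -> cder P w (f w)) ->
  (exists d' : C, cder f z d') -> K r1 z ->
  exists d' : C, cder (fun w => if w == z then f z else (P w - P z) / (w - z)) z d'.
Proof.
move=> r12 dP [d' dE] hz; exists (d' / 2) => e e0.
have [del del0 hd] := dE _ e0.
exists (Num.min del (r2 - r1)); first by rewrite lt_min del0 subr_gt0.
move=> w; rewrite lt_min eqxx => /andP[w1 w2].
have Kw : K r2 w by have := K_near hz (ltW w2); rewrite addrC subrK.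
have Kz := K_sub (ltW r12) hz.
case: eqVneq => [->|wz]; first by rewrite !subrr mulr0 subr0 nm0 mulr0.
have hS : segi f z w (P w - P z) by apply: segi_FTC => t t01; apply/dP/K_convex.
have := @seg_affine R f z w z (f z) d' (e * nm (w - z)) (segi_seg hS).
rewrite (segE hS) => /(_ _)h.
have wz0 : w - z != 0 by rewrite subr_eq0.
rewrite -(ler_pM2r (_ : 0 < nm (w - z))) ?nm_gt0//.
rewrite -nmM (_ : _ * (w - z) = P w - P z -
  (f z * w + d' * (w - z) ^+ 2 / 2 - (f z * z + d' * (z - z) ^+ 2 / 2))); last by field.
apply: h => t /andP[t0 t1].
have E : pt z w t - z = t%:C * (w - z) by rewrite /pt; ring.
have L : nm (pt z w t - z) <= nm (w - z).
  by rewrite E nmM nm_real ger0_norm// ler_piMl ?nm_ge0.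
rewrite opprD addrA (le_trans (hd _ _)) ?(le_lt_trans L)//.
by rewrite ler_wpM2l ?(ltW e0).
Qed.

(** Cauchy's formula is first shown for functions whose derivative is known to be differentiable: by
    [second_order] their difference quotient at [z] is holomorphic, hence has a primitive and
    integrates to 0. *)
Lemma Cauchy_primitive P f r2 z : r < r2 ->
  (forall w, K r2 w -> cder P w (f w)) -> hol r2 f -> K r0 z ->
  pint n v (fun ze => P ze * (ze - z)^-1) = P z * winding n v z.
Proof.
move=> rr2 dP hf hz.
pose q w := if w == z then f z else (P w - P z) / (w - z).
have r0r2 := lt_trans r0r rr2.
have hq r1 : r1 < r2 -> hol r1 q.
  move=> r12 w hw; have [->|wz] := eqVneq w z.
    by apply: (second_order r0r2 dP) => //; apply/hf/(K_sub (ltW r0r2)).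
  have wz0 : w - z != 0 by rewrite subr_eq0.
  have D1 := cderB (dP w (K_sub (ltW r12) hw)) (cder_cst (P z) w).
  have D2 := cder_invB wz0.
  eexists; apply: (@cder_ext R _ q w _ (nm (w - z))) (cderM D1 D2); first by rewrite nm_gt0.
  move=> u hu; rewrite /q; case: eqVneq hu => // ->.
  by rewrite nmB ltxx.
have [Q hQ] : exists Q, forall w, K r w -> cder Q w (q w).
  apply: (@Goursat_primitive R ((r + r2) / 2)); last by apply: hq; lra.
  have h1 := r00; have h2 := r0r; apply/andP; split.
    by lra.
  by lra.
have I0 : pint n v q = 0.
  by case: cv => v0 _ _ _; apply: (@pint_FTC _ _ Q) => // ze /onp_K; exact: hQ.
have PP : pdiff n v P by move=> ze /onp_K/(K_sub (ltW rr2))/dP h; eexists; exact: h.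
have Pk := pdiff_cauchy d0 (fun ze h => dd h hz).
have E : pint n v q = pint n v (fun ze => (- P z) * (ze - z)^-1 + P ze * (ze - z)^-1).
  apply: pint_ext; first exact: (hol_pdiff (lexx r) (hq _ rr2)).
  move=> ze hze; have z1 : ze - z != 0 by rewrite -nm_gt0 (lt_le_trans d0)// dd.
  by move: z1; rewrite subr_eq0 /q => /negbTE ->; ring.
move: I0; rewrite E pint_lin//; last exact: pdiffM.
by move/eqP; rewrite mulNr addrC subr_eq0 => /eqP.
Qed.

(** The formula for a primitive [P] of [f] is differentiated in [z]: the integral of
    [P / (ze - z)^2] is [f z] times the winding integral. Integration by parts along the closed
    polygon replaces it by the integral of [f / (ze - z)]. *)
Lemma Cauchy_formula f r2 r1 z : r < r2 -> hol r2 f -> r1 < r0 -> K r1 z ->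
  pint n v (fun ze => f ze * (ze - z)^-1) = f z * winding n v 2^-1.
Proof.
move=> rr2 hf r10 hz; have h1 := r00; have h2 := r0r.
have [P dP] : exists P, forall w, K ((r + r2) / 2) w -> cder P w (f w).
  by apply: (@Goursat_primitive R r2) => //; apply/andP; split; lra.
have Kz := K_sub (ltW r10) hz.
have PP : pdiff n v P.
  by move=> ze /onp_K /(@K_sub _ _ ((r + r2) / 2))h; eexists; apply: dP; apply: h; lra.
have Pf := hol_pdiff (ltW rr2) hf.
have hd ze : onp n v ze -> d <= nm (ze - z) by move=> h; exact: dd.
have D1 := cauchy_kernel d0 PP hd.
have Pk := pdiff_cauchy d0 hd.
have D2 : cder (fun z => pint n v (fun ze => P ze * (ze - z)^-1)) z (f z * winding n v 2^-1).
  have r010 : 0 < r0 - r1 by rewrite subr_gt0.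
  have dPz : cder P z (f z) by apply: dP; apply: K_sub Kz; lra.
  have := cderM dPz (cder_cst (winding n v 2^-1) z); rewrite mulr0 add0r mulrC.
  apply: (@cder_ext R _ _ _ _ (r0 - r1)) => // w hw.
  have Kw : K r0 w by have := K_near hz (ltW hw); rewrite addrC subrK.
  rewrite (@Cauchy_primitive P f ((r + r2) / 2)) ?winding_cst//; first lra.
  by apply: hol_sub hf; lra.
rewrite (cder_unique D2 D1).
apply/eqP; rewrite -subr_eq0.
have := pint_lin (-1) (pdiffM PP (pdiffM Pk Pk)) (pdiffM Pf Pk).
rewrite mulN1r addrC => <-; apply/eqP; case: cv => v0 _ _ _.
apply: (@pint_FTC _ _ (fun ze => P ze * (ze - z)^-1)) => // ze hze.
have z1 : ze - z != 0 by rewrite -nm_gt0 (lt_le_trans d0)// hd.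
have dPz : cder P ze (f ze).
  by apply: dP; apply: (@K_sub _ r); [lra|exact: onp_K].
have := cderM dPz (cder_invB z1); congr cder.
by ring.
Qed.

End Cauchy.
End Contour.

(** * A polygon around the unit interval *)

Section Stadium.
Variable R : realType.
Local Notation C := (Cplx R).
Implicit Types (x y z w : C) (c s t : R) (n : nat) (v : nat -> C).

(** The argument of [ze - h] grows along an edge that runs counterclockwise around [h]. The cross
    product of [ze - h] and [q - p] is constant on the edge and equals that of [p - h] and [q - h];
    divided by [|ze - h|^2] it is the imaginary part of the integrand. *)
Lemma Im_seg_inv (p q h : C) :
  (forall t, 0 <= t <= 1 -> pt p q t != h) ->
  0 < complex.Re (p - h) * complex.Im (q - h) - complex.Im (p - h) * complex.Re (q - h) ->
  0 < complex.Im (seg (fun ze => (ze - h)^-1) p q).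
Proof.
move=> ph cr; have [U hU ->] : segi (fun ze => (ze - h)^-1) p q (seg (fun ze => (ze - h)^-1) p q).
  by apply: segi_exists => t /ph th; eexists; apply: cder_invB; rewrite subr_eq0.
have ImE (u : C) : complex.Im u = complex.Re (- 'i%C * u) by case: u => ? ? /=; ring.
pose phi s := complex.Re (- 'i%C * U s).
pose dphi s := complex.Re (- 'i%C * ((pt p q s - h)^-1 * (q - p))).
have dP s : 0 <= s <= 1 -> rd phi s (dphi s) by move=> /hU; exact: rcder_Re.
have [||s s01 E] := @MVT_segment R phi dphi 0 1 ler01.
- by move=> x /andP[]; rewrite !bnd_simp => x0 x1; apply/is_derive_rd/dP; rewrite !ltW.
- apply: continuous_in_subspaceT => x; rewrite inE/= in_itv/= => /dP.
  exact: rd_cont.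
rewrite ImE mulrBr (_ : complex.Re _ = phi 1 - phi 0); last first.
  by rewrite /phi; case: (U 1) (U 0) => ? ? [].
rewrite E subr0 mulr1 /dphi -ImE.
have s01' : 0 <= s <= 1 by move: s01; rewrite in_itv.
set ze := pt p q s - h; have ze0 : ze != 0 by rewrite subr_eq0 ph.
have nh2 : 0 < nm ze ^+ 2 by rewrite exprn_gt0// nm_gt0.
rewrite -(pmulr_rgt0 _ nh2) nm_sqr; move: cr; congr (0 < _).
set X := ze^-1 * (q - p).
have XE : q - p = ze * X by rewrite /X mulrA divff// mul1r.
have qE : q - h = ze + (1 - s)%:C * (ze * X) by rewrite -XE /ze /pt rmorphB rmorph1; ring.
have pE : p - h = ze - s%:C * (ze * X) by rewrite -XE /ze /pt; ring.
rewrite qE pE; case: (ze) (X) => [a b] [c d] /=; ring.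
Qed.

Lemma clamp_mono s t : s <= t -> clamp s <= clamp t.
Proof.
move=> st; rewrite /clamp.
case: (leP 1 s) => hs; case: (leP 1 t) => ht; rewrite ?(max_idPr (@ler01 R)).
- by [].
- by lra.
- by case: (leP 0 s) => h; lra.
- by case: (leP 0 t) => h; case: (leP 0 s) => h'; lra.
Qed.

Lemma sqrt_near (a b e : R) : 0 <= a -> 0 <= b -> 0 <= e -> `|a - b| <= e ^+ 2 ->
  `|Num.sqrt a - Num.sqrt b| <= e.
Proof.
move=> a0 b0 e0.
wlog ba : a b a0 b0 / b <= a.
  move=> h; have [/h|/ltW /h] := leP b a; first exact.
  by rewrite distrC => h' ab; rewrite distrC; apply: h'.
have sba : Num.sqrt b <= Num.sqrt a by rewrite ler_sqrt.
rewrite !ger0_norm ?subr_ge0// => h.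
rewrite -(ler_pXn2r (_ : 0 < 2)%N) ?nnegrE ?subr_ge0//; apply: le_trans h.
have sa := sqr_sqrtr a0; have sb := sqr_sqrtr b0.
have := sqrtr_ge0 b; have := sqrtr_ge0 a.
by move: sa sb sba; set u := Num.sqrt a; set w := Num.sqrt b => <- <-; nra.
Qed.

Section Vertices.
Variables (r0 r : R).
Hypotheses (r00 : 0 < r0) (r0r : r0 < r).
Let r' := (r0 + r) / 2.
(** Chosen so that [r * eta = r - r']: while the centre moves, that is for [|c| <= eta], the height
    [r sqrt (1 - c^2)] alone is at least [r'] by [etar]. *)
Let eta := 1 - r' / r.

(** The centre of the disc whose boundary carries the vertex of abscissa [c]: moving it from [0] to
    [1] while [c] crosses [-eta, eta] turns the circle into an almost constant-distance curve
    around [0,1]. *)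
Let S c := clamp (1 / 2 + c / (2 * eta)).
Let V c : C := (S c + r * c) +i* (r * Num.sqrt (1 - c ^+ 2)).

Let eta01 : 0 < eta < 1.
Proof.
have h := r00; have h' := r0r; have r_gt0 : 0 < r by lra.
by rewrite /eta /r' ltrBlDr ltrDl divr_gt0 ?subr_gt0 ?ltr_pdivrMr//; lra.
Qed.

Let etar : r' ^+ 2 <= r ^+ 2 * (1 - eta ^+ 2).
Proof.
have h := r00; have h' := r0r; have r_gt0 : 0 < r by lra.
have E : r * eta = r - r' by rewrite /eta mulrBr mulr1 mulrC divfK// gt_eqF.
have -> : r ^+ 2 * (1 - eta ^+ 2) = r ^+ 2 - (r - r') ^+ 2 by rewrite -E; ring.
by rewrite /r'; nra.
Qed.

Let S_ge c : eta <= c -> S c = 1.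
Proof.
have /andP[h _] := eta01 => hc; rewrite /S /clamp (min_idPl _) ?(max_idPr _)//.
rewrite -lerBlDl ler_pdivlMr ?mulr_gt0//; lra.
Qed.

Let S_le c : c <= - eta -> S c = 0.
Proof.
have /andP[h _] := eta01 => hc; rewrite /S /clamp (max_idPl _)//.
rewrite ge_min; apply/orP; right; rewrite -lerBrDl ler_pdivrMr ?mulr_gt0//; lra.
Qed.

Let S_mono c c' : c <= c' -> S c <= S c'.
Proof.
have /andP[h _] := eta01 => hc; rewrite /S clamp_mono//.
by rewrite lerD2l ler_pM2r// invr_gt0 mulr_gt0//.
Qed.

Let S0 : S 0 = 1 / 2.
Proof. by rewrite /S mul0r addr0 clamp_id//; lra. Qed.

(** For [|c| >= eta] the centre is the end of [0,1] on the side of [V c], and the distance is at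
    least [r]; in between the height suffices. *)
Let V_far c (x : R) : -1 <= c <= 1 -> 0 <= x <= 1 -> r' <= nm (V c - x%:C).
Proof.
move=> c11 /andP[x0 x1]; have h := r00; have h' := r0r; have r_gt0 : 0 < r by lra.
have c2 : 0 <= 1 - c ^+ 2 by nra.
have /andP[e0 e1] := eta01.
rewrite nm_geE /=; last by rewrite /r'; lra.
rewrite subr0 [(r * _) ^+ 2]exprMn sqr_sqrtr//; apply: (le_trans etar).
have [ce|ce] := lerP eta c.
  rewrite S_ge//; have : 0 <= r * c by rewrite mulr_ge0//; lra.
  have : 0 <= eta ^+ 2 by rewrite sqr_ge0.
  by nra.
have [ce'|ce'] := lerP c (- eta).
  rewrite S_le//; have : r * c <= 0 by rewrite mulr_ge0_le0//; lra.
  have : 0 <= eta ^+ 2 by rewrite sqr_ge0.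
  by nra.
rewrite -[leLHS]add0r lerD ?sqr_ge0// ler_wpM2l ?sqr_ge0// lerD2l lerN2.
by nra.
Qed.

Let V_K c : -1 <= c <= 1 -> K r (V c).
Proof.
move=> c11; have h := r00; have h' := r0r; have r_gt0 : 0 < r by lra.
have c2 : 0 <= 1 - c ^+ 2 by nra.
exists (S c); first exact: clamp01.
rewrite nm_leE ?(ltW r_gt0)//= ?oppr0 ?addr0 ?subr0 [(r * Num.sqrt _) ^+ 2]exprMn sqr_sqrtr//.
by rewrite le_eqVlt; apply/orP; left; apply/eqP; ring.
Qed.

(** Counterclockwise order around 1/2: the real offset [m] decreases with [c] and changes sign at
    [c = 0], where [S 0 = 1 / 2]. The condition [c - c' < 2] excludes the pair 1, -1, whose points
    are collinear with 1/2. *)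
Let V_cross c c' : -1 <= c' -> c' < c -> c <= 1 -> c - c' < 2 ->
  0 < complex.Re (V c - 2^-1) * complex.Im (V c' - 2^-1) -
      complex.Im (V c - 2^-1) * complex.Re (V c' - 2^-1).
Proof.
have h := r00; have h' := r0r; have r_gt0 : 0 < r by lra.
move=> c'1 cc c1 cc2.
have -> : 2^-1 = (2^-1)%:C :> C by rewrite fmorphV rmorph_nat.
rewrite /= oppr0 !addr0.
set m := S c + r * c - 2^-1; set m' := S c' + r * c' - 2^-1.
set s := Num.sqrt (1 - c ^+ 2); set s' := Num.sqrt (1 - c' ^+ 2).
rewrite ?subr0.
have s0 : 0 <= s := sqrtr_ge0 _; have s'0 : 0 <= s' := sqrtr_ge0 _.
have mm : m' < m by rewrite /m /m'; have := S_mono (ltW cc); nra.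
have mpos : 0 <= c' -> 0 <= m'.
  by move=> h0; have := S_mono h0; rewrite S0 /m'; nra.
have mneg : c <= 0 -> m <= 0.
  by move=> h0; have := S_mono h0; rewrite S0 /m; nra.
have c2 : 0 <= 1 - c ^+ 2 by nra.
have c'2 : 0 <= 1 - c' ^+ 2 by nra.
have sE : s ^+ 2 = 1 - c ^+ 2 by rewrite sqr_sqrtr.
have s'E : s' ^+ 2 = 1 - c' ^+ 2 by rewrite sqr_sqrtr.
suff : 0 < m * s' - s * m' by nra.
have [p|p] := lerP 0 c'.
  have := mpos p => mp; have ss : s <= s' by rewrite ler_sqrt//; nra.
  have s'p : 0 < s' by rewrite sqrtr_gt0; nra.
  by nra.
have [q|q] := lerP c 0.
  have := mneg q => mp; have ss : s' <= s by rewrite ler_sqrt//; nra.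
  have sp : 0 < s by rewrite sqrtr_gt0; nra.
  by nra.
have mp : 0 < m by have := S_mono (ltW q); rewrite S0 /m; nra.
have mn : m' < 0 by have := S_mono (ltW p); rewrite S0 /m'; nra.
have [c1'|c1'] := ltP c 1.
  have sp : 0 < s by rewrite sqrtr_gt0; nra.
  by nra.
have s'p : 0 < s' by rewrite sqrtr_gt0; nra.
by nra.
Qed.

(** Near [c = 1] and [c = -1] the square root is only Holder continuous of exponent 1/2; hence the
    step [e^2 / 2] in [c] for a step of order [e] on the curve. *)
Let V_step c c' e : -1 <= c <= 1 -> -1 <= c' <= 1 -> 0 <= e <= 1 -> `|c - c'| <= e ^+ 2 / 2 ->
  nm (V c - V c') <= (1 / eta + 2 * r) * e.
Proof.
have h := r00; have h' := r0r; have r_gt0 : 0 < r by lra.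
have /andP[e0 e1] := eta01.
move=> /andP[c0 c1] /andP[c0' c1'] /andP[e00 e11] hc.
have c2 : 0 <= 1 - c ^+ 2 by nra.
have c'2 : 0 <= 1 - c' ^+ 2 by nra.
have hce : `|c - c'| <= e by apply: (le_trans hc); nra.
apply: (le_trans (nm_le_ReIm _)); rewrite /=.
have h1 : `|S c - S c'| <= e / eta.
  apply: (le_trans (clamp_lip _ _)).
  have -> : 1 / 2 + c / (2 * eta) - (1 / 2 + c' / (2 * eta)) = (c - c') / (2 * eta).
    by field; rewrite gt_eqF.
  rewrite normrM [`|(2 * eta)^-1|]ger0_norm ?invr_ge0 ?mulr_ge0 ?(ltW e0)//.
  rewrite ler_pM ?invr_ge0 ?mulr_ge0 ?(ltW e0)// lef_pV2 ?posrE ?mulr_gt0//.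
  by move: e0; lra.
have h2 : `|Num.sqrt (1 - c ^+ 2) - Num.sqrt (1 - c' ^+ 2)| <= e.
  apply: sqrt_near => //; have -> : 1 - c ^+ 2 - (1 - c' ^+ 2) = (c' - c) * (c' + c) by ring.
  rewrite normrM distrC; apply: (@le_trans _ _ (e ^+ 2 / 2 * 2)); last by rewrite divfK.
  by rewrite ler_pM// ler_norml; lra.
rewrite -mulrBr normrM (gtr0_norm r_gt0).
have -> : S c + r * c - (S c' + r * c') = (S c - S c') + r * (c - c') by ring.
have := ler_normD (S c - S c') (r * (c - c')); rewrite normrM (gtr0_norm r_gt0) => h3.
have := ler_wpM2l (ltW r_gt0) hce; have := ler_wpM2l (ltW r_gt0) h2.
by rewrite mulrDl mul1r [eta^-1 * e]mulrC; lra.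
Qed.

(** The distance [d] is fixed before the edge length, because the expansion of the Cauchy kernel
    needs edges that are short compared with [d]. *)
Lemma contour_exists : exists2 d : R, 0 < d & forall e : R, 0 < e ->
  exists n v, contour r0 r d n v /\ forall k, (k < n)%N -> nm (v k.+1 - v k) <= e.
Proof.
have h := r00; have h' := r0r; have r_gt0 : 0 < r by lra.
have /andP[eta0 eta1] := eta01.
(* Vertices are at least [r' - r0] away from [K r0]; moving along an edge of length at most [d] uses
   up one half of this. *)
pose d := (r' - r0) / 2; have d0 : 0 < d by rewrite /d /r'; lra.
exists d => // e' e'0; pose e := Num.min e' d.
have e0 : 0 < e by rewrite lt_min e'0.
have A0 : 0 < 1 / eta + 2 * r by apply: addr_gt0; [exact: divr_gt0|exact: mulr_gt0].
pose q := Num.min 1 (e / (1 / eta + 2 * r)).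
have q0 : 0 < q by rewrite lt_min ltr01 divr_gt0.
have q1 : q <= 1 by rewrite ge_min lexx.
have qe : (1 / eta + 2 * r) * q <= e by rewrite mulrC -ler_pdivlMr// ge_min lexx orbT.
(* [N >= 2] secures the condition [c - c' < 2] of [V_cross], and [N > 4 / q^2] makes the step
   [2 / N] at most [q^2 / 2]. *)
pose M := Num.bound (4 / q ^+ 2); pose N := M.+2.
have NM : 4 / q ^+ 2 < N%:R.
  apply: (@lt_trans _ _ M%:R); last by rewrite ltr_nat.
  by apply: archi_boundP; rewrite divr_ge0 ?exprn_ge0 ?(ltW q0).
have N0 : 0 < N%:R :> R by rewrite ltr0n.
pose c (k : nat) : R := 1 - 2 * k%:R / N%:R.
have cS k : c k - c k.+1 = 2 / N%:R by rewrite /c -natr1; field; rewrite gt_eqF.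
have stepq : 2 / N%:R <= q ^+ 2 / 2.
  rewrite ler_pdivrMr//; move: NM; rewrite ltr_pdivrMr ?exprn_gt0// => NM; nra.
have N2 : 2 / N%:R < 2 :> R.
  by rewrite ltr_pdivrMr// ltr_pMr// ltr1n.
have N20 : 0 < 2 / N%:R :> R by rewrite divr_gt0.
have c11 k : (k <= N)%N -> -1 <= c k <= 1.
  move=> kN; have k0 : 0 <= k%:R :> R by [].
  have kN' : k%:R <= N%:R :> R by rewrite ler_nat.
  rewrite /c; apply/andP; split; last by rewrite lerBlDr lerDl divr_ge0 ?mulr_ge0// ltW.
  by rewrite lerBrDl -lerBrDr ler_pdivrMr//; lra.
have c0 : c 0 = 1 by rewrite /c mulr0 mul0r subr0.
have cN : c N = -1 by rewrite /c; field; rewrite gt_eqF.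
(* The upper half runs from [1 + r] to [- r]; the rest is its image under the half-turn
   [z |-> 1 - z] about 1/2. *)
pose v (k : nat) : C := if (k <= N)%N then V (c k) else 1 - V (c (k - N)%N).
have V1 : V 1 = 1 - V (-1).
  rewrite /V S_ge ?(ltW eta1)// S_le ?lerN2 ?(ltW eta1)// sqrrN expr1n subrr sqrtr0 !mulr0.
  by apply/eqP; rewrite eq_complex /=; apply/andP; split; apply/eqP; ring.
have vhi k : (N <= k)%N -> v k = 1 - V (c (k - N)%N).
  rewrite leq_eqVlt => /orP[/eqP <-|kN]; last by rewrite /v leqNgt kN.
  by rewrite /v leqnn subnn c0 V1 cN opprB addrC subrK.
have vcase (P : C -> C -> Prop) : (forall k, (k < N)%N -> P (V (c k)) (V (c k.+1))) ->
    (forall k, (k < N)%N -> P (1 - V (c k)) (1 - V (c k.+1))) ->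
    forall k, (k < 2 * N)%N -> P (v k) (v k.+1).
  move=> h1 h2 k k2; have [kN|Nk] := ltnP k N.
    by rewrite /v kN (ltnW kN); exact: h1.
  rewrite !vhi ?subSn ?(leqW Nk)//; apply: h2; rewrite ltn_subLR//.
  by rewrite addnn -mul2n.
have vpt k : (k <= 2 * N)%N -> exists2 c, -1 <= c <= 1 & v k = V c \/ v k = 1 - V c.
  move=> k2; have [kN|Nk] := leqP k N.
    by exists (c k); [exact: c11|left; rewrite /v kN].
  exists (c (k - N)%N); last by right; apply: vhi; exact: ltnW.
  by apply: c11; rewrite leq_subLR addnn -mul2n.
have nmrefl (a b : C) : nm (1 - a - (1 - b)) = nm (a - b).
  by rewrite nmB; congr nm; ring.
have vstep k : (k < 2 * N)%N -> nm (v k.+1 - v k) <= e.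
  move: k; have B k : (k < N)%N -> nm (V (c k.+1) - V (c k)) <= e.
    move=> kN; apply: le_trans qe; apply: V_step; try exact: c11.
    - exact/c11/ltnW.
    - by rewrite (ltW q0).
    - by rewrite distrC cS ger0_norm ?(ltW N20).
  apply: (vcase (fun a b => nm (b - a) <= e)) => // k kN.
  by rewrite nmrefl; exact: B.
have vfar k z : (k <= 2 * N)%N -> K r0 z -> r' - r0 <= nm (v k - z).
  move=> k2 [x x01 hx]; have [b b11 vE] := vpt k k2.
  have : r' <= nm (v k - x%:C).
    case: vE => ->; first exact: V_far.
    have -> : 1 - V b - x%:C = - (V b - (1 - x)%:C) by rewrite rmorphB rmorph1; ring.
    by rewrite nmN; apply: V_far => //; lra.
  by have := nm_tri z (v k) x%:C; lra.
have ponto ze z : onp (2 * N) v ze -> K r0 z -> d <= nm (ze - z).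
  move=> [k kn [t /andP[t0 t1] ->]] hz; have := vfar k z (ltnW kn) hz.
  have := nm_tri (pt (v k) (v k.+1) t) (v k) z; have := vstep k kn.
  have : nm (v k - pt (v k) (v k.+1) t) <= nm (v k.+1 - v k).
    rewrite (_ : _ - _ = - (t%:C * (v k.+1 - v k))); last by rewrite /pt; ring.
    by rewrite nmN nmM nm_real ger0_norm// ler_piMl ?nm_ge0.
  have : e <= d by rewrite ge_min lexx orbT.
  by rewrite /d; lra.
exists (2 * N)%N, v; split; last first.
  by move=> k /vstep h1; apply: (le_trans h1); rewrite ge_min lexx.
split.
- by rewrite vhi ?leq_pmull// mul2n -addnn addnK cN /v c0 V1.
- move=> k /vpt [b b11 [->|->]]; first exact: V_K.
  have [x x01 hx] := V_K b11; exists (1 - x); first lra.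
  by rewrite rmorphB rmorph1 nmrefl.
- by split.
have K2 : K r0 (2^-1 : C).
  have -> : 2^-1 = (2^-1)%:C :> C by rewrite fmorphV rmorph_nat.
  by apply: K_real; [exact: ltW|lra].
have Im_pos k : (k < 2 * N)%N ->
    0 < complex.Im (seg (fun ze => (ze - 2^-1)^-1) (v k) (v k.+1)).
  move=> kn; apply: Im_seg_inv => [t t01|].
    rewrite -subr_eq0 -nm_gt0; apply: (lt_le_trans d0); apply: ponto => //.
    by exists k => //; exists t.
  move: k kn; have B k : (k < N)%N -> 0 < complex.Re (V (c k) - 2^-1) * complex.Im (V (c k.+1) - 2^-1) -
      complex.Im (V (c k) - 2^-1) * complex.Re (V (c k.+1) - 2^-1).
    move=> kN; have /andP[a1 _] := c11 k.+1 kN; have /andP[_ a2] := c11 k (ltnW kN).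
    by apply: V_cross; [exact: a1|rewrite -subr_gt0 cS|exact: a2|rewrite cS].
  apply: (vcase (fun a b => 0 < complex.Re (a - 2^-1) * complex.Im (b - 2^-1) -
      complex.Im (a - 2^-1) * complex.Re (b - 2^-1))) => // k kN.
  have E a : 1 - a - 2^-1 = - (a - 2^-1) :> C by field.
  have := B k kN; rewrite !E.
  move: (V (c k) - 2^-1) (V (c k.+1) - 2^-1) => [a1 a2] [b1 b2] /=.
  by rewrite !mulrNN.
have : 0 < complex.Im (winding (2 * N) v 2^-1).
  have E : complex.Im (winding (2 * N) v 2^-1) =
      \sum_(k < 2 * N) complex.Im (seg (fun ze => (ze - 2^-1)^-1) (v k) (v k.+1)).
    rewrite /winding /pint; elim/big_rec2: _ => //= k a b _ <-.
    by case: (seg _ _ _) (b) => ? ? [].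
  rewrite E (bigD1 (Ordinal (ltn0Sn _ : (0 < 2 * N)%N)))//= ltr_wpDr ?Im_pos//.
  by apply: sumr_ge0 => k _; apply/ltW/Im_pos.
by apply: contraTneq => ->; rewrite ltxx.
Qed.
End Vertices.
End Stadium.

(** * Holomorphic difference quotients *)

Section Quotient.
Variable R : realType.
Local Notation C := (Cplx R).
Implicit Types (x y z w : C) (r d e s t : R) (n : nat) (v : nat -> C).

Lemma pintZ n v (c : C) f : pdiff n v f -> pint n v (fun z => c * f z) = c * pint n v f.
Proof.
move=> hf; have P0 : pdiff n v (fun=> 0) by move=> ze _; exists 0; exact: cder_cst.
have E0 : pint n v (fun=> 0) = 0.
  by apply: big1 => k _; apply: segE; rewrite -[X in segi _ _ _ X](mul0r (v k.+1 - v k)); exact: segi_cst.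
have := pint_lin c hf P0; rewrite E0 addr0 => <-.
by congr (pint n v _); apply/funext => z; rewrite addr0.
Qed.

(** The quotient is defined as a Cauchy integral of [f ze / ((ze - x) (ze - z))], so nothing special
    happens at [z = x], and its value there is the derivative. *)
Lemma diffquot r r' (f : C -> C) x : 0 < r' < r -> hol r f -> K r' x ->
  exists Q : C -> C, [/\ hol r' Q, forall z, K r' z -> f z - f x = Q z * (z - x) &
    cder f x (Q x)].
Proof.
move=> /andP[r'0 r'r] hf hx.
pose r0 := r' + (r - r') / 3; pose r1 := r' + (r - r') * (2 / 3).
have r0r1 : r0 < r1 by rewrite /r0 /r1; lra.
have r00 : 0 < r0 by rewrite /r0; lra.
have [d d0 /(_ 1 ltr01) [n [v [cv _]]]] := contour_exists r00 r0r1.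
have [v0 _ [_ dd] W0] := cv.
have r1r : r1 < r by rewrite /r1; lra.
have r'r0 : r' < r0 by rewrite /r0; lra.
have Pf := hol_pdiff cv (ltW r1r) hf.
have hxd ze (h : onp n v ze) := dd _ _ h (K_sub (ltW r'r0) hx).
have Px := pdiff_cauchy d0 hxd.
have Pphi := pdiffM Pf Px.
pose W := winding n v 2^-1.
pose Q z := W^-1 * pint n v (fun ze => f ze * (ze - x)^-1 * (ze - z)^-1).
have QD r2 z : r2 <= r0 -> K r2 z -> exists q : C, cder Q z q.
  move=> r2r0 hz; have hzd ze (h : onp n v ze) := dd _ _ h (K_sub r2r0 hz).
  eexists; exact: (cderM (cder_cst W^-1 z) (cauchy_kernel d0 Pphi hzd)).
have QE r2 z : r2 < r0 -> K r2 z -> f z - f x = Q z * (z - x).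
  move=> r2r0 hz; have hzd ze (h : onp n v ze) := dd _ _ h (K_sub (ltW r2r0) hz).
  have Pz := pdiff_cauchy d0 hzd.
  have Cx := Cauchy_formula (ltW r00) r0r1 cv r1r hf r'r0 hx.
  have Cz := Cauchy_formula (ltW r00) r0r1 cv r1r hf r2r0 hz.
  rewrite -/W in Cx Cz W0.
  apply: (mulIf W0); rewrite mulrBl -Cx -Cz.
  rewrite /Q; set J := pint n v (fun ze => f ze * (ze - x)^-1 * (ze - z)^-1).
  have -> : W^-1 * J * (z - x) * W = (z - x) * J by field.
  rewrite addrC -mulN1r -pint_lin; [|exact: pdiffM|exact: pdiffM].
  rewrite -pintZ; last exact: pdiffM.
  apply: pint_ext; first by apply: pdiff_lin; exact: pdiffM.
  move=> ze hze; have z1 : ze - x != 0 by rewrite -nm_gt0 (lt_le_trans d0) ?hxd.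
  have z2 : ze - z != 0 by rewrite -nm_gt0 (lt_le_trans d0) ?hzd.
  by field; rewrite z1 z2.
exists Q; split.
- by move=> z hz; apply: QD hz; exact: ltW.
- by move=> z hz; apply: QE hz.
have [q hq] := QD r' x (ltW r'r0) hx.
have D : cder (fun z => z - x) x 1.
  by have := cderB (cder_id x) (cder_cst x x); rewrite subr0.
have := cderD (cderM hq D) (cder_cst (f x) x).
rewrite subrr mul0r addr0 mulr1 addr0.
apply: (@cder_ext R _ _ _ _ ((r0 - r') / 2)); first by rewrite divr_gt0 ?subr_gt0.
move=> w hw; rewrite -[RHS](subrK (f x)) (QE ((r0 + r') / 2) w)//; first lra.
have := K_near hx (ltW hw); apply: K_sub; lra.
Qed.

End Quotient.

(** * The transfer operator as a matrix *)

Section Sums.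
Variable R : realType.
Local Notation C := (Cplx R).

Lemma sum_tupleS (V : nmodType) (T : finType) m (G : seq T -> V) :
  \sum_(w : m.+1.-tuple T) G w = \sum_(w : m.-tuple T) \sum_(i : T) G (i :: w).
Proof.
rewrite exchange_big /= pair_bigA /=.
rewrite (reindex (fun q : T * m.-tuple T => [tuple of q.1 :: q.2])) //=.
exists (fun w => (thead w, [tuple of behead w])) => [[i w] _|w _] /=.
  by congr pair; apply: val_inj.
by rewrite -tuple_eta.
Qed.

Lemma sum_divmod (V : nmodType) (Q J : nat) (Phi : nat -> nat -> V) : (0 < J)%N ->
  \sum_(a < Q * J) Phi (a %/ J)%N (a %% J)%N = \sum_(k < Q) \sum_(j < J) Phi k j.
Proof.
move=> J0; elim: Q => [|Q IH]; first by rewrite !big_ord0.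
rewrite big_ord_recr /= -IH -(big_mkord xpredT (fun a => Phi (a %/ J)%N (a %% J)%N)).
rewrite -(big_mkord xpredT (fun a => Phi (a %/ J)%N (a %% J)%N)).
rewrite (@big_cat_nat _ _ _ (Q * J)) ?leq_mul2r ?leqnSn ?orbT//=; congr (_ + _).
rewrite -{1}[(Q * J)%N]add0n big_addn mulSn addnK big_mkord.
apply: eq_bigr => j _; rewrite divnDMl// divn_small// add0n.
by rewrite [(j + _)%N]addnC modnMDl modn_small.
Qed.

Lemma geom_le (q : R) n : 0 <= q <= 1 / 2 -> \sum_(k < n) q ^+ k <= 2.
Proof.
move=> /andP[q0 q1]; suff : \sum_(k < n) q ^+ k <= 2 - 2 * q ^+ n.
  by have := exprn_ge0 n q0; lra.
elim: n => [|n IH]; first by rewrite big_ord0 expr0; lra.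
rewrite big_ord_recr /= exprS; have := exprn_ge0 n q0; nra.
Qed.

Lemma segi_sum I (r : seq I) (f : I -> C -> C) (J : I -> C) a b :
  (forall i, segi (f i) a b (J i)) ->
  segi (fun z => \sum_(i <- r) f i z) a b (\sum_(i <- r) J i).
Proof.
move=> h; elim: r => [|i r IH].
  rewrite big_nil -[X in segi _ _ _ X](mul0r (b - a)).
  apply: segi_ext (segi_cst 0 a b) => t _.
  by rewrite big_nil.
rewrite big_cons -[J i]mul1r; apply: segi_ext (segi_lin 1 (h i) IH) => t _.
by rewrite big_cons mul1r.
Qed.

End Sums.

Section Transfer.
Variable R : realType.
Local Notation C := (Cplx R).
Variables (N : nat) (F : 'I_N -> C -> C) (p : 'I_N -> R) (del kap : R).
Hypotheses (del0 : 0 < del) (kap01 : 0 < kap < 1).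
Hypotheses (hF : forall i, hol del (F i)).
Hypotheses (FK : forall i z, K del z -> K (kap * del) (F i z)).
Hypotheses (FL : forall i z z', K del z -> K del z' ->
  nm (F i z - F i z') <= kap * nm (z - z')).
Hypotheses (p0 : forall i, 0 <= p i) (p1 : \sum_i p i = 1).

Definition Fw (w : seq 'I_N) : C -> C := foldr (fun i f => F i \o f) id w.

Definition transfer (f : C -> C) z := \sum_i (p i)%:C * f (F i z).

Definition transfern m (f : C -> C) z :=
  \sum_(w : m.-tuple 'I_N) (pw p w)%:C * f (Fw w z).

Lemma transfernS m f z : transfern m.+1 f z = transfern m (transfer f) z.
Proof.
rewrite /transfern (sum_tupleS m (fun w : seq 'I_N => (pw p w)%:C * f (Fw w z))).
apply: eq_bigr => w _; rewrite /transfer mulr_sumr; apply: eq_bigr => i _.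
by rewrite /pw big_cons rmorphM mulrCA mulrA.
Qed.

Lemma pw_ge0 w : 0 <= pw p w.
Proof. exact: prodr_ge0. Qed.

Lemma sum_pw m : \sum_(w : m.-tuple 'I_N) pw p w = 1.
Proof.
elim: m => [|m IH].
  rewrite (bigD1 [tuple]) //= big1 ?addr0; first by rewrite /pw big_nil.
  by move=> w; rewrite (tuple0 w); case: eqP.
rewrite (sum_tupleS m (pw p)) -IH; apply: eq_bigr => w _.
under eq_bigr do rewrite /pw big_cons.
by rewrite -mulr_suml p1 mul1r.
Qed.

Lemma kdel : kap * del < del.
Proof. by have /andP[_ h] := kap01; rewrite gtr_pMl. Qed.

Lemma Fw_K w z : K del z -> K del (Fw w z).
Proof. by move=> hz; elim: w => //= i w /(FK i); apply: K_sub; exact/ltW/kdel. Qed.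

Lemma Fw_Kk w z : (0 < size w)%N -> K del z -> K (kap * del) (Fw w z).
Proof. by case: w => //= i w _ /(Fw_K w)/(FK i). Qed.

Lemma Fw_hol w : hol del (Fw w).
Proof.
move=> z hz; elim: w => [|i w [d hd]]; first by exists 1; exact: cder_id.
have [d' hd'] := hF i (Fw_K w hz).
by exists (d' * d); apply: (cder_comp hd hd').
Qed.

Lemma Fw_lip w z z' : K del z -> K del z' ->
  nm (Fw w z - Fw w z') <= kap ^+ size w * nm (z - z').
Proof.
move=> hz hz'; elim: w => [|i w IH]; first by rewrite expr0 mul1r.
apply: (le_trans (FL i (Fw_K w hz) (Fw_K w hz'))).
by rewrite exprS -mulrA ler_wpM2l//; have /andP[/ltW] := kap01.
Qed.

(** Non-empty words map [K del] into [K (kap * del)], so the operator enlarges the domain of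
    holomorphy; this gain makes it nuclear. *)
Lemma transfer_hol m f : (0 < m)%N -> hol (kap * del) f -> hol del (transfern m f).
Proof.
move=> m0 hf z hz.
have /choice[D hD] : forall w : m.-tuple 'I_N, exists d : C,
    cder (fun z => (pw p w)%:C * f (Fw w z)) z d.
  move=> w; have [d1 h1] := Fw_hol w hz.
  have [d2 h2] : exists d : C, cder f (Fw w z) d.
    by apply: hf; apply: Fw_Kk => //; rewrite size_tuple.
  eexists; exact: (cderM (cder_cst _ z) (cder_comp h1 h2)).
by eexists; exact: (cder_sum _ hD).
Qed.

Lemma transfern_bound m f z M : (forall w : m.-tuple 'I_N, nm (f (Fw w z)) <= M) ->
  nm (transfern m f z) <= M.
Proof.
move=> h; rewrite -[M]mul1r -(sum_pw m) mulr_suml; apply: (le_trans (nm_sum _ _ _)).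
apply: ler_sum => w _; rewrite nmM nm_real ger0_norm ?pw_ge0//.
by rewrite ler_wpM2l ?pw_ge0.
Qed.

(** * The nuclear expansion, its truncated matrices and their traces *)

Section Nuclear.
Variables (r0 r d : R) (J : nat) (v : nat -> C).
Hypotheses (r0k : kap * del < r0) (r0r : r0 < r) (rdel : r < del).
Hypotheses (cv : contour r0 r d J v).
Hypotheses (vstep : forall k, (k < J)%N -> nm (v k.+1 - v k) <= d / 2).

Let W := winding J v 2^-1.
Let cen j := mid (v j) (v j.+1).
(** The scale [d / 2] splits the ratio 1/4 evenly: [|ze - cen j| <= d / 4] on the edge and
    [|z - cen j| >= d] on [K r0], so both [ev k] and [es k] are of order [(1 / 2)^k]. *)
Let sc : C := (d / 2)%:C.

Let d0 : 0 < d. Proof. by case: cv => _ _ []. Qed.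
Let dd ze z : onp J v ze -> K r0 z -> d <= nm (ze - z).
Proof. by case: cv => _ _ [_ h] _; exact: h. Qed.
Let W0 : W != 0. Proof. by case: cv. Qed.
Let J0 : (0 < J)%N.
Proof.
rewrite lt0n; apply: contraNneq W0 => J0; rewrite /W /winding /pint J0.
by rewrite big_ord0.
Qed.

(** For [ze] on the edge [j],
    [1 / (ze - z) = \sum_k ev k j z * ((ze - cen j) / sc) ^+ k]. *)
Definition ev k j (z : C) : C := - (sc / (z - cen j)) ^+ k / (z - cen j).
Definition es k j (f : C -> C) : C :=
  W^-1 * seg (fun ze => f ze * ((ze - cen j) / sc) ^+ k) (v j) (v j.+1).

(** The pairs [(k, j)] are numbered by [a = k * J + j]. *)
Let Ev (a : nat) := ev (a %/ J) (a %% J).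
Let Es (a : nat) := es (a %/ J) (a %% J).
Let x (a : nat) : R := (1 / 2) ^+ (a %/ J).

Let cen_onp j : (j < J)%N -> onp J v (cen j).
Proof. by move=> jJ; exists j => //; exists (1 / 2) => //; lra. Qed.

Let cen_far j z : (j < J)%N -> K r0 z -> d <= nm (z - cen j).
Proof. by move=> jJ hz; rewrite nmB; apply: dd => //; exact: cen_onp. Qed.

Let cen_near j t : (j < J)%N -> 0 <= t <= 1 -> nm (pt (v j) (v j.+1) t - cen j) <= d / 4.
Proof.
move=> jJ t01; have -> : pt (v j) (v j.+1) t - cen j = (t - 1 / 2)%:C * (v j.+1 - v j).
  by rewrite /cen /mid /pt rmorphB; ring.
rewrite nmM nm_real; have h := vstep jJ.
have : `|t - 1 / 2| <= 1 / 2 by rewrite ler_norml; lra.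
have := nm_ge0 (v j.+1 - v j); have := normr_ge0 (t - 1 / 2); nra.
Qed.

Let sc_nm : nm sc = d / 2.
Proof. by rewrite nm_real ger0_norm// divr_ge0// ltW. Qed.

Let sc0 : sc != 0. Proof. by rewrite -nm_gt0 sc_nm divr_gt0. Qed.

Let scq j t : (j < J)%N -> 0 <= t <= 1 -> nm ((pt (v j) (v j.+1) t - cen j) / sc) <= 1 / 2.
Proof.
move=> jJ t01; rewrite nmf sc_nm ler_pdivrMr ?divr_gt0//.
by apply: (le_trans (cen_near jJ t01)); lra.
Qed.

Let ev_bound k j z : (j < J)%N -> K r0 z -> nm (ev k j z) <= (1 / 2) ^+ k / d.
Proof.
move=> jJ hz; have h := cen_far jJ hz; have h0 := lt_le_trans d0 h.
rewrite /ev nmf nmN nmX nmf sc_nm ler_pM ?exprn_ge0 ?invr_ge0 ?divr_ge0 ?nm_ge0 ?(ltW d0)//.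
  rewrite lerXn2r ?nnegrE ?divr_ge0 ?nm_ge0 ?(ltW d0)//.
  by rewrite ler_pdivrMr//; lra.
by rewrite lef_pV2 ?posrE.
Qed.

Let ev_cder k j z : (j < J)%N -> K r0 z -> exists e : C, cder (ev k j) z e.
Proof.
move=> jJ hz; have h := cen_far jJ hz; have h0 := lt_le_trans d0 h.
rewrite nm_gt0 in h0; have D := cder_invB h0.
have D1 := cderM (cder_cst sc z) D.
by eexists; exact: (cderM (cderN (cderX k D1)) D).
Qed.

Let powf_cder k j ze : exists e : C, cder (fun ze => ((ze - cen j) / sc) ^+ k) ze e.
Proof.
have D : cder (fun z => z - cen j) ze 1.
  by have := cderB (cder_id ze) (cder_cst (cen j) ze); rewrite subr0.
by eexists; exact: (cderX k (cderM D (cder_cst sc^-1 ze))).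
Qed.

Let es_segi f k j : pdiff J v f -> (j < J)%N ->
  segi (fun ze => f ze * ((ze - cen j) / sc) ^+ k) (v j) (v j.+1)
       (seg (fun ze => f ze * ((ze - cen j) / sc) ^+ k) (v j) (v j.+1)).
Proof.
move=> hf jJ; apply: (@pdiff_segi R J v _ j) => //.
apply: (pdiffM hf) => ze _; exact: powf_cder.
Qed.

Let es_sum I (s : seq I) (c : I -> C) (f : I -> C -> C) k j : (j < J)%N ->
  (forall i, pdiff J v (f i)) ->
  es k j (fun z => \sum_(i <- s) c i * f i z) = \sum_(i <- s) c i * es k j (f i).
Proof.
move=> jJ hf; rewrite /es; under [RHS]eq_bigr do rewrite mulrCA.
rewrite -mulr_sumr; congr (_ * _); apply: segE.
have Z i : segi (fun ze => c i * (f i ze * ((ze - cen j) / sc) ^+ k)) (v j) (v j.+1)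
    (c i * seg (fun ze => f i ze * ((ze - cen j) / sc) ^+ k) (v j) (v j.+1)).
  have := segi_lin (c i) (es_segi k (hf i) jJ) (segi_cst 0 (v j) (v j.+1)).
  by rewrite mul0r addr0; apply: segi_ext => t _; rewrite addr0.
apply: segi_ext (segi_sum s Z) => t _.
by rewrite mulr_suml; apply: eq_bigr => i _; rewrite mulrA.
Qed.

Let es_sub f g k j : (j < J)%N -> pdiff J v f -> pdiff J v g ->
  es k j f - es k j g = es k j (fun z => f z - g z).
Proof.
move=> jJ hf hg; rewrite /es -mulrBr; congr (_ * _); apply/esym/segE.
rewrite addrC -mulN1r; apply: segi_ext (segi_lin (-1) (es_segi k hg jJ) (es_segi k hf jJ)).
by move=> t _; ring.
Qed.

Let A : R := (nm W)^-1 * (d / 2).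

Let A0 : 0 <= A. Proof. by rewrite mulr_ge0 ?invr_ge0 ?divr_ge0 ?nm_ge0 ?(ltW d0). Qed.

Let es_bound f k j M : (j < J)%N -> pdiff J v f -> 0 <= M ->
  (forall ze, onp J v ze -> nm (f ze) <= M) -> nm (es k j f) <= A * M * (1 / 2) ^+ k.
Proof.
move=> jJ hf M0 hM; rewrite /es nmM nmV /A -!mulrA ler_wpM2l ?invr_ge0 ?nm_ge0//.
apply: (@le_trans _ _ (M * (1 / 2) ^+ k * nm (v j.+1 - v j))).
  apply: segi_bound (es_segi k hf jJ) _ => t t01.
  rewrite nmM ler_pM ?nm_ge0//; first by apply: hM; exists j => //; exists t.
  by rewrite nmX lerXn2r ?nnegrE ?nm_ge0// scq.
have B : 0 <= M * (1 / 2) ^+ k by rewrite mulr_ge0// exprn_ge0.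
apply: le_trans (ler_wpM2l B (vstep jJ)) _.
by rewrite le_eqVlt; apply/orP; left; apply/eqP; ring.
Qed.

(** The remainder of the geometric series is exactly [q^Q / (ze - z)] with [|q| <= 1 / 4]. *)
Let repro_err Q j ze z t : (j < J)%N -> 0 <= t <= 1 -> ze = pt (v j) (v j.+1) t -> K r0 z ->
  nm ((ze - z)^-1 - \sum_(k < Q) ev k j z * ((ze - cen j) / sc) ^+ k) <= d^-1 * (1 / 4) ^+ Q.
Proof.
move=> jJ t01 zeE hz; have h := cen_far jJ hz; have h0 := lt_le_trans d0 h.
have hze : d <= nm (ze - z) by apply: dd => //; exists j => //; exists t.
have hze0 := lt_le_trans d0 hze; rewrite nm_gt0 in hze0.
have hn := cen_near jJ t01; rewrite -zeE in hn.
pose q := (ze - cen j) / (z - cen j).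
have q4 : nm q <= 1 / 4.
  by rewrite nmf ler_pdivrMr//; lra.
have c0 : z - cen j != 0 by rewrite -nm_gt0.
have -> : \sum_(k < Q) ev k j z * ((ze - cen j) / sc) ^+ k = - (z - cen j)^-1 * \sum_(k < Q) q ^+ k.
  rewrite mulr_sumr; apply: eq_bigr => k _; rewrite /ev /q.
  rewrite mulNr mulNr mulrAC -exprMn mulNr mulrC; congr (- (_ * _ ^+ _)).
  by rewrite mulrC mulrA divfK.
have E : (ze - z) = - (z - cen j) * (1 - q) by rewrite /q; field.
have q10 : 1 - q != 0 by move: hze0; rewrite E mulf_eq0 negb_or => /andP[].
have -> : (ze - z)^-1 - - (z - cen j)^-1 * \sum_(k < Q) q ^+ k = (ze - z)^-1 * q ^+ Q.
  have G : (1 - q) * \sum_(k < Q) q ^+ k = 1 - q ^+ Q by rewrite -[LHS]opprK -mulNr opprB -subrX1 opprB.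
  have -> : q ^+ Q = 1 - (1 - q) * \sum_(k < Q) q ^+ k by rewrite G; ring.
  move: (\sum_(k < Q) q ^+ k) (1 - q) q10 E => T u u0 ->.
  by field; rewrite u0 c0.
rewrite nmM nmV nmX ler_pM ?invr_ge0 ?exprn_ge0 ?nm_ge0//.
  by rewrite lef_pV2 ?posrE ?nm_gt0.
by rewrite lerXn2r ?nnegrE ?nm_ge0.
Qed.

(** The point [Z ze] may move with the integration variable: a constant [Z] serves Cauchy's formula
    in [proj_err], and [Z = Fw w] serves the traces in [trace_limit]. *)
Let repro H Z M Q : pdiff J v H -> 0 <= M -> (forall ze, onp J v ze -> nm (H ze) <= M) ->
  (forall ze, onp J v ze -> K r0 (Z ze)) -> pdiff J v Z ->
  nm (pint J v (fun ze => H ze * (ze - Z ze)^-1) -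
      \sum_(k < Q) \sum_(j < J) seg (fun ze => H ze * ev k j (Z ze) * ((ze - cen j) / sc) ^+ k)
        (v j) (v j.+1)) <= M * (d^-1 * (1 / 4) ^+ Q) * plen J v.
Proof.
move=> hH M0 hM hZ dZ.
have P1 : pdiff J v (fun ze => H ze * (ze - Z ze)^-1).
  apply: pdiffM => // ze hze; have [z1 h1] := dZ _ hze.
  have hz : ze - Z ze != 0 by rewrite -nm_gt0; exact: lt_le_trans d0 (dd hze (hZ _ hze)).
  by eexists; exact: (@cderV _ (fun ze => ze - Z ze) _ _ hz (cderB (cder_id ze) h1)).
have P2 (j k : nat) : (j < J)%N -> pdiff J v (fun ze => H ze * ev k j (Z ze) * ((ze - cen j) / sc) ^+ k).
  move=> jJ; apply: pdiffM; last by move=> ze _; exact: powf_cder.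
  apply: pdiffM => // ze hze; have [z1 h1] := dZ _ hze.
  have [z2 h2] := ev_cder k jJ (hZ _ hze).
  by eexists; exact: (cder_comp h1 h2).
rewrite exchange_big /= /pint -sumrB; apply: (le_trans (nm_sum _ _ _)).
rewrite /plen mulr_sumr; apply: ler_sum => j _; have jJ := ltn_ord j.
rewrite addrC -mulN1r.
have S1 := segi_sum (index_enum 'I_Q) (fun k => pdiff_segi (P2 j k jJ) jJ).
apply: (segi_bound (segi_lin (-1) S1 (pdiff_segi P1 jJ))) => t t01.
set ze := pt _ _ _; have hze : onp J v ze by exists (j : nat) => //; exists t.
rewrite (_ : _ + _ = H ze * ((ze - Z ze)^-1 -
    \sum_(k < Q) ev k j (Z ze) * ((ze - cen j) / sc) ^+ k)); last first.
  rewrite mulrBr mulN1r addrC; congr (_ - _).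
  rewrite mulr_sumr; apply: eq_bigr => k _.
  by rewrite -mulrA.
rewrite nmM ler_pM ?nm_ge0 ?hM//.
exact: (repro_err Q jJ t01 (erefl _) (hZ _ hze)).
Qed.

Let Ev_hol b : hol (kap * del) (Ev b).
Proof.
move=> z hz; apply: ev_cder; first by rewrite ltn_mod.
exact: K_sub (ltW r0k) hz.
Qed.

Let x_ge0 a : 0 <= x a. Proof. exact: exprn_ge0. Qed.

Let Ev_bound b z : K (kap * del) z -> nm (Ev b z) <= x b / d.
Proof. by move=> /(K_sub (ltW r0k)); apply: ev_bound; rewrite ltn_mod. Qed.

Let sum_x2 Q : \sum_(a < Q * J) x a ^+ 2 <= 2 * J%:R.
Proof.
rewrite (sum_divmod Q (fun k _ => ((1 / 2) ^+ k) ^+ 2 : R))//.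
under eq_bigr => k _ do rewrite sumr_const card_ord -[_ *+ J]mulr_natr.
rewrite -mulr_suml ler_wpM2r//; under eq_bigr => k _ do rewrite exprAC.
by apply: geom_le; rewrite expr2; apply/andP; split; lra.
Qed.

Lemma transfern1E f : transfern 1 f = transfer f.
Proof.
apply/funext => z; rewrite transfernS /transfern (bigD1 [tuple]) //= big1 ?addr0.
  by rewrite /pw big_nil mul1r.
by move=> w; rewrite (tuple0 w); case: eqP.
Qed.

Definition ent (H : C -> C) a b := Es a (fun ze => H ze * transfer (Ev b) ze).

(** The matrix of [f |-> H * L f], truncated to [k < Q]. *)
Definition tmx H Q : 'M[C]_(Q * J) := \matrix_(a < Q * J, b < Q * J) ent H a b.

Let onpK ze : onp J v ze -> K del ze.
Proof. by move=> /(onp_K cv)/(K_sub (ltW rdel)). Qed.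

Let transfer_hol1 b : hol del (transfer (Ev b)).
Proof. by rewrite -transfern1E; apply: transfer_hol => //; exact: Ev_hol. Qed.

Let transfer_bound b ze : K del ze -> nm (transfer (Ev b) ze) <= x b / d.
Proof.
move=> hz; rewrite -transfern1E; apply: transfern_bound => w.
by apply/Ev_bound/Fw_Kk => //; rewrite size_tuple.
Qed.

(** The decay in [b] comes from the size of [Ev b] on [K (kap * del)], that in [a] from the
    functional [Es a]. *)
Lemma ent_bound H M a b : hol del H -> 0 <= M -> (forall ze, onp J v ze -> nm (H ze) <= M) ->
  nm (ent H a b) <= A * M / d * (x a * x b).
Proof.
move=> hH M0 hM; apply: le_trans (_ : A * (M * (x b / d)) * x a <= _).
  apply: es_bound.
  - by rewrite ltn_mod.
  - by apply: pdiffM; apply: (hol_pdiff cv (ltW rdel)).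
  - by rewrite mulr_ge0// divr_ge0// ltW.
  - move=> ze hze; rewrite nmM ler_pM ?nm_ge0 ?hM//.
    exact/transfer_bound/onpK.
by rewrite le_eqVlt; apply/orP; left; apply/eqP; ring.
Qed.

Let ent1 a b : ent (fun=> 1) a b = Es a (transfer (Ev b)).
Proof. by rewrite /ent; congr (Es a _); apply/funext => z; exact: mul1r. Qed.

Let r00 : 0 <= r0.
Proof.
have /andP[k0 _] := kap01; apply: ltW; apply: lt_trans r0k.
by rewrite mulr_gt0.
Qed.

(** Cauchy's formula for [transfer (Ev b)], with the kernel cut after [Q] terms. The error keeps the
    factor [x b], on which the weighted induction of [approx] relies. *)
Let proj_err Q b z : K (kap * del) z ->
  nm (\sum_(c < Q * J) ent (fun=> 1) c b * Ev c z - transfer (Ev b) z) <=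
    (nm W)^-1 * (x b / d * (d^-1 * (1 / 4) ^+ Q) * plen J v).
Proof.
move=> hz; set f := transfer (Ev b).
have Pf : pdiff J v f := hol_pdiff cv (ltW rdel) (transfer_hol1 b).
have x0 : 0 <= x b / d by rewrite divr_ge0 ?x_ge0 ?(ltW d0).
have hzr := K_sub (ltW r0k) hz.
have Pz : pdiff J v (fun=> z) by move=> ze _; exists 0; exact: cder_cst.
have := repro Q Pf x0 (fun ze h => transfer_bound b (onpK h)) (fun _ _ => hzr) Pz.
rewrite (Cauchy_formula r00 r0r cv rdel (transfer_hol1 b) r0k hz) -/W => h.
apply: le_trans (ler_wpM2l _ h); last by rewrite invr_ge0 nm_ge0.
rewrite -nmV -nmM -nmN le_eqVlt; apply/orP; left; apply/eqP; congr nm.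
rewrite mulrBr mulrCA mulVf// mulr1 opprB; congr (_ - _).
rewrite (_ : \sum_(c < Q * J) _ = \sum_(k < Q) \sum_(j < J) es k j f * ev k j z); last first.
  rewrite -(sum_divmod Q (fun k j => es k j f * ev k j z))//.
  by apply: eq_bigr => c _; rewrite ent1.
rewrite mulr_sumr; apply: eq_bigr => k _.
rewrite mulr_sumr; apply: eq_bigr => j _; rewrite /es -mulrA; congr (_ * _).
have jJ := ltn_ord j.
have := segi_lin (ev k j z) (es_segi k Pf jJ) (segi_cst 0 (v j) (v j.+1)).
rewrite mul0r addr0 mulrC => /segi_ext h1; apply/esym/segE; apply: h1 => t _.
by rewrite addr0; ring.
Qed.

(** Induction on [m]. With one more matrix factor the old error is summed against entries, where
    [\sum_k x k ^+ 2 <= 2 J] keeps the constant independent of [Q]; the new error is [proj_err],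
    sent through [transfern m.+1] and [Es a]. *)
Let approx H : hol del H -> forall m, exists2 c : R, 0 <= c & forall Q (a b : 'I_(Q * J)),
  nm ((tmx H Q *m tmx (fun=> 1) Q ^+ m) a b -
      Es a (fun ze => H ze * transfern m.+1 (Ev b) ze)) <= c * (x a * x b) * (1 / 4) ^+ Q.
Proof.
move=> hH; have PH := hol_pdiff cv (ltW rdel) hH.
have [M M0 hM] := pdiff_bounded PH.
have P1 : hol del (fun=> 1 : C) by move=> z _; exists 0; exact: cder_cst.
have Ptr m b : pdiff J v (fun ze => H ze * transfern m.+1 (Ev b) ze).
  by apply: pdiffM => //; apply: (hol_pdiff cv (ltW rdel)); apply: transfer_hol.
pose B := A * 1 / d; pose G := (nm W)^-1 * (d^-1 * d^-1) * plen J v.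
have G0 : 0 <= G by rewrite !mulr_ge0 ?invr_ge0 ?nm_ge0 ?plen_ge0// ltW.
have B0 : 0 <= B by rewrite /B mulr1 divr_ge0// ltW.
have hB a b : nm (ent (fun=> 1) a b) <= B * (x a * x b).
  by apply: ent_bound => // ze _; rewrite nm1.
elim=> [|m [c c0 IH]].
  exists 0 => // Q a b; rewrite expr0 mulmx1 mxE /ent transfern1E subrr nm0.
  by rewrite !mul0r.
exists (c * B * (2 * J%:R) + A * (M * G)) => [|Q a b].
  by apply: addr_ge0; apply: mulr_ge0 => //; exact: mulr_ge0.
pose T (c : nat) := Es a (fun ze => H ze * transfern m.+1 (Ev c) ze).
pose lam (c : nat) := ent (fun=> 1) c b.
rewrite exprSr mulmxA mxE.
set X := tmx H Q *m _ ^+ m.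
under eq_bigr => k _ do rewrite [tmx _ _ k b]mxE.
have aJ : (a %% J < J)%N by rewrite ltn_mod.
have E : \sum_(k < Q * J) lam k * T k - Es a (fun ze => H ze * transfern m.+2 (Ev b) ze) =
    Es a (fun ze => H ze * transfern m.+1
      (fun z => \sum_(k < Q * J) lam k * Ev k z - transfer (Ev b) z) ze).
  rewrite -(@es_sum _ _ (fun k : 'I_(Q * J) => lam k) (fun k ze => H ze * transfern m.+1 (Ev k) ze))//.
  rewrite es_sub//; last first.
    move=> ze hze; have /choice[D hD] : forall k : 'I_(Q * J), exists e : C,
        cder (fun z => lam k * (H z * transfern m.+1 (Ev k) z)) ze e.
      move=> k; have [e he] := Ptr m k ze hze.
      by eexists; exact: (cderM (cder_cst (lam k) ze) he).
    by eexists; exact: (cder_sum _ hD).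
  rewrite /Es; congr (es _ _ _); apply/funext => ze; rewrite transfernS /transfern.
  transitivity (H ze * (\sum_(k < Q * J) lam k * \sum_(w : m.+1.-tuple 'I_N) (pw p w)%:C * Ev k (Fw w ze) -
     \sum_(w : m.+1.-tuple 'I_N) (pw p w)%:C * transfer (Ev b) (Fw w ze))).
    rewrite mulrBr; congr (_ - _); rewrite mulr_sumr.
    by apply: eq_bigr => k _; rewrite mulrCA.
  congr (_ * _); under [RHS]eq_bigr do rewrite mulrBr.
  rewrite sumrB; congr (_ - _); under eq_bigr do rewrite mulr_sumr.
  rewrite exchange_big; apply: eq_bigr => w _; rewrite mulr_sumr.
  by apply: eq_bigr => k _; rewrite mulrCA.
rewrite (_ : _ - _ = \sum_(k < Q * J) (X a k - T k) * lam k + (\sum_(k < Q * J) lam k * T k -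
    Es a (fun ze => H ze * transfern m.+2 (Ev b) ze))); last first.
  rewrite addrA; congr (_ - _); rewrite -big_split; apply: eq_bigr => k _ /=.
  by rewrite -/(lam k); ring.
rewrite E; apply: (le_trans (nmD _ _)); rewrite 2!mulrDl; apply: lerD.
  apply: (le_trans (nm_sum _ _ _)).
  apply: (@le_trans _ _ (\sum_(k < Q * J) c * B * (x k ^+ 2) * (x a * x b) * (1 / 4) ^+ Q)).
    apply: ler_sum => k _; rewrite nmM.
    apply: le_trans (ler_pM (nm_ge0 _) (nm_ge0 _) (IH Q a k) (hB k b)) _.
    by rewrite le_eqVlt; apply/orP; left; apply/eqP; ring.
  rewrite -!mulr_suml -mulr_sumr ler_wpM2r ?exprn_ge0// ler_wpM2r ?mulr_ge0//.
  by apply: ler_wpM2l; [exact: mulr_ge0 c0 B0|exact: sum_x2].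
pose M2 := (nm W)^-1 * (x b / d * (d^-1 * (1 / 4) ^+ Q) * plen J v).
have M20 : 0 <= M2.
  by rewrite !mulr_ge0 ?invr_ge0 ?exprn_ge0 ?nm_ge0 ?plen_ge0// ltW.
apply: (@le_trans _ _ (A * (M * M2) * x a)); last first.
  by rewrite le_eqVlt; apply/orP; left; apply/eqP; rewrite /M2 /G; ring.
apply: es_bound => //.
- apply: pdiffM => //; apply: (hol_pdiff cv (ltW rdel)); apply: transfer_hol => // z hz.
  have /choice[D hD] : forall k : 'I_(Q * J), exists e : C, cder (fun z => lam k * Ev k z) z e.
    move=> k; have [e he] := Ev_hol k hz.
    by eexists; exact: (cderM (cder_cst (lam k) z) he).
  have [e he] := transfer_hol1 b (K_sub (ltW kdel) hz).
  by eexists; exact: (cderB (cder_sum _ hD) he).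
- exact: mulr_ge0.
- move=> ze hze; rewrite nmM ler_pM ?nm_ge0 ?hM//; apply: transfern_bound => w.
  by apply/proj_err/Fw_Kk; [rewrite size_tuple|exact: onpK].
Qed.

Variables (zf D : seq 'I_N -> C).
Hypotheses (zfK : forall w, (0 < size w)%N -> K (kap * del) (zf w)).
Hypotheses (zfE : forall w, (0 < size w)%N -> Fw w (zf w) = zf w).
Hypotheses (DE : forall w, (0 < size w)%N -> cder (Fw w) (zf w) (D w)).

Lemma nm_cder_le (G : C -> C) z (e k rr : R) (dz : C) : 0 < rr -> cder G z dz ->
  (forall w, nm (w - z) < rr -> nm (G w - G z) <= k * nm (w - z)) -> nm dz <= k.
Proof.
move=> rr0 hG hl; apply: nm_le_eps => e1 e10.
have [dl dl0 h] := hG _ e10; pose t := Num.min dl rr / 2.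
have t0 : 0 < t by rewrite divr_gt0// lt_min dl0.
have tE : nm (z + t%:C - z) = t by rewrite addrC addKr nm_real gtr0_norm.
have tm : t < Num.min dl rr by rewrite ltr_pdivrMr// ltr_pMr ?ltr1n// lt_min dl0.
move: tm; rewrite lt_min => /andP[t1 t2].
have {}h := h (z + t%:C); have {}hl := hl (z + t%:C); rewrite tE in h hl.
have {}h := h t1; have {}hl := hl t2.
rewrite -(ler_pM2r t0) mulrDl -[X in nm _ * X]tE -nmM.
rewrite -[dz * _](subKr (G (z + t%:C) - G z)).
by apply: (le_trans (nmD _ _)); rewrite nmN lerD.
Qed.

Lemma D_le w : (0 < size w)%N -> nm (D w) <= kap ^+ size w.
Proof.
move=> w0; apply: (@nm_cder_le (Fw w) (zf w) 0 _ (del - kap * del)) (DE w0) _.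
  by rewrite subr_gt0 kdel.
move=> z hz; apply: Fw_lip; last exact: K_sub (ltW kdel) (zfK w0).
by have := K_near (zfK w0) (ltW hz); rewrite addrC subrK.
Qed.

(** With [q] the difference quotient of [Fw w] at its fixed point [z], one has
    [ze - Fw w ze = (ze - z) (1 - q ze)]. As [|q| <= kap^|w| < 1], Cauchy's formula applies to
    [H / (1 - q)] at [z], where [q z = D w]. *)
Let residue H w : hol del H -> (0 < size w)%N ->
  pint J v (fun ze => H ze * (ze - Fw w ze)^-1) = W * (H (zf w) / (1 - D w)).
Proof.
move=> hH w0; set z := zf w.
have hr := r0r; have hd := rdel; have hk := r0k; have /andP[k0 k1] := kap01.
have kd0 : 0 < kap * del by rewrite mulr_gt0.
pose r2 := (r + del) / 2.
have r2d : 0 < r2 < del by rewrite /r2; apply/andP; split; lra.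
have rr2 : r < r2 by rewrite /r2; lra.
have hz : K r2 z by apply: K_sub (zfK w0); rewrite /r2; lra.
have kw : kap ^+ size w < 1 by rewrite exprn_ilt1 ?(ltW k0)// -lt0n.
have [q [hq qE hqz]] := diffquot r2d (Fw_hol w) hz.
have qD : q z = D w by exact: cder_unique hqz (DE w0).
have zd : K del z by apply: K_sub hz; case/andP: r2d => _ /ltW.
have q1 u : K r2 u -> 1 - q u != 0.
  move=> hu; suff : nm (q u) <= kap ^+ size w.
    move=> qk; rewrite subr_eq0; apply: contraTneq qk => <-.
    by rewrite nm1 -ltNge.
  have [->|uz] := eqVneq u z; first by rewrite qD D_le.
  have hu' : K del u by apply: K_sub hu; case/andP: r2d => _ /ltW.
  have := Fw_lip w hu' zd; rewrite qE// nmM ler_pM2r//.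
  by rewrite nm_gt0 subr_eq0.
have hHu : hol r2 (fun u => H u * (1 - q u)^-1).
  move=> u hu; have [h1 H1] := hH u (K_sub (ltW (andP r2d).2) hu).
  have [h2 H2] := hq u hu.
  have H3 : cder (fun u => 1 - q u) u (0 - h2) by exact: cderB (cder_cst 1 u) H2.
  by eexists; exact: (cderM H1 (@cderV _ (fun u => 1 - q u) _ _ (q1 u hu) H3)).
have := Cauchy_formula r00 r0r cv rr2 hHu r0k (zfK w0).
rewrite -/W -/z qD mulrC => <-; apply/esym/pint_ext.
  apply: pdiffM; first exact: (hol_pdiff cv (ltW rr2)).
  apply: pdiff_cauchy d0 _ => ze hze; apply: dd => //.
  exact: K_sub (ltW r0k) (zfK w0).
move=> ze hze; have hze2 := K_sub (ltW rr2) (onp_K cv hze).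
rewrite -mulrA -invfM; congr (_ * _^-1).
have := qE _ hze2; rewrite (zfE w0) -/z => qE'.
by rewrite -[Fw w ze](subrK z) qE'; ring.
Qed.

(** For each word the diagonal terms, [es k j] applied to [H ze * ev k j (Fw w ze)], add up to the
    truncated expansion of [1 / (ze - Fw w ze)] under the integral; [residue] evaluates the
    limit. *)
Lemma trace_limit H : hol del H -> forall m, exists2 c : R, 0 <= c & forall Q,
  nm (\tr (tmx H Q *m tmx (fun=> 1) Q ^+ m) -
      \sum_(w : m.+1.-tuple 'I_N) (pw p w)%:C * (H (zf w) / (1 - D w))) <= c * (1 / 4) ^+ Q.
Proof.
move=> hH m; have PH := hol_pdiff cv (ltW rdel) hH.
have [M M0 hM] := pdiff_bounded PH; have [c c0 hc] := approx hH m.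
pose G := (nm W)^-1 * (M * d^-1 * plen J v).
exists (c * (2 * J%:R) + G) => [|Q].
  by rewrite addr_ge0 ?mulr_ge0 ?invr_ge0 ?nm_ge0 ?plen_ge0// ltW.
pose T (a : nat) := Es a (fun ze => H ze * transfern m.+1 (Ev a) ze).
pose rho (w : seq 'I_N) := H (zf w) / (1 - D w).
pose Sg (w : seq 'I_N) := \sum_(k < Q) \sum_(j < J)
  seg (fun ze => H ze * ev k j (Fw w ze) * ((ze - cen j) / sc) ^+ k) (v j) (v j.+1).
have E : \sum_(a < Q * J) T a = \sum_(w : m.+1.-tuple 'I_N) (pw p w)%:C * (W^-1 * Sg w).
  rewrite (sum_divmod Q (fun k j => es k j (fun ze => H ze * transfern m.+1 (ev k j) ze)))//.
  transitivity (\sum_(k < Q) \sum_(j < J) \sum_(w : m.+1.-tuple 'I_N) (pw p w)%:C *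
      es k j (fun ze => H ze * ev k j (Fw w ze))).
    apply: eq_bigr => k _; apply: eq_bigr => j _.
    rewrite -es_sum//.
      congr es; apply/funext => ze; rewrite /transfern mulr_sumr.
      by apply: eq_bigr => w _; rewrite mulrCA.
    move=> w; apply: pdiffM => // ze hze; have [h1 H1] := Fw_hol w (onpK hze).
    have [h2 H2] : exists e : C, cder (ev k j) (Fw w ze) e.
      apply: ev_cder => //; apply: K_sub (ltW r0k) _; apply: Fw_Kk; last exact: onpK.
      by rewrite size_tuple.
    by eexists; exact: (cder_comp H1 H2).
  under eq_bigr => k _ do rewrite exchange_big.
  rewrite exchange_big; apply: eq_bigr => w _ /=.
  rewrite /Sg !mulr_sumr; apply: eq_bigr => k _; rewrite !mulr_sumr.
  by apply: eq_bigr => j _; rewrite /es.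
rewrite [\tr _](_ : _ = \sum_(a < Q * J) ((tmx H Q *m tmx (fun=> 1) Q ^+ m) a a - T a) +
  \sum_(a < Q * J) T a); last by rewrite -big_split; apply: eq_bigr => a _; rewrite /= subrK.
rewrite E -addrA -sumrB; apply: (le_trans (nmD _ _)); rewrite mulrDl; apply: lerD.
  apply: (le_trans (nm_sum _ _ _)).
  apply: (@le_trans _ _ (\sum_(a < Q * J) c * x a ^+ 2 * (1 / 4) ^+ Q)).
    by apply: ler_sum => a _; rewrite expr2; exact: hc.
  by rewrite -mulr_suml -mulr_sumr ler_wpM2r ?exprn_ge0// ler_wpM2l.
rewrite -[leRHS]mul1r -[X in _ <= X * _](sum_pw m.+1) mulr_suml.
apply: (le_trans (nm_sum _ _ _)); apply: ler_sum => w _; rewrite -mulrBr nmM nm_real ger0_norm ?pw_ge0//.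
rewrite ler_wpM2l ?pw_ge0//; have w0 : (0 < size w)%N by rewrite size_tuple.
have Pw : pdiff J v (Fw w) by move=> ze /onpK; exact: Fw_hol.
have Kw ze : onp J v ze -> K r0 (Fw w ze).
  by move=> /onpK/(Fw_Kk w0); exact: K_sub (ltW r0k).
have := repro Q PH M0 hM Kw Pw; rewrite (residue hH w0) => h.
have -> : W^-1 * Sg w - H (zf w) / (1 - D w) = - (W^-1 * (W * (H (zf w) / (1 - D w)) - Sg w)).
  by rewrite mulrBr mulKf// opprB.
rewrite nmN nmM nmV /G -!mulrA ler_wpM2l ?invr_ge0 ?nm_ge0//.
apply: (le_trans h); rewrite le_eqVlt; apply/orP; left; apply/eqP; ring.
Qed.

End Nuclear.
End Transfer.

(** * Determinants with superexponentially small coefficients *)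

Section FredholmSeries.
Variable K : comNzRingType.
Implicit Types (n : nat).

Definition repl n (j : 'I_n) (Y Z : 'M[K]_n) : 'M[K]_n :=
  \matrix_(i, k) if i == j then Z i k else Y i k.

(** Replacing row [j] leaves the cofactors along that row unchanged, so the expansion along it is a
    diagonal entry of [Z *m \adj Y]. *)
Lemma tr_adj_repl n (Y Z : 'M[K]_n) :
  \tr (\adj Y *m Z) = \sum_j \det (repl j Y Z).
Proof.
rewrite mxtrace_mulC; apply: eq_bigr => j _.
rewrite mxE (expand_det_row _ j); apply: eq_bigr => k _.
rewrite !mxE eqxx; congr (_ * _); rewrite /cofactor; congr (_ * \det _).
apply/matrixP => i' k'; rewrite !mxE.
by rewrite eq_sym (negPf (neq_lift _ _)).
Qed.

Lemma deriv_prod_seq (I : eqType) (s : seq I) (f : I -> {poly K}) : uniq s ->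
  (\prod_(i <- s) f i)^`() = \sum_(j <- s) \prod_(i <- s) (if i == j then (f i)^`() else f i).
Proof.
elim: s => [|i s IH] /=; first by rewrite !big_nil derivC.
move=> /andP[iNs us]; rewrite big_cons derivM (IH us) big_cons big_cons eqxx; congr (_ + _).
  congr (_ * _); apply: eq_big_seq => k ks.
  by case: eqP => // ki; move: iNs; rewrite -ki ks.
rewrite mulr_sumr; apply: eq_big_seq => k ks; rewrite big_cons.
by case: eqP => // ik; move: iNs; rewrite ik ks.
Qed.
End FredholmSeries.

(** * Newton's identities through the adjugate of [1 - z M] *)

Section Newton.
Variable K : comNzRingType.
Variables (n : nat) (M : 'M[K]_n).

Definition Ymx : 'M[{poly K}]_n := 1%:M - 'X *: map_mx polyC M.
Definition fred : {poly K} := \det Ymx.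

Definition adjc k : 'M[K]_n := map_mx (coefp k) (\adj Ymx).

(** Jacobi's formula: differentiating the Leibniz expansion row by row replaces one row of [Ymx] by
    that of [- M]. *)
Lemma deriv_fred : fred^`() = - \tr (\adj Ymx *m map_mx polyC M).
Proof.
have dY i j : (Ymx i j)^`() = - (M i j)%:P.
  rewrite !mxE derivB derivM derivX mul1r derivC mulr0 addr0.
  by case: eqP => _; rewrite ?(derivC 1) ?(derivC 0) sub0r.
have -> : - \tr (\adj Ymx *m map_mx polyC M) = \tr (\adj Ymx *m (- map_mx polyC M)).
  by rewrite mulmxN raddfN.
rewrite tr_adj_repl /fred /determinant raddf_sum exchange_big.
apply: eq_bigr => s _; rewrite raddfMsign /= deriv_prod_seq ?index_enum_uniq//.
rewrite mulr_sumr; apply: eq_bigr => j _; congr (_ * _); apply: eq_bigr => i _.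
by rewrite [in RHS]mxE; case: eqP => // _; rewrite dY !mxE.
Qed.

Lemma adjc0 : adjc 0 = (fred`_0)%:M.
Proof.
have := mul_mx_adj Ymx; rewrite -/fred => /matrixP h.
apply/matrixP => i j; have := congr1 (coefp 0) (h i j).
rewrite /Ymx mulmxBl mul1mx -scalemxAl !mxE /= !coefE/= subr0.
by move=> ->.
Qed.

Lemma adjcS k : adjc k.+1 = (fred`_k.+1)%:M + M *m adjc k.
Proof.
have := mul_mx_adj Ymx; rewrite -/fred => /matrixP h.
apply/matrixP => i j; have := congr1 (coefp k.+1) (h i j).
rewrite /Ymx mulmxBl mul1mx -scalemxAl !mxE /= coefB coefXM/= coefMn => <-.
rewrite coef_sum -[LHS](subrK (\sum_k0 M i k0 * adjc k k0 j)); congr (_ - _ + _).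
by apply: eq_bigr => l _; rewrite !mxE coefCM.
Qed.

(** The identity [Ymx *m \adj Ymx = fred], read coefficientwise, says that the adjugate is the power
    series [fred / (1 - z M)]. *)
Lemma adjcE k : adjc k = \sum_(j < k.+1) fred`_(k - j) *: M ^+ j.
Proof.
elim: k => [|k IH]; first by rewrite adjc0 big_ord1 expr0 scalemx1.
rewrite adjcS IH [RHS]big_ord_recl subn0 expr0.
rewrite scalemx1; congr (_ + _).
rewrite mulmx_sumr; apply: eq_bigr => j _.
by rewrite -scalemxAr lift0 subSS exprS.
Qed.

(** Stated for any [B] to serve twice: [B = M] gives Newton's identities, and the matrix with [g]
    inserted gives, up to sign, the approximations of [alpha_n]. *)
Lemma tr_adj_coef (B : 'M[K]_n) k :
  (\tr (\adj Ymx *m map_mx polyC B))`_k = \sum_(j < k.+1) fred`_(k - j) * \tr (B *m M ^+ j).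
Proof.
transitivity (\tr (adjc k *m B)).
  rewrite coef_sum; apply: eq_bigr => i _; rewrite !mxE coef_sum.
  by apply: eq_bigr => l _; rewrite !mxE coefMC.
rewrite adjcE mulmx_suml raddf_sum; apply: eq_bigr => j _ /=.
by rewrite -scalemxAl mxtraceZ mxtrace_mulC.
Qed.

Lemma fred0 : fred`_0 = 1.
Proof.
have -> : fred`_0 = coefp 0 (\det Ymx) by [].
rewrite -det_map_mx (_ : map_mx _ _ = 1%:M) ?det1//.
apply/matrixP => i j; rewrite !mxE /=.
rewrite coefB coefXM /= subr0.
by case: eqP => _; rewrite coefE.
Qed.

Lemma Newton k : fred`_k.+1 *+ k.+1 = - \sum_(j < k.+1) fred`_(k - j) * \tr (M ^+ j.+1).
Proof.
rewrite -coef_deriv deriv_fred coefN tr_adj_coef; congr (- _).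
by apply: eq_bigr => j _; rewrite exprS.
Qed.
End Newton.

(** * Coefficient bounds for determinants by majorants *)

Section Majorant.
Variable R : realType.
Local Notation C := (Cplx R).
Implicit Types (P : {poly C}) (Q : {poly R}).

Definition dom P Q := forall k, nm P`_k <= Q`_k.
Definition ledom Q Q' := forall k, 0 <= Q`_k <= Q'`_k.

Lemma domD P P' Q Q' : dom P Q -> dom P' Q' -> dom (P + P') (Q + Q').
Proof. by move=> h h' k; rewrite !coefD; apply: le_trans (nmD _ _) (lerD _ _). Qed.

Lemma dom_sum I (s : seq I) (P : pred I) f g : (forall i, P i -> dom (f i) (g i)) ->
  dom (\sum_(i <- s | P i) f i) (\sum_(i <- s | P i) g i).
Proof.
move=> h; elim/big_rec2: _ => [k|i y1 y2 Pi hy]; first by rewrite !coef0 nm0.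
by apply: domD => //; exact: h.
Qed.

Lemma domM P P' Q Q' : dom P Q -> dom P' Q' -> dom (P * P') (Q * Q').
Proof.
move=> h h' k; rewrite !coefM; apply: (le_trans (nm_sum _ _ _)).
by apply: ler_sum => j _; rewrite nmM ler_pM ?nm_ge0.
Qed.

Lemma dom_prod I (s : seq I) f g : (forall i, dom (f i) (g i)) ->
  dom (\prod_(i <- s) f i) (\prod_(i <- s) g i).
Proof.
move=> h; elim/big_rec2: _ => [k|i y1 y2 Pi hy]; last exact: domM.
by rewrite !coef1; case: eqP => _; rewrite ?nm1 ?nm0.
Qed.

Lemma dom_ge0 P Q k : dom P Q -> 0 <= Q`_k.
Proof. by move=> /(_ k); apply: le_trans; exact: nm_ge0. Qed.

Lemma ledomM Q1 Q2 Q1' Q2' : ledom Q1 Q1' -> ledom Q2 Q2' -> ledom (Q1 * Q2) (Q1' * Q2').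
Proof.
move=> h h' k; rewrite !coefM; apply/andP; split.
  by apply: sumr_ge0 => j _; rewrite mulr_ge0//; [case/andP: (h j)|case/andP: (h' (k - j)%N)].
by apply: ler_sum => j _; case/andP: (h j) => ? ?; case/andP: (h' (k - j)%N) => ? ?; rewrite ler_pM.
Qed.

Lemma ledom_prod I (s : seq I) f g : (forall i, ledom (f i) (g i)) ->
  ledom (\prod_(i <- s) f i) (\prod_(i <- s) g i).
Proof.
move=> h; elim/big_rec2: _ => [k|i y1 y2 Pi hy]; last exact: ledomM.
by rewrite !coef1; case: eqP => _; rewrite ?lexx ?ler01.
Qed.

(* In the Leibniz expansion the permutations are among all maps, and the sum over all maps
   of the products of the majorants factors into the product of the row sums. *)
Lemma dom_det n (B : 'M[{poly C}]_n) (q : 'I_n -> 'I_n -> {poly R}) :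
  (forall i j, dom (B i j) (q i j)) -> dom (\det B) (\prod_i \sum_j q i j).
Proof.
move=> h k; have q0 i j l : 0 <= (q i j)`_l by exact: dom_ge0 (h i j).
rewrite bigA_distr_bigA (bigID (fun f : {ffun 'I_n -> 'I_n} => injectiveb f)) /= coefD.
apply: ler_wpDr.
  rewrite coef_sum; apply: sumr_ge0 => f _.
  have : ledom (\prod_i q i (f i)) (\prod_i q i (f i)).
    by apply: ledom_prod => i l; rewrite lexx q0.
  by move=> /(_ k)/andP[].
rewrite (reindex (@pval _)) /=; last first.
  pose in_Sn := insubd (1%g : 'S_n).
  by exists in_Sn => /= f Uf; first apply: val_inj; apply: insubdK.
rewrite (eq_bigl xpredT) => [|s]; last by rewrite (valP s).
apply: (@dom_sum _ _ _ (fun s : 'S_n => (-1) ^+ s * \prod_i B i (s i))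
   (fun s => \prod_i q i (pval s i))) => s _ l.
have -> : nm ((-1) ^+ s * \prod_i B i (s i))`_l = nm (\prod_i B i (s i))`_l.
  by rewrite mulr_sign; case: ifP => _//; rewrite coefN nmN.
by rewrite pvalE; apply: dom_prod => i; exact: h.
Qed.

Variables (r : R).
Hypothesis r01 : 0 < r < 1.

(** A crude form of Euler's q-identity: in the infinite product the coefficient is [b^k r^'C(k, 2)]
    divided by the product of [1 - r^i] for [1 <= i <= k]. The induction peels off the factor
    [i = 0] and replaces [b] by [b * r]. *)
Lemma gauss_coef (n k : nat) (b : R) : 0 <= b ->
  0 <= (\prod_(i < n) (1 + 'X * (b * r ^+ i)%:P))`_k <= (b / (1 - r)) ^+ k * r ^+ 'C(k, 2).
Proof.
have /andP[r0 r1] := r01; have r1' : 0 < 1 - r by rewrite subr_gt0.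
elim: n k b => [|n IH] k b b0.
  rewrite big_ord0 coef1; case: k => [|k]; first by rewrite !expr0 mulr1 lexx ler01.
  by rewrite /= lexx mulr_ge0 ?exprn_ge0 ?divr_ge0 ?(ltW r1') ?(ltW r0).
have E : \prod_(i < n.+1) (1 + 'X * (b * r ^+ i)%:P) =
    (1 + 'X * b%:P) * \prod_(i < n) (1 + 'X * (b * r * r ^+ i)%:P).
  rewrite big_ord_recl expr0 mulr1; congr (_ * _); apply: eq_bigr => i _.
  by rewrite lift0 exprS mulrA.
rewrite E mulrDl mul1r -mulrA coefD coefXM coefCM.
have br0 : 0 <= b * r by rewrite mulr_ge0// ltW.
have /andP[h0 h1] := IH k (b * r) br0.
case: k h0 h1 => [|k] h0 h1.
  by rewrite /= addr0 h0 /=; apply: (le_trans h1); rewrite !expr0.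
have /andP[h2 h3] := IH k (b * r) br0; rewrite /=; apply/andP; split.
  by rewrite addr_ge0// mulr_ge0.
(* The two terms are the shares [r^(k+1)] and [1 - r^(k+1)] of the left-hand side; the factor
   [(1 - r^(k+1)) / (1 - r) >= 1] is the slack. *)
have -> : (b / (1 - r)) ^+ k.+1 * r ^+ 'C(k.+1, 2) =
   (b * r / (1 - r)) ^+ k.+1 * r ^+ 'C(k.+1, 2) +
   b * ((b * r / (1 - r)) ^+ k * r ^+ 'C(k, 2)) * ((1 - r ^+ k.+1) / (1 - r)).
  rewrite binS bin1 exprD !exprMn !exprS; field; exact: lt0r_neq0.
apply: lerD => //; rewrite -[leLHS]mulr1; apply: ler_pM => //.
- by rewrite mulr_ge0.
- by rewrite ler_wpM2l.
rewrite ler_pdivlMr// mul1r lerD2l lerN2 exprS.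
by rewrite ler_piMr ?(ltW r0)// exprn_ile1 ?(ltW r0) ?(ltW r1).
Qed.

Lemma geom_sum_le n : \sum_(j < n) r ^+ j <= (1 - r)^-1.
Proof.
have /andP[r0 r1] := r01; have r1' : 0 < 1 - r by rewrite subr_gt0.
rewrite -[leRHS]mul1r ler_pdivlMr// mulrC -[leLHS]opprK -mulNr opprB -subrX1 opprB.
by rewrite lerBlDr lerDl exprn_ge0// ltW.
Qed.

Variables (b : R).
Hypothesis b0 : 0 <= b.

Let row i : {poly R} := 1 + 'X * (b / (1 - r) * r ^+ i)%:P.
(** One division by [1 - r] comes from the row sums [\sum_j r^j], the other from [gauss_coef]. *)
Let be := b / (1 - r) / (1 - r).

Let bp : 0 <= b / (1 - r).
Proof. by have /andP[_ r1] := r01; rewrite divr_ge0// subr_ge0 ltW. Qed.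

Let rX i : 0 <= r ^+ i. Proof. by have /andP[/ltW r0 _] := r01; rewrite exprn_ge0. Qed.

Let Yq n (i j : 'I_n) : {poly R} := (i == j)%:R + 'X * (b * (r ^+ i * r ^+ j))%:P.

Let dom_Y n (M : 'M[C]_n) : (forall i j, nm (M i j) <= b * (r ^+ i * r ^+ j)) ->
  forall i j, dom (Ymx M i j) (Yq i j).
Proof.
move=> h i j k; rewrite !mxE coefB coefXM coefMn coef1 /Yq coefD coefXM coefMn coef1.
rewrite !coefC; case: k => [|[|k]] /=.
- by rewrite subr0 addr0; case: eqP => _; rewrite ?mulr1n ?mulr0n ?nm1 ?nm0.
- by rewrite !mul0rn sub0r add0r nmN; exact: h.
- by rewrite !mul0rn subr0 addr0 nm0.
Qed.

Let ledom_row n (i : 'I_n) : ledom (\sum_j Yq i j) (row i).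
Proof.
have -> : \sum_j Yq i j = 1 + 'X * (b * r ^+ i * \sum_(j < n) r ^+ j)%:P.
  rewrite big_split /=; congr (_ + _).
    rewrite (bigD1 i)//= eqxx big1 ?addr0// => j ji.
    by rewrite eq_sym (negbTE ji).
  rewrite -mulr_sumr -raddf_sum /=; congr (_ * _%:P).
  by rewrite mulr_sumr; apply: eq_bigr => j _; rewrite mulrA.
have S0 : 0 <= \sum_(j < n) r ^+ j by apply: sumr_ge0.
move=> k; rewrite /row !coefD coef1 !coefXM !coefC.
case: k => [|[|k]] /=; rewrite ?addr0 ?lexx ?ler01// !add0r; apply/andP; split.
  by rewrite !mulr_ge0.
by rewrite [leRHS]mulrAC ler_wpM2l ?mulr_ge0 ?geom_sum_le.
Qed.

Let dom_le P Q Q' k : dom P Q -> ledom Q Q' -> nm P`_k <= Q'`_k.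
Proof. by move=> h h'; apply: le_trans (h k) _; case/andP: (h' k). Qed.

Lemma fred_bound n (M : 'M[C]_n) k : (forall i j, nm (M i j) <= b * (r ^+ i * r ^+ j)) ->
  nm (fred M)`_k <= be ^+ k * r ^+ 'C(k, 2).
Proof.
move=> h; apply: le_trans (andP (gauss_coef n k bp)).2.
apply: dom_le (dom_det (dom_Y h)) _; apply: ledom_prod => i; exact: ledom_row.
Qed.

(** By [tr_adj_repl] one row at a time is replaced. Its majorant is a constant, at most
    [b / (1 - r) * r^j] times [row j], so the product of all rows is again [G]; the sum over [j]
    gives the extra factor [be]. *)
Lemma adj_bound n (M MH : 'M[C]_n) k :
  (forall i j, nm (M i j) <= b * (r ^+ i * r ^+ j)) ->
  (forall i j, nm (MH i j) <= b * (r ^+ i * r ^+ j)) ->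
  nm (\tr (\adj (Ymx M) *m map_mx polyC MH))`_k <= be * (be ^+ k * r ^+ 'C(k, 2)).
Proof.
move=> h hH; rewrite tr_adj_repl coef_sum; apply: (le_trans (nm_sum _ _ _)).
have /andP[_ g1] := gauss_coef n k bp; set G := \prod_(i < n) _ in g1.
have /andP[_ r1] := r01.
apply: (@le_trans _ _ (\sum_(j < n) b / (1 - r) * r ^+ j * G`_k)); last first.
  rewrite -mulr_suml -mulr_sumr; apply: ler_pM => //.
  - by rewrite mulr_ge0// sumr_ge0.
  - by have /andP[] := gauss_coef n k bp.
  - by rewrite /be ler_wpM2l ?geom_sum_le.
apply: ler_sum => j _; rewrite -coefCM.
pose q' (i l : 'I_n) : {poly R} := if i == j then (b * (r ^+ i * r ^+ l))%:P else Yq i l.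
apply: (@dom_le _ (\prod_i \sum_l q' i l)).
  apply: dom_det => i l m; rewrite mxE /q'; case: eqP => [->|_]; last exact: dom_Y.
  by rewrite mxE !coefC; case: eqP => _; rewrite ?nm0//; exact: hH.
have -> : G = row j * \prod_(i < n | i != j) row i by rewrite /G (bigD1 j).
rewrite (bigD1 j)//= mulrA; apply: ledomM; last first.
  move=> m; have : ledom (\prod_(i < n) (if i != j then \sum_l q' i l else 1))
      (\prod_(i < n) (if i != j then row i else 1)).
    apply: ledom_prod => i l; case: ifP => ij; last by rewrite coef1; case: eqP; rewrite lexx ?ler01.
    rewrite (eq_bigr (Yq i)) => [|l' _]; first exact: ledom_row.
    by rewrite /q' (negbTE ij).
  by move/(_ m); rewrite -!big_mkcond.
have -> : \sum_l q' j l = (b * r ^+ j * \sum_(l < n) r ^+ l)%:P.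
  rewrite mulr_sumr raddf_sum /=; apply: eq_bigr => l _.
  by rewrite /q' eqxx mulrA.
have S0 : 0 <= \sum_(j < n) r ^+ j by apply: sumr_ge0.
move=> m; rewrite coefCM coefD coef1 coefXM !coefC; case: m => [|m] /=.
  rewrite addr0 mulr1 !mulr_ge0//=.
  by rewrite [leRHS]mulrAC ler_wpM2l ?mulr_ge0 ?geom_sum_le.
have c0 : 0 <= b / (1 - r) * r ^+ j := mulr_ge0 bp (rX j).
by rewrite lexx add0r (mulr_ge0 c0)//; case: ifP.
Qed.

End Majorant.

(** * Passage to the limit of the truncations *)

Section Limit.
Variable R : realType.
Local Notation C := (Cplx R).

Definition clim (u : nat -> C) (l : C) := forall e : R, 0 < e -> exists Q0, forall Q,
  (Q0 <= Q)%N -> nm (u Q - l) <= e.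

Lemma clim_geom u l (c : R) : 0 <= c -> (forall Q, nm (u Q - l) <= c * (1 / 4) ^+ Q) -> clim u l.
Proof.
move=> c0 h e e0.
have [n hn] : exists n : nat, c / e < n%:R.
  by exists (Num.bound (c / e)); apply: archi_boundP; rewrite divr_ge0// ltW.
exists n => Q nQ; apply: (le_trans (h Q)).
rewrite expr_div_n expr1n mul1r ler_pdivrMr ?exprn_gt0// mulrC -ler_pdivrMr//.
apply: (le_trans (ltW hn)); rewrite -natrX ler_nat; apply: (leq_trans nQ).
by rewrite ltnW// ltn_expl.
Qed.

Lemma clim_cst c : clim (fun=> c) c.
Proof. by move=> e e0; exists 0%N => Q _; rewrite subrr nm0 ltW. Qed.

Lemma climD u v l l' : clim u l -> clim v l' -> clim (fun Q => u Q + v Q) (l + l').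
Proof.
move=> hu hv e e0; have e20 : 0 < e / 2 by rewrite divr_gt0.
have [n hn] := hu _ e20; have [m hm] := hv _ e20; exists (maxn n m) => Q.
rewrite geq_max => /andP[nQ mQ].
rewrite (_ : _ - _ = (u Q - l) + (v Q - l')); last by ring.
by apply: (le_trans (nmD _ _)); rewrite [e]splitr lerD ?hn ?hm.
Qed.

Lemma climM u v l l' : clim u l -> clim v l' -> clim (fun Q => u Q * v Q) (l * l').
Proof.
move=> hu hv e e0; pose B := 1 + nm l + nm l'.
have B0 : 0 < B by rewrite /B -addrA ltr_pwDl// addr_ge0 ?nm_ge0.
pose e1 := Num.min 1 (e / 2 / B).
have e10 : 0 < e1 by rewrite lt_min ltr01 !divr_gt0.
have [n hn] := hu _ e10; have [m hm] := hv _ e10; exists (maxn n m) => Q.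
rewrite geq_max => /andP[/hn {}hn /hm {}hm].
rewrite (_ : _ - _ = (u Q - l) * (v Q - l') + (u Q - l) * l' + l * (v Q - l')); last by ring.
have e1B : e1 * B <= e / 2 by rewrite -ler_pdivlMr// ge_min lexx orbT.
have e11 : e1 <= 1 by rewrite ge_min lexx.
apply: (le_trans (nmD _ _)); have := nmD ((u Q - l) * (v Q - l')) ((u Q - l) * l').
rewrite !nmM; move: hn hm e1B; rewrite /B.
have := nm_ge0 l; have := nm_ge0 l'; have := nm_ge0 (u Q - l); have := nm_ge0 (v Q - l').
set x := nm (u Q - l); set y := nm (v Q - l'); set z := nm l; set w := nm l'.
move=> y0 x0 w0 z0 xe ye eB h.
have h1 : x * y <= e1 * 1 by rewrite ler_pM// (le_trans ye).
have h2 : x * w <= e1 * w by rewrite ler_wpM2r.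
have h3 : z * y <= e1 * z by rewrite mulrC ler_wpM2r.
by move: e0 eB; lra.
Qed.

Lemma clim_sum I (s : seq I) (u : I -> nat -> C) l : (forall i, clim (u i) (l i)) ->
  clim (fun Q => \sum_(i <- s) u i Q) (\sum_(i <- s) l i).
Proof.
move=> h; elim: s => [|i s IH].
  rewrite big_nil (_ : (fun Q => _) = fun=> 0); first exact: clim_cst.
  by apply/funext => Q; rewrite big_nil.
rewrite big_cons (_ : (fun Q => _) = fun Q => u i Q + \sum_(j <- s) u j Q); first exact: climD.
by apply/funext => Q; rewrite big_cons.
Qed.

Lemma clim_bound u l B : clim u l -> (forall Q, nm (u Q) <= B) -> nm l <= B.
Proof.
move=> h hB; apply: nm_le_eps => e e0; have [n /(_ n (leqnn n)) hn] := h _ e0.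
rewrite -[l](subrK (u n)) addrC; apply: (le_trans (nmD _ _)).
by rewrite lerD// nmB.
Qed.

(** [a] obeys the recursion of the coefficients of [fred (M Q)] with the limits of the traces, so
    the coefficients converge one by one. The bounds do not depend on [Q] or on the size of the
    matrices and persist. *)
Lemma fredholm_limit (n : nat -> nat) (M MH : forall Q, 'M[C]_(n Q)) (T U a al : nat -> C) (r b : R) :
  0 < r < 1 -> 0 <= b ->
  (forall Q i j, nm (M Q i j) <= b * (r ^+ i * r ^+ j)) ->
  (forall Q i j, nm (MH Q i j) <= b * (r ^+ i * r ^+ j)) ->
  (forall m, clim (fun Q => \tr (M Q ^+ m.+1)) (T m.+1)) ->
  (forall m, clim (fun Q => \tr (MH Q *m M Q ^+ m)) (U m.+1)) ->
  a 0 = 1 -> (forall k, a k.+1 *+ k.+1 = - \sum_(j < k.+1) a (k - j)%N * T j.+1) ->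
  (forall k, al k.+1 = - \sum_(j < k.+1) a (k - j)%N * U j.+1) ->
  let be := b / (1 - r) / (1 - r) in
  forall k, nm (a k) <= be ^+ k * r ^+ 'C(k, 2) /\
    nm (al k.+1) <= be * (be ^+ k * r ^+ 'C(k, 2)).
Proof.
move=> r01 b0 hM hH hT hU a0 aS alS be k.
have clN u (l : C) : clim u l -> clim (fun Q => - u Q) (- l).
  move=> h; have := climM (clim_cst (-1)) h; rewrite mulN1r.
  by congr clim; apply/funext => Q; rewrite mulN1r.
have ca m : clim (fun Q => (fred (M Q))`_m) (a m).
  elim/ltn_ind: m => -[|m] IH.
    rewrite a0; under eq_fun do rewrite fred0; exact: clim_cst.
  have m0 : (m.+1%:R : C) != 0 by rewrite pnatr_eq0.
  have -> : a m.+1 = m.+1%:R^-1 * - \sum_(j < m.+1) a (m - j)%N * T j.+1.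
    by rewrite -aS -[a _ *+ _]mulr_natl mulKf.
  rewrite (_ : (fun Q => _) = fun Q => m.+1%:R^-1 *
      - \sum_(j < m.+1) (fred (M Q))`_(m - j) * \tr (M Q ^+ j.+1)); last first.
    by apply/funext => Q; rewrite -Newton -[_`_ _ *+ _]mulr_natl mulKf.
  apply: climM; first exact: clim_cst.
  apply: clN; apply: (@clim_sum _ _ _ (fun j : 'I_m.+1 => a (m - j)%N * T j.+1)) => j.
  by apply: climM => //; apply: IH; rewrite ltnS leq_subr.
split; first by apply: (clim_bound (ca k)) => Q; exact: fred_bound.
have : clim (fun Q => - (\tr (\adj (Ymx (M Q)) *m map_mx polyC (MH Q)))`_k) (al k.+1).
  rewrite alS; apply: clN; under eq_fun do rewrite tr_adj_coef.
  by apply: (@clim_sum _ _ _ (fun j : 'I_k.+1 => a (k - j)%N * U j.+1)) => j; apply: climM.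
by move/clim_bound; apply => Q; rewrite nmN; exact: adj_bound.
Qed.
End Limit.

(** * Sums over compositions *)

Section Compositions.
Variable R : realType.
Implicit Types (x u : nat -> R) (n l : nat).

(** The series [\sum_(m > 0) x_m z^m] cut at degree [n]. The entry [x 0] is replaced by 0 because
    the parts of a composition are positive. *)
Definition gpoly n x : {poly R} := \poly_(m < n.+1) (if m is 0 then 0 else x m).

Lemma gpoly_coef n x m : (m <= n)%N -> (gpoly n x)`_m = if m is 0 then 0 else x m.
Proof. by move=> mn; rewrite coef_poly ltnS mn. Qed.

Lemma composition_coef n l (f : 'I_l -> nat -> R) :
  \sum_(s : l.-tuple 'I_n.+1 | is_composition s) \prod_(j < l) f j (tnth s j) =
  (\prod_(j < l) gpoly n (f j))`_n.
Proof.
pose c (j : 'I_l) (m : nat) : R := if m is 0 then 0 else f j m.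
have -> : \prod_(j < l) gpoly n (f j) =
    \sum_(g : {ffun 'I_l -> 'I_n.+1}) (\prod_j c j (g j)) *: 'X^(\sum_j g j).
  transitivity (\prod_(j < l) \sum_(m < n.+1) c j m *: 'X^m).
    by apply: eq_bigr => j _; rewrite /gpoly poly_def.
  rewrite bigA_distr_bigA; apply: eq_bigr => g _ /=.
  rewrite scaler_prod; congr (_ *: _).
  by elim/big_rec2: _ => //= j a b _ ->; rewrite exprD.
rewrite coef_sumMXn.
rewrite (reindex (fun s : l.-tuple 'I_n.+1 => [ffun j => tnth s j])) /=; last first.
  exists (fun g => [tuple g j | j < l]) => [s _|g _].
    by apply: eq_from_tnth => j; rewrite tnth_mktuple ffunE.
  by apply/ffunP => j; rewrite ffunE tnth_mktuple.
rewrite [RHS](bigID (fun s : l.-tuple 'I_n.+1 => [forall j, (0 < tnth s j)%N])) /=.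
rewrite addrC [X in X + _]big1 ?add0r => [|s /andP[_]]; last first.
  rewrite negb_forall => /existsP[j]; rewrite -eqn0Ngt => /eqP s0.
  by rewrite (bigD1 j)//= ffunE s0 /c mul0r.
apply: eq_big => [s|s /andP[/forallP s0 _]].
  rewrite /is_composition andbC; congr (_ && _).
  by congr (_ == _); apply: eq_bigr => j _; rewrite ffunE.
by apply: eq_bigr => j _; rewrite ffunE /c; case: (tnth s j : nat) (s0 j).
Qed.

Definition sg l : R := (-1) ^+ l / l`!%:R.

Lemma sgS l : sg l.+1 * l.+1%:R = - sg l.
Proof.
rewrite /sg factS natrM exprS; field.
by rewrite pnatr_eq0 -lt0n fact_gt0 addrC natr1 pnatr_eq0.
Qed.

Definition epoly L n x : {poly R} := \sum_(l < L) sg l *: gpoly n x ^+ l.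

(** The coefficient of [z^n] in [exp (- \sum_(m > 0) x_m z^m)]. *)
Definition expc x n := (epoly n.+1 n x)`_n.

Lemma coefX_small (P : {poly R}) l n : P`_0 = 0 -> (n < l)%N -> (P ^+ l)`_n = 0.
Proof.
move=> P0; elim: l n => [|l IH] n // nl; rewrite exprS coefM big1// => j _.
have [j0|j0] := posnP j; first by rewrite j0 P0 mul0r.
by rewrite IH ?mulr0//; have := ltn_ord j; lia.
Qed.

Lemma coefX_eq (P Q : {poly R}) l n : (forall m, (m <= n)%N -> P`_m = Q`_m) ->
  forall m, (m <= n)%N -> (P ^+ l)`_m = (Q ^+ l)`_m.
Proof.
move=> h; elim: l => [|l IH] m mn //; rewrite !exprS !coefM; apply: eq_bigr => j _.
by rewrite h ?IH//; have := ltn_ord j; lia.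
Qed.

(** [gpoly] has no constant term, so powers beyond the [n]-th do not reach this coefficient, and
    both truncations are harmless. *)
Lemma epoly_coef L N x n : (n < L)%N -> (n <= N)%N -> (epoly L N x)`_n = expc x n.
Proof.
move=> nL nN; rewrite /expc /epoly.
have g0 M : (gpoly M x)`_0 = 0 by rewrite gpoly_coef.
rewrite !coef_sum -(subnKC nL) big_split_ord /= [X in _ + X]big1 ?addr0 => [|j _].
  apply: eq_bigr => l _; rewrite !coefZ; congr (_ * _); apply: (@coefX_eq _ _ _ n) => // m mn.
  by rewrite !gpoly_coef// (leq_trans mn).
by rewrite coefZ coefX_small ?mulr0//; lia.
Qed.

Lemma expc0 x : expc x 0 = 1.
Proof. by rewrite /expc /epoly big_ord1 coefZ expr0 coef1 /sg expr0 fact0 divr1 mulr1. Qed.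

(** The differential equation [(exp (- X))' = - X' exp (- X)]; [sgS] differentiates the outer
    series, and the loss of one power is covered by [epoly_coef]. *)
Lemma expcS x n : n.+1%:R * expc x n.+1 = - \sum_(j < n.+1) expc x (n - j) * (j.+1%:R * x j.+1).
Proof.
rewrite mulr_natl -coef_deriv; set N := n.+1; rewrite /epoly raddf_sum /= big_ord_recl.
rewrite expr0 derivZ derivC scaler0 add0r.
have -> : \sum_(i < N) (sg (lift ord0 i) *: gpoly N x ^+ lift ord0 i)^`() =
    - ((gpoly N x)^`() * epoly N N x).
  rewrite /epoly mulr_sumr -sumrN; apply: eq_bigr => i _; rewrite lift0.
  rewrite derivZ deriv_exp /= -[_ *+ _]scaler_nat scalerA sgS scaleNr.
  by rewrite scalerAr.
rewrite coefN coefM; congr (- _); apply: eq_bigr => j _.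
rewrite coef_deriv gpoly_coef// epoly_coef ?ltnS ?leq_subr//; last by rewrite /N; lia.
by rewrite -[x j.+1 *+ _]mulr_natl mulrC.
Qed.

Lemma composition_expc x n : \sum_(1 <= l < n.+2) sg l *
    (\sum_(s : l.-tuple 'I_n.+2 | is_composition s) \prod_(j < l) x (tnth s j)) = expc x n.+1.
Proof.
rewrite /expc /epoly big_ord_recl coefD coefZ expr0 coef1 mulr0 add0r coef_sum.
rewrite big_add1 big_mkord; apply: eq_bigr => l _.
by rewrite (composition_coef _ (fun _ => x)) prodr_const card_ord coefZ lift0.
Qed.

(** The first variation of [exp (- X)] in a direction [U] is [- U exp (- X)]. The [l] positions of
    the marked part contribute equally, and [sgS] absorbs the factor [l]. *)
Lemma composition_deriv x u n : \sum_(1 <= l < n.+2) sg l *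
    (\sum_(s : l.-tuple 'I_n.+2 | is_composition s) \sum_(j < l) u (tnth s j) *
      \prod_(m < l | m != j) x (tnth s m)) = - \sum_(j < n.+1) expc x (n - j) * u j.+1.
Proof.
transitivity (- (gpoly n.+1 u * epoly n.+1 n.+1 x)`_n.+1).
  rewrite big_add1 big_mkord /epoly mulr_sumr coef_sum -sumrN; apply: eq_bigr => l _.
  rewrite exchange_big /=.
  transitivity (sg l.+1 * \sum_(j < l.+1) (gpoly n.+1 u * gpoly n.+1 x ^+ l)`_n.+1).
    congr (_ * _); apply: eq_bigr => j _.
    transitivity (\sum_(s : l.+1.-tuple 'I_n.+2 | is_composition s)
        \prod_(m < l.+1) (if m == j then u else x) (tnth s m)).
      apply: eq_bigr => s _; rewrite [RHS](bigD1 j)//= eqxx; congr (_ * _).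
      by apply: eq_bigr => m /negPf ->.
    rewrite (composition_coef _ (fun m => if m == j then u else x)); congr (polyseq _)`__.
    rewrite (bigD1 j)//= eqxx; congr (_ * _).
    rewrite (eq_bigr (fun=> gpoly n.+1 x)) => [|m /negPf ->//].
    rewrite prodr_const; congr (_ ^+ _).
    by have := cardC1 j; rewrite card_ord.
  rewrite sumr_const card_ord -[_ *+ _]mulr_natl mulrA sgS mulNr; congr (- _).
  by rewrite -scalerAr coefZ.
congr (- _); rewrite coefM big_ord_recl gpoly_coef// mul0r add0r.
apply: eq_bigr => j _; rewrite lift0 gpoly_coef// subSS epoly_coef ?ltnS ?leq_subr//; last first.
  by have := ltn_ord j; lia.
exact: mulrC.
Qed.
End Compositions.

(** * Convergence of the quotients *)

Section Sequences.
Variable R : realType.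
Implicit Types (x y t u : nat -> R) (q e : R).

Lemma leq_sqr n : (n <= n ^ 2)%N.
Proof. by case: n => // n; rewrite -mulnn leq_pmulr. Qed.

Lemma geom_small q : 0 < q < 1 -> forall e, 0 < e -> exists n0, forall n, (n0 <= n)%N -> q ^+ n <= e.
Proof.
move=> /andP[q0 q1] e e0.
have : (fun n => q ^+ n) @ \oo --> (0 : R) by apply: cvg_expr; rewrite ger0_norm// ltW.
move=> /cvgrPdist_le /(_ e e0) [n0 _ h]; exists n0 => n /h /=.
by rewrite sub0r normrN; apply: le_trans; exact: ler_norm.
Qed.

Lemma geom_sum_bound q n : 0 < q < 1 -> \sum_(j < n) q ^+ j <= (1 - q)^-1.
Proof.
move=> /andP[q0 q1]; have q1' : 0 < 1 - q by rewrite subr_gt0.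
rewrite -[leRHS]mul1r ler_pdivlMr// mulrC -[leLHS]opprK -mulNr opprB -subrX1 opprB.
by rewrite lerBlDr lerDl exprn_ge0// ltW.
Qed.

(** With [s = (1 + q) / 2] one has [q <= s^2]. One factor [s^n] absorbs [n + 1], since [(n + 1) s^n]
    is at most the sum of the [s^j] for [j <= n]; the other is small. *)
Lemma lin_geom_small q : 0 < q < 1 -> forall c e, 0 < e ->
  exists n0, forall n, (n0 <= n)%N -> c * (n.+1%:R * q ^+ n) <= e.
Proof.
move=> /andP[q0 q1] c e e0; pose s := (1 + q) / 2.
have s01 : 0 < s < 1 by rewrite /s; apply/andP; split; lra.
have /andP[s0 s1] := s01; have s1' : 0 < 1 - s by rewrite subr_gt0.
have qs : q <= s ^+ 2 by rewrite /s; nra.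
pose c' := `|c| + 1; have c'0 : 0 < c' by rewrite ltr_wpDl.
have [n0 h] := geom_small s01 (mulr_gt0 (divr_gt0 e0 c'0) s1').
exists n0 => n /h hn; apply: (@le_trans _ _ (c' * (n.+1%:R * q ^+ n))).
  rewrite ler_wpM2r ?mulr_ge0 ?exprn_ge0 ?(ltW q0)//.
  by apply: (le_trans (ler_norm c)); rewrite lerDl.
have h1 : n.+1%:R * s ^+ n <= (1 - s)^-1.
  apply: le_trans (geom_sum_bound n.+1 s01).
  rewrite mulr_natl -[X in _ *+ X]card_ord -sumr_const; apply: ler_sum => j _.
  by apply: ler_wiXn2l; rewrite ?(ltW s0) ?(ltW s1)// -ltnS.
have h2 : q ^+ n <= s ^+ n * s ^+ n.
  rewrite -exprMn -expr2; apply: lerXn2r => //; rewrite nnegrE ?(ltW q0)//.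
  by rewrite exprn_ge0 ?(ltW s0).
apply: (@le_trans _ _ (c' * ((1 - s)^-1 * (e / c' * (1 - s))))).
  rewrite ler_wpM2l ?(ltW c'0)//; apply: (@le_trans _ _ (n.+1%:R * s ^+ n * s ^+ n)).
    by rewrite -mulrA ler_wpM2l.
  by rewrite ler_pM ?mulr_ge0 ?exprn_ge0 ?(ltW s0).
by rewrite le_eqVlt; apply/orP; left; apply/eqP; field; rewrite !gt_eqF.
Qed.

Lemma conv_sum x y n : \sum_(m < n.+1) \sum_(j < m.+1) x j * y (m - j)%N =
  \sum_(j < n.+1) x j * \sum_(i < (n - j).+1) y i.
Proof.
elim: n => [|n IH]; first by rewrite !big_ord1.
rewrite big_ord_recr IH [RHS]big_ord_recr /= subnn big_ord1.
rewrite [X in _ + X]big_ord_recr /= subnn addrA; congr (_ + _).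
rewrite -big_split; apply: eq_bigr => j _ /=.
have jn : (j <= n)%N by rewrite -ltnS.
by rewrite (subSn jn) [in RHS]big_ord_recr /= mulrDr.
Qed.

(** Every left end [v k - E k] lies below every right end [v m + E m], so the supremum of the left
    ends keeps the rate [E] without loss. *)
Lemma cauchy_rate v E : (forall k m, (k <= m)%N -> `|v m - v k| <= E k) ->
  exists l : R, forall k : nat, `|l - v k| <= E k.
Proof.
move=> h; have E0 k : 0 <= E k by have := h k k (leqnn k); apply: le_trans.
have vE k m : v k - E k <= v m + E m.
  have [km|/ltnW mk] := leqP k m.
    by have := h k m km; have := E0 m; rewrite ler_norml => ? /andP[]; lra.
  by have := h m k mk; have := E0 k; rewrite ler_norml => ? /andP[]; lra.
pose S := range (fun k => v k - E k); have S0 : S !=set0 by exists (v 0 - E 0); exists 0.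
exists (sup S) => k.
have A : v k - E k <= sup S.
  by apply: ub_le_sup; [exists (v 0 + E 0) => _ [m _ <-]|exists k].
have B : sup S <= v k + E k by apply: ge_sup => // _ [m _ <-].
by rewrite ler_norml; lra.
Qed.

(** The coefficients of the exponential of a series with radius of convergence [1 / k]. For [n > n0]
    the factor [n] exceeds [B = C / (1 - k / q)], which closes the induction; [M] is chosen to cover
    the first terms. *)
Lemma growth y k C : 0 < k < 1 -> 0 <= C ->
  (forall n, n.+1%:R * `|y n.+1| <= \sum_(j < n.+1) C * k ^+ j.+1 * `|y (n - j)%N|) ->
  exists M q, [/\ 0 <= M, k < q < 1 & forall n, `|y n| <= M * q ^+ n].
Proof.
move=> /andP[k0 k1] C0 h; pose q := (1 + k) / 2.
have kq : k < q by rewrite /q; lra.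
have q1 : q < 1 by rewrite /q; lra.
have q0 : 0 < q by apply: lt_trans kq.
pose rr := k / q; have rr01 : 0 < rr < 1 by rewrite divr_gt0//= ltr_pdivrMr// mul1r.
have /andP[rr0 rr1] := rr01.
pose B := C / (1 - rr); have B0 : 0 <= B by rewrite divr_ge0// subr_ge0 ltW.
pose n0 := Num.bound B; pose M := \sum_(j < n0.+1) `|y j| / q ^+ j.
have M0 : 0 <= M by apply: sumr_ge0 => j _; rewrite divr_ge0// exprn_ge0// ltW.
exists M, q; split; rewrite ?kq//; elim/ltn_ind => n IH.
have qn : 0 < q ^+ n by rewrite exprn_gt0.
have [nn0|nn0] := leqP n n0.
  rewrite -ler_pdivrMr// /M (bigD1 (Ordinal (nn0 : (n < n0.+1)%N)))//= lerDl.
  by apply: sumr_ge0 => j _; rewrite divr_ge0// exprn_ge0// ltW.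
case: n qn nn0 IH => // n qn nn0 IH.
have n1 : 0 < n.+1%:R :> R by rewrite ltr0n.
rewrite -(ler_pM2l n1); apply: (le_trans (h n)).
apply: (@le_trans _ _ (\sum_(j < n.+1) C * M * q ^+ n.+1 * rr ^+ j)).
  apply: ler_sum => j _; have jn : (j <= n)%N by rewrite -ltnS.
  have := IH (n - j)%N; rewrite ltnS leq_subr => /(_ isT) hj.
  apply: (@le_trans _ _ (C * k ^+ j.+1 * (M * q ^+ (n - j)))).
    by rewrite ler_wpM2l// mulr_ge0// exprn_ge0// ltW.
  have -> : q ^+ n.+1 = q ^+ j.+1 * q ^+ (n - j) by rewrite -exprD addSn subnKC.
  have -> : C * M * (q ^+ j.+1 * q ^+ (n - j)) * rr ^+ j =
      C * (M * q ^+ (n - j)) * (q * (q * rr) ^+ j).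
    by rewrite [(q * rr) ^+ j]exprMn [q ^+ j.+1]exprS; ring.
  have -> : q * rr = k by rewrite /rr mulrC divfK// gt_eqF.
  have -> : C * k ^+ j.+1 * (M * q ^+ (n - j)) = C * (M * q ^+ (n - j)) * (k * k ^+ j).
    by rewrite exprS; ring.
  rewrite ler_wpM2l ?mulr_ge0 ?exprn_ge0 ?(ltW q0)//.
  by rewrite ler_wpM2r ?exprn_ge0 ?(ltW k0) ?(ltW kq).
rewrite -mulr_sumr; apply: (@le_trans _ _ (C * M * q ^+ n.+1 * (1 - rr)^-1)).
  by rewrite ler_wpM2l ?geom_sum_bound// !mulr_ge0// exprn_ge0// ltW.
have -> : C * M * q ^+ n.+1 * (1 - rr)^-1 = B * (M * q ^+ n.+1) by rewrite /B; ring.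
rewrite ler_wpM2r ?mulr_ge0 ?(ltW qn)//.
apply: le_trans (ltW (archi_boundP B0)) _.
by rewrite ler_nat ltnW.
Qed.

(** By Bernoulli [r = 4 rho - 3 <= rho^4], hence [r^'C(n, 2) <= rho^(2 n^2 - 2 n)]. One factor
    [rho^(n^2)] is kept; the other joins [B^n] in [(A rho^n)^n], which is at most 1 for large
    [n]. *)
Lemma superexp_bound (r B : R) : 0 < r < 1 -> 1 <= B -> exists c rho : R, [/\ 0 < rho < 1, 0 <= c &
  forall n, B ^+ n * r ^+ 'C(n, 2) <= c * rho ^+ (n ^ 2)].
Proof.
move=> /andP[r0 r1] B1; pose rho := (3 + r) / 4.
have rho0 : 0 < rho by rewrite /rho; lra.
have rho1 : rho < 1 by rewrite /rho; lra.
have rr : r <= rho ^+ 4.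
  have h : 2 * rho - 1 <= rho ^+ 2 by nra.
  have -> : rho ^+ 4 = (rho ^+ 2) ^+ 2 by rewrite -exprM.
  have : r = 4 * rho - 3 by rewrite /rho; field.
  by move: h; set s := rho ^+ 2; nra.
pose A := B / rho ^+ 2.
have A1 : 1 <= A.
  by rewrite ler_pdivlMr ?exprn_gt0// mul1r (le_trans _ B1)// exprn_ile1 ?ltW.
have A0 : 0 < A by apply: lt_le_trans A1.
have Ai : 0 < A^-1 by rewrite invr_gt0.
have rho01 : 0 < rho < 1 by rewrite rho0.
have [n0 h0] := geom_small rho01 Ai.
exists (A ^+ n0), rho; split; first by rewrite rho0.
  by rewrite exprn_ge0// ltW.
move=> n; have B0 : 0 <= B by apply: le_trans B1.
apply: (@le_trans _ _ (B ^+ n * rho ^+ (4 * 'C(n, 2)))).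
  by rewrite ler_wpM2l ?exprn_ge0// exprM lerXn2r ?nnegrE ?(ltW r0) ?exprn_ge0 ?(ltW rho0).
have -> : B ^+ n * rho ^+ (4 * 'C(n, 2)) = (A * rho ^+ n) ^+ n * rho ^+ (n ^ 2).
  have -> : B = A * rho ^+ 2 by rewrite /A divfK// gt_eqF// exprn_gt0.
  have X (m l : nat) : (A * rho ^+ m) ^+ n * rho ^+ l = A ^+ n * rho ^+ (m * n + l).
    by rewrite exprMn -mulrA -exprM -exprD.
  rewrite !X; congr (_ * _ ^+ _).
  have : (2 * 'C(n, 2) = n * n.-1)%N by rewrite mul2n bin2 -divn2 -muln2 divnK// dvdn2;
    case: (n) => // l; rewrite oddM /= andNb.
  by case: (n) => // l /=; nia.
have Arn : 0 <= A * rho ^+ n := mulr_ge0 (ltW A0) (exprn_ge0 n (ltW rho0)).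
rewrite ler_wpM2r ?exprn_ge0 ?(ltW rho0)//.
have [nn|nn] := leqP n0 n.
  apply: (@le_trans _ _ 1); last exact: exprn_ege1.
  apply: exprn_ile1; first exact: Arn.
  by rewrite mulrC -ler_pdivlMr// mul1r; apply: h0.
apply: (@le_trans _ _ (A ^+ n)).
  apply: lerXn2r; [exact: Arn|exact: ltW A0|].
  by rewrite ler_piMr ?(ltW A0)// exprn_ile1 ?ltW.
by apply: ler_weXn2l => //; exact: ltnW.
Qed.

Section Ratio.
Variables (t u a al : nat -> R) (mu k C : R).
Hypotheses (k01 : 0 < k < 1) (C0 : 0 <= C).
Hypotheses (a0 : a 0 = 1) (al0 : al 0 = 0).
Hypothesis aS : forall n, n.+1%:R * a n.+1 = - \sum_(j < n.+1) a (n - j)%N * t j.+1.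
Hypothesis alS : forall n, al n.+1 = - \sum_(j < n.+1) a (n - j)%N * u j.+1.
Hypothesis t1 : forall n, `|t n.+1 - 1| <= C * k ^+ n.+1.
Hypothesis umu : forall n, `|u n.+1 - mu| <= C * k ^+ n.+1.

(** The limit 1 of [t] produces the factor [1 - z], as [- \sum_(m > 0) z^m / m = log (1 - z)]; [e]
    is what remains in the exponent. *)
Let e n := t n.+1 - 1.
(** [b] has the generating function [q] of [\sum_n a_n z^n = (1 - z) q], and [bh] that of [1 / q]. *)
Let b n := \sum_(j < n.+1) a j.
Let bh := expc (fun n => - e n.-1 / n%:R).

Let sum_rev (f : nat -> R) n : \sum_(j < n.+1) f (n - j)%N = \sum_(j < n.+1) f j.
Proof.
rewrite (reindex_inj rev_ord_inj) /=; apply: eq_bigr => j _.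
by rewrite subSS subKn// -ltnS.
Qed.

Let aS' n : n.+1%:R * a n.+1 = - b n - \sum_(j < n.+1) e j * a (n - j)%N.
Proof.
rewrite aS /b -(sum_rev a) -opprD -big_split; congr (- _); apply: eq_bigr => j _ /=.
by rewrite /e; ring.
Qed.

Let b_0 : b 0 = a 0. Proof. by rewrite /b big_ord1. Qed.

Let b_S n : b n.+1 = b n + a n.+1. Proof. by rewrite /b big_ord_recr. Qed.

Let bS n : n.+1%:R * b n.+1 = - \sum_(j < n.+1) e j * b (n - j)%N.
Proof.
elim: n => [|n IH].
  by have := aS' 0; rewrite !big_ord1 !mul1r b_S b_0 => ->; ring.
rewrite b_S mulrDr aS' -natr1 mulrDl mul1r IH.
rewrite [in RHS]big_ord_recr /= subnn [in X in _ - X]big_ord_recr /= subnn b_0.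
rewrite [in RHS](eq_bigr (fun j : 'I_n.+1 => e j * b (n - j)%N + e j * a (n.+1 - j)%N)) => [|j _].
  by rewrite big_split /=; ring.
have jn : (j <= n)%N by rewrite -ltnS.
by rewrite (subSn jn) b_S mulrDr.
Qed.

Let bhS n : n.+1%:R * bh n.+1 = \sum_(j < n.+1) e j * bh (n - j)%N.
Proof.
rewrite /bh expcS -sumrN; apply: eq_bigr => j _; rewrite -/bh /=; field.
by rewrite addrC natr1 pnatr_eq0.
Qed.

Let e_bound n : `|e n| <= C * k ^+ n.+1. Proof. exact: t1. Qed.

Let rec_bound y : (forall n, n.+1%:R * y n.+1 = - \sum_(j < n.+1) e j * y (n - j)%N) \/
    (forall n, n.+1%:R * y n.+1 = \sum_(j < n.+1) e j * y (n - j)%N) ->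
  forall n, n.+1%:R * `|y n.+1| <= \sum_(j < n.+1) C * k ^+ j.+1 * `|y (n - j)%N|.
Proof.
move=> h n; have -> : n.+1%:R * `|y n.+1| = `|\sum_(j < n.+1) e j * y (n - j)%N|.
  rewrite -[n.+1%:R]ger0_norm// -normrM; case: h => ->//; exact: normrN.
apply: (le_trans (ler_norm_sum _ _ _)); apply: ler_sum => j _.
by rewrite normrM ler_wpM2r.
Qed.

(** With [P] the series of [e], [q' = - P q] and [(1 / q)' = P (1 / q)]; so the product of the
    truncations has derivative 0 in the degrees that they determine. *)
Let conv_bbh n : \sum_(j < n.+1) b j * bh (n - j)%N = (n == 0%N)%:R.
Proof.
case: n => [|n].
  by rewrite big_ord1 /b big_ord1 a0 mul1r /bh expc0.
have n1 : n.+1%:R != 0 :> R by rewrite pnatr_eq0.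
apply: (mulfI n1); rewrite mulr0.
pose B := \poly_(i < n.+2) b i; pose H := \poly_(i < n.+2) bh i; pose P := \poly_(i < n.+2) e i.
have -> : \sum_(j < n.+2) b j * bh (n.+1 - j)%N = (B * H)`_n.+1.
  by rewrite coefM; apply: eq_bigr => j _; rewrite !coef_poly ltn_ord ltnS leq_subr.
rewrite mulr_natl -coef_deriv derivM coefD.
have cf (f : nat -> R) i : (i <= n.+1)%N -> (\poly_(i < n.+2) f i)`_i = f i by move=> h; rewrite coef_poly ltnS h.
have dB i : (i <= n)%N -> B^`()`_i = (- (P * B))`_i.
  move=> hi; rewrite coef_deriv cf// -mulr_natl bS coefN coefM; congr (- _).
  by apply: eq_bigr => j _; rewrite !cf//; have := ltn_ord j; lia.
have dH i : (i <= n)%N -> H^`()`_i = (P * H)`_i.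
  move=> hi; rewrite coef_deriv cf// -mulr_natl bhS coefM.
  by apply: eq_bigr => j _; rewrite !cf//; have := ltn_ord j; lia.
have -> : (B^`() * H)`_n = (- (P * B) * H)`_n.
  by rewrite !coefM; apply: eq_bigr => j _; rewrite dB// -ltnS.
have -> : (B * H^`())`_n = (B * (P * H))`_n.
  by rewrite !coefM; apply: eq_bigr => j _; rewrite dH// leq_subr.
by rewrite -coefD (_ : _ + _ = 0) ?coef0//; ring.
Qed.

Let bounds : exists M q, [/\ 0 <= M, k < q < 1 & forall n, `|b n| <= M * q ^+ n /\ `|bh n| <= M * q ^+ n].
Proof.
have [M1 [q1 [M10 /andP[kq1 q11] h1]]] := growth k01 C0 (rec_bound (or_introl bS)).
have [M2 [q2 [M20 /andP[kq2 q21] h2]]] := growth k01 C0 (rec_bound (or_intror bhS)).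
have /andP[k0 _] := k01.
exists (M1 + M2), (Num.max q1 q2); split.
- exact: addr_ge0.
- by rewrite lt_max kq1 gt_max q11.
move=> n; have q10 := ltW (lt_trans k0 kq1); have q20 := ltW (lt_trans k0 kq2).
have m1 : q1 ^+ n <= Num.max q1 q2 ^+ n by rewrite lerXn2r ?nnegrE ?le_max ?lexx ?q10.
have m2 : q2 ^+ n <= Num.max q1 q2 ^+ n by rewrite lerXn2r ?nnegrE ?le_max ?lexx ?q20 ?orbT.
split.
  apply: (le_trans (h1 n)); apply: ler_pM => //; first exact: exprn_ge0.
  by rewrite lerDl.
apply: (le_trans (h2 n)); apply: ler_pM => //; first exact: exprn_ge0.
by rewrite lerDr.
Qed.

(** Summation by parts: [b] decays geometrically, so the left-hand side tends to minus the sum of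
    the [b_n]. *)
Let sum_na K : \sum_(n < K.+1) n%:R * a n = K%:R * b K - \sum_(n < K) b n.
Proof.
elim: K => [|K IH]; first by rewrite big_ord1 big_ord0 !mul0r subr0.
by rewrite big_ord_recr /= IH [in RHS]big_ord_recr /= b_S -natr1; ring.
Qed.

Let sum_al K : \sum_(n < K.+2) al n =
  - mu * (\sum_(n < K.+1) b n) - \sum_(j < K.+1) (u j.+1 - mu) * b (K - j)%N.
Proof.
rewrite big_ord_recl al0 add0r.
have -> : \sum_(j < K.+1) (u j.+1 - mu) * b (K - j)%N =
    \sum_(m < K.+1) \sum_(j < m.+1) (u j.+1 - mu) * a (m - j)%N.
  by rewrite (conv_sum (fun j => u j.+1 - mu)).
rewrite mulr_sumr -sumrB; apply: eq_bigr => m _; rewrite lift0 alS.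
rewrite /b -(sum_rev a) mulNr mulr_sumr -opprD -big_split; congr (- _).
by apply: eq_bigr => j _ /=; ring.
Qed.

Variables (rho C1 : R).
Hypotheses (rho01 : 0 < rho < 1) (C10 : 0 <= C1).
Hypothesis a_small : forall n, `|n%:R * a n| <= C1 * rho ^+ (n ^ 2).
Hypothesis al_small : forall n, `|al n| <= C1 * rho ^+ (n ^ 2).

Let E (n : nat) : R := C1 / (1 - rho) * rho ^+ (n ^ 2).

Let tail (f : nat -> R) : (forall n, `|f n| <= C1 * rho ^+ (n ^ 2)) -> forall i m, (i <= m)%N ->
  `|\sum_(n < m.+1) f n - \sum_(n < i.+1) f n| <= E i.
Proof.
have /andP[r0 r1] := rho01.
move=> hf i m im; rewrite -(subnKC (im : (i.+1 <= m.+1)%N)) big_split_ord /= addrAC subrr add0r.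
apply: (le_trans (ler_norm_sum _ _ _)); rewrite subSS.
apply: (@le_trans _ _ (\sum_(j < m - i) C1 * rho ^+ (i ^ 2) * rho ^+ j)).
  apply: ler_sum => j _; apply: (le_trans (hf _)); rewrite -mulrA -exprD ler_wpM2l//.
  by apply: ler_wiXn2l; rewrite ?(ltW r0) ?(ltW r1)//; nia.
by rewrite -mulr_sumr /E [leRHS]mulrAC ler_wpM2l ?geom_sum_bound// mulr_ge0// exprn_ge0// ltW.
Qed.

Lemma ratio_limit : exists2 S : R, S != 0 & forall i,
  `|S - \sum_(n < i.+1) n%:R * a n| <= E i /\
  `|mu * S - \sum_(n < i.+1) al n| <= E i.
Proof.
have [S hS] := cauchy_rate (tail a_small); have [A hA] := cauchy_rate (tail al_small).
have /andP[r0 r1] := rho01; have /andP[k0 k1] := k01.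
have [M [q [M0 /andP[kq q1] hM]]] := bounds.
have q01 : 0 < q < 1 by rewrite (lt_trans k0 kq).
have /andP[q0 _] := q01.
have q1' : 0 < 1 - q by rewrite subr_gt0.
have E_small d : 0 < d -> exists n0, forall n, (n0 <= n)%N -> E n <= d.
  move=> d0; have D0 : 0 < C1 / (1 - rho) + 1.
    by rewrite ltr_wpDl// divr_ge0// subr_ge0 ltW.
  have [n0 h] := geom_small rho01 (divr_gt0 d0 D0); exists n0 => n nn; rewrite /E.
  apply: (@le_trans _ _ ((C1 / (1 - rho) + 1) * rho ^+ (n ^ 2))).
    by rewrite ler_wpM2r ?exprn_ge0 ?(ltW r0)// lerDl.
  by rewrite mulrC -ler_pdivlMr//; apply: h; exact: leq_trans nn (leq_sqr n).
pose P K := \sum_(n < K.+1) b n.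
have bq n : `|b n| <= M * q ^+ n by case: (hM n).
have bhq n : `|bh n| <= M * q ^+ n by case: (hM n).
(* [sum n a_n = K b_K - P_(K-1)] and [b_K] is geometrically small. *)
have PS d : 0 < d -> exists n0, forall n, (n0 <= n)%N -> `|P n + S| <= d.
  move=> d0; have d20 : 0 < d / 2 by rewrite divr_gt0.
  have [n1 h1] := E_small _ d20; have [n2 h2] := lin_geom_small q01 (M * 1) d20.
  exists (maxn n1 n2) => n; rewrite geq_max => /andP[n1n n2n].
  have := hS n.+1; rewrite sum_na -/(P n) => h.
  have := h1 n.+1 (leqW n1n) => hE.
  have hb : `|n.+1%:R * b n.+1| <= d / 2.
    apply: le_trans (h2 n n2n); rewrite normrM ger0_norm// mulr1 [leRHS]mulrCA ler_wpM2l//.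
    apply: (le_trans (bq _)); rewrite ler_wpM2l// exprS ler_piMl ?exprn_ge0 ?(ltW q0)//.
    exact: ltW.
  rewrite (_ : P n + S = (S - (n.+1%:R * b n.+1 - P n)) + n.+1%:R * b n.+1); last by ring.
  apply: (le_trans (ler_normD _ _)); rewrite [d]splitr lerD//.
  exact: le_trans hE.
(* If [S] were 0, the partial sums [P] of [q] at 1 would tend to 0 while those of [1 / q] stay
   bounded; but the product of the two tends to 1. *)
have S0 : S != 0.
  apply/eqP => S0; pose Ph K := \sum_(n < K.+1) bh n.
  have PhB i m : (i <= m)%N -> `|Ph m - Ph i| <= M / (1 - q) * q ^+ i.
    move=> im; rewrite /Ph -(subnKC (im : (i.+1 <= m.+1)%N)) big_split_ord /= addrAC subrr add0r.
    apply: (le_trans (ler_norm_sum _ _ _)); rewrite subSS.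
    apply: (@le_trans _ _ (\sum_(j < m - i) M * q ^+ i * q ^+ j)).
      apply: ler_sum => j _; apply: (le_trans (bhq _)); rewrite -mulrA -exprD ler_wpM2l//.
      by apply: ler_wiXn2l; rewrite ?(ltW q0) ?(ltW q1)//; lia.
    by rewrite -mulr_sumr [leRHS]mulrAC ler_wpM2l ?geom_sum_bound// mulr_ge0// exprn_ge0// ltW.
  have Ph0 m : `|Ph m| <= M / (1 - q).
    apply: (le_trans (ler_norm_sum _ _ _)).
    apply: (@le_trans _ _ (\sum_(j < m.+1) M * q ^+ j)); first by apply: ler_sum => j _.
    by rewrite -mulr_sumr ler_wpM2l// geom_sum_bound.
  have one K : \sum_(j < K.+1) b j * Ph (K - j)%N = 1.
    rewrite -(conv_sum b bh); under eq_bigr do rewrite conv_bbh.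
    by rewrite big_ord_recl big1 ?addr0.
  (* Replacing [Ph (K - j)] by [Ph K] in the convolution costs [q^(K - j)] against [b j] of order
     [q^j], that is [q^K] in each of the [K + 1] terms. *)
  have PPh K : `|P K * Ph K - 1| <= M * (M / (1 - q)) * (K.+1%:R * q ^+ K).
    rewrite -[X in _ - X](one K) /P mulr_suml -sumrB; apply: (le_trans (ler_norm_sum _ _ _)).
    apply: (@le_trans _ _ (\sum_(j < K.+1) M * (M / (1 - q)) * q ^+ K)); last first.
      by rewrite sumr_const card_ord -[leLHS]mulr_natl le_eqVlt; apply/orP; left; apply/eqP; ring.
    apply: ler_sum => j _; rewrite -mulrBr normrM; have jK : (j <= K)%N by rewrite -ltnS.
    apply: (le_trans (ler_pM (normr_ge0 _) (normr_ge0 _) (bq j) (PhB _ _ (leq_subr _ _)))).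
    by rewrite -[in leRHS](subnKC jK) exprD le_eqVlt; apply/orP; left; apply/eqP; ring.
  have G0 : 0 < M / (1 - q) + 1 by rewrite ltr_wpDl// divr_ge0// ltW.
  have [n1 h1] := lin_geom_small q01 (M * (M / (1 - q))) (ltac:(lra) : 0 < 1 / 4).
  have [n2 h2] := PS (1 / 4 / (M / (1 - q) + 1)) (divr_gt0 (ltac:(lra) : 0 < 1 / 4) G0).
  pose n := maxn n1 n2.
  have := h1 n (leq_maxl _ _); have := h2 n (leq_maxr _ _); rewrite S0 addr0 => g2 g1.
  have g3 := le_trans (PPh n) g1.
  have g4 : `|P n * Ph n| <= 1 / 4.
    rewrite normrM; apply: (@le_trans _ _ (1 / 4 / (M / (1 - q) + 1) * (M / (1 - q) + 1))).
      by rewrite ler_pM// (le_trans (Ph0 n))// lerDl.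
    by rewrite divfK// gt_eqF.
  by move: g3 g4; rewrite !ler_norml; lra.
exists S => // i; split; first exact: hS.
suff -> : mu * S = A by exact: hA.
apply/eqP; rewrite -subr_eq0 -normr_eq0 eq_le normr_ge0 andbT.
apply/ler_addgt0Pr => d d0; rewrite add0r.
have d30 : 0 < d / 3 by rewrite divr_gt0.
have N0 : 0 < `|mu| + 1 by rewrite ltr_wpDl.
have [n1 h1] := E_small _ d30; have [n2 h2] := PS _ (divr_gt0 d30 N0).
have [n3 h3] := lin_geom_small q01 (C * M) d30.
pose n := maxn n1 (maxn n2 n3).
have g1 := le_trans (hA n.+1) (h1 n.+1 (leqW (leq_maxl _ _))).
have g2 := h2 n (leq_trans (leq_maxl _ _) (leq_maxr _ _)).
have g3 := h3 n (leq_trans (leq_maxr _ _) (leq_maxr _ _)).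
rewrite sum_al -/(P n) in g1; set X := \sum_(j < n.+1) _ in g1.
have gX : `|X| <= d / 3.
  apply: le_trans g3; apply: (le_trans (ler_norm_sum _ _ _)).
  apply: (@le_trans _ _ (\sum_(j < n.+1) C * M * q ^+ n)); last first.
    by rewrite sumr_const card_ord -[leLHS]mulr_natl le_eqVlt; apply/orP; left; apply/eqP; ring.
  apply: ler_sum => j _; rewrite normrM; have jn : (j <= n)%N by rewrite -ltnS.
  apply: (le_trans (ler_pM (normr_ge0 _) (normr_ge0 _) (umu j) (bq _))).
  rewrite -[in leRHS](subnKC jn) exprD.
  have -> : C * k ^+ j.+1 * (M * q ^+ (n - j)) = C * M * (k ^+ j.+1 * q ^+ (n - j)) by ring.
  rewrite ler_wpM2l ?mulr_ge0// ler_wpM2r ?exprn_ge0 ?(ltW q0)//.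
  apply: (@le_trans _ _ (k ^+ j)).
    by rewrite exprS ler_piMl ?exprn_ge0 ?(ltW k0) ?(ltW k1).
  by rewrite lerXn2r ?nnegrE ?(ltW k0) ?(ltW q0) ?(ltW kq).
have gm : `|mu * (P n + S)| <= d / 3.
  rewrite normrM; apply: (@le_trans _ _ ((`|mu| + 1) * (d / 3 / (`|mu| + 1)))).
    by rewrite ler_pM// lerDl.
  by rewrite mulrC divfK// gt_eqF.
have -> : mu * S - A = mu * (P n + S) - (A - (- mu * P n - X)) + X by ring.
apply: (le_trans (ler_normD _ _)); have := ler_normB (mu * (P n + S)) (A - (- mu * P n - X)).
lra.
Qed.

(** From [n0] on the denominator is at least [|S| / 2]. For [i < n0] it may be small or 0, and these
    finitely many errors are collected in [c1]; the final 1 in the constant makes the inequality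
    strict. *)
Lemma ratio_rate : exists c lam : R, [/\ 0 < c, 0 < lam & forall i,
  `|mu - (\sum_(n < i.+1) al n) / (\sum_(n < i.+1) n%:R * a n)| < c * expR (- lam * i%:R ^+ 2)].
Proof.
have [S S0 hS] := ratio_limit; have /andP[r0 r1] := rho01.
have SN : 0 < `|S| by rewrite normr_gt0.
have r1' : 0 < 1 - rho by rewrite subr_gt0.
have S4 : 0 < `|S| / 2 by rewrite divr_gt0.
pose G := C1 / (1 - rho); have G0 : 0 <= G by rewrite divr_ge0// ltW.
have G10 : 0 < G + 1 by rewrite ltr_wpDl.
have [n0 h0] := geom_small rho01 (divr_gt0 S4 G10).
pose f i := `|mu - (\sum_(n < i.+1) al n) / (\sum_(n < i.+1) n%:R * a n)|.
pose c1 := \sum_(i < n0) f i / rho ^+ (i ^ 2).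
have fr i : 0 <= f i / rho ^+ (i ^ 2) by rewrite divr_ge0 ?normr_ge0 ?exprn_ge0 ?(ltW r0).
have c10 : 0 <= c1 by apply: sumr_ge0 => i _; exact: fr.
pose c2 := (`|mu| + 1) * G / (`|S| / 2).
have c20 : 0 <= c2 := divr_ge0 (mulr_ge0 (addr_ge0 (normr_ge0 mu) ler01) G0) (ltW S4).
exists (c1 + c2 + 1), (- ln rho); split.
- by rewrite ltr_wpDl// addr_ge0.
- by rewrite oppr_gt0 ln_lt0// r0.
move=> i; have -> : expR (- - ln rho * i%:R ^+ 2) = rho ^+ (i ^ 2).
  by rewrite opprK -natrX expRM_natr lnK ?posrE.
have rp : 0 < rho ^+ (i ^ 2) by rewrite exprn_gt0.
rewrite -/(f i) -ltr_pdivrMr//.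
have [ii|ii] := ltnP i n0.
  apply: (@le_lt_trans _ _ c1); last by rewrite ltr_pwDr// lerDl.
  rewrite /c1 (bigD1 (Ordinal ii))//= lerDl; apply: sumr_ge0 => j _; exact: fr.
apply: (@le_lt_trans _ _ c2); last by rewrite -addrA ltr_wpDl// ltrDl.
rewrite ler_pdivrMr// /f; have [h1 h2] := hS i.
set Sk := \sum_(n < i.+1) n%:R * a n in h1 *; set Ak := \sum_(n < i.+1) al n in h2 *.
have EG : E i = G * rho ^+ (i ^ 2) by [].
have Skb : `|S| / 2 <= `|Sk|.
  have : E i <= `|S| / 2.
    rewrite EG; apply: (@le_trans _ _ ((G + 1) * rho ^+ (i ^ 2))).
      by rewrite ler_wpM2r ?(ltW rp)// lerDl.
    by rewrite mulrC -ler_pdivlMr//; apply: h0; exact: leq_trans ii (leq_sqr i).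
  by have := ler_normD (S - Sk) Sk; rewrite subrK; lra.
have Skp : 0 < `|Sk| by apply: lt_le_trans Skb.
have Sk0 : Sk != 0 by rewrite -normr_gt0.
have -> : mu - Ak / Sk = ((mu * S - Ak) - mu * (S - Sk)) / Sk by field.
rewrite normrM normfV ler_pdivrMr//.
apply: (@le_trans _ _ ((`|mu| + 1) * E i)).
  apply: (le_trans (ler_normB _ _)); rewrite normrM.
  have := ler_wpM2l (normr_ge0 mu) h1; lra.
rewrite EG /c2; apply: (@le_trans _ _ ((`|mu| + 1) * G / (`|S| / 2) * rho ^+ (i ^ 2) * (`|S| / 2))).
  by rewrite le_eqVlt; apply/orP; left; apply/eqP; field; rewrite gt_eqF.
by rewrite ler_wpM2l// mulr_ge0// ltW.
Qed.

End Ratio.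
End Sequences.

(** * Lipschitz functions on the unit interval *)

Section Lipschitz.
Variable R : realType.
Local Notation C := (Cplx R).
Implicit Types (f g : R -> R) (x y L e c : R).

Definition lip01 f L := forall x y, 0 <= x <= 1 -> 0 <= y <= 1 -> `|f x - f y| <= L * `|x - y|.

Lemma lip01_clamp_continuous f L : 0 <= L -> lip01 f L -> continuous (f \o (@clamp R)).
Proof.
move=> L0 h x; apply/cvgrPdist_lt => e e0.
have L1 : 0 < L + 1 by rewrite ltr_wpDl.
apply/nbhs_ballP; exists (e / (L + 1)) => /=; first by rewrite divr_gt0.
move=> y; rewrite /ball /= => xy.
apply: le_lt_trans (h _ _ (clamp01 x) (clamp01 y)) _.
apply: (@le_lt_trans _ _ ((L + 1) * `|x - y|)); last by rewrite mulrC -ltr_pdivlMr.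
by rewrite ler_pM// ?clamp_lip// lerDl.
Qed.

Lemma lip01_within f L : 0 <= L -> lip01 f L -> {within `[0, 1], continuous f}.
Proof.
move=> L0 h; apply: (@subspace_eq_continuous _ _ _ (f \o (@clamp R))).
  by move=> x; rewrite inE/= in_itv/= => x01; rewrite /= clamp_id.
exact: continuous_subspaceT (lip01_clamp_continuous L0 h).
Qed.

Lemma lip01_fixed f L : 0 <= L -> lip01 f L -> (forall x, 0 <= x <= 1 -> 0 <= f x <= 1) ->
  exists2 x, 0 <= x <= 1 & f x = x.
Proof.
move=> L0 h f01; pose g x := f x - x.
have hg : {within `[0, 1], continuous g}.
  apply: (@lip01_within _ (L + 1)); first by rewrite addr_ge0.
  move=> x y hx hy; rewrite /g (_ : _ - _ = (f x - f y) - (x - y)); last by ring.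
  by rewrite mulrDl mul1r (le_trans (ler_normB _ _))// lerD2r h.
have i0 : 0 <= (0 : R) <= 1 by apply/andP; split.
have i1 : 0 <= (1 : R) <= 1 by apply/andP; split.
have /andP[f0 _] := f01 0 i0; have /andP[_ f1] := f01 1 i1.
have [|c c01 gc] := IVT ler01 hg (v := 0).
  by rewrite /g ge_min le_max subr0 f0 subr_le0 f1 orbT.
exists c; first by move: c01; rewrite in_itv.
by apply/eqP; rewrite -subr_eq0 -/(g c) gc.
Qed.

Variable mu : probability (measurableTypeR R) R.
Hypothesis mu1 : mu (`[0%R, 1%R]%classic : set R) = 1%E.

Lemma lip01_integrable f L : 0 <= L -> lip01 f L -> mu.-integrable (`[0%R, 1%R]%classic : set R) (EFin \o f).
Proof.
move=> L0 h; apply: measurable_bounded_integrable => //.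
- by rewrite [ltLHS](mu1 : _ = _) ltry.
- by apply: subspace_continuous_measurable_fun => //; exact: lip01_within L0 h.
exists (`|f 0| + L); split; first exact: num_real.
move=> M hM x /=; rewrite in_itv/= => x01; apply: le_trans (ltW hM).
have i0 : 0 <= (0 : R) <= 1 by apply/andP; split.
rewrite -[f x](subrK (f 0)) addrC (le_trans (ler_normD _ _))// lerD2l.
apply: (le_trans (h _ _ x01 i0)); rewrite subr0 ler_piMr//.
by have /andP[h0 h1] := x01; rewrite ger0_norm.
Qed.

Lemma lip01_integral_near f L c e : 0 <= L -> lip01 f L ->
  (forall x, 0 <= x <= 1 -> `|f x - c| <= e) -> `|\int[mu]_(x in `[0, 1]) f x - c| <= e.
Proof.
move=> L0 h hc; have fi := lip01_integrable L0 h.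
have ci r : mu.-integrable (`[0%R, 1%R]%classic : set R) (EFin \o cst r).
  apply: (@lip01_integrable _ 0) => // x y _ _; rewrite /cst subrr normr0 mul0r//.
have cE r : \int[mu]_(x in `[0, 1]) r = r by rewrite Rintegral_cst//= mu1 /= mulr1.
have hc' x : `[0, 1]%classic x -> c - e <= f x <= c + e.
  by rewrite /= in_itv/= => /hc; rewrite ler_norml => /andP[h1 h2]; lra.
have A : \int[mu]_(x in `[0, 1]) f x <= c + e.
  by rewrite -[leRHS]cE; apply: le_Rintegral => //; [exact: ci|move=> x /hc' /andP[]].
have B : c - e <= \int[mu]_(x in `[0, 1]) f x.
  by rewrite -[leLHS]cE; apply: le_Rintegral => //; [exact: ci|move=> x /hc' /andP[]].
by rewrite ler_norml; lra.
Qed.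
End Lipschitz.

(** * A closed neighbourhood [K del] inside the domain *)

Section OpenNbhd.
Variable R : realType.
Local Notation C := (Cplx R).

Lemma K_in_open (D : set C) : open D -> @I01C R `<=` D ->
  exists2 del : R, 0 < del & forall z, K del z -> D z.
Proof.
move=> oD ID.
have : \forall d \near (0 : R)^'+, `[0%R, 1%R]%classic `<=`
    (fun x : R => forall z : C, nm (z - x%:C) <= d -> D z).
  have /compact_near_coveringP nc := @segment_compact R 0 1.
  apply: nc => x x01.
  have Dx : D x%:C by apply: ID; exists x.
  have : nbhs (x%:C : C) D by move: oD; rewrite openE => /(_ _ Dx).
  move=> /nbhs_ballP [e /posC[-> e0] he]; set r := complex.Re e in e0 he.
  have r2 : 0 < r / 2 by rewrite divr_gt0.
  near=> y d => z /= hz; apply: he; rewrite -ball_normE /= normC_nm ltcR nmB.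
  apply: (le_lt_trans (nm_tri y%:C _ _)); rewrite [r]splitr; apply: ler_ltD.
    apply: (le_trans hz); near: d; exact: nbhs_right_le.
  rewrite -rmorphB nm_real distrC; near: y.
  exact: (@cvgr_dist_lt _ _ _ _ _ id x (@cvg_id _ _) _ r2).
move=> hd; near (0 : R)^'+ => d.
exists d; first by near: d; exact: nbhs_right_gt.
move=> z [x x01 hz]; have : `[0%R, 1%R]%classic `<=`
    (fun x : R => forall z : C, nm (z - x%:C) <= d -> D z) by near: d.
by move=> /(_ x); apply; rewrite ?in_itv.
Unshelve. all: by end_near. Qed.

End OpenNbhd.

(** * Fixed points of the iterated maps *)

Section HolLipschitz.
Variable R : realType.
Local Notation C := (Cplx R).

(** [hol] gives no uniform bound on the derivative. The Lipschitz constant comes from Cauchy's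
    formula at [z] and [z'], whose kernels differ by [(z - z') / ((ze - z) (ze - z'))]. *)
Lemma hol_lipschitz (r r' : R) (f : C -> C) : 0 < r' < r -> hol r f ->
  exists2 L : R, 0 <= L & forall z z', K r' z -> K r' z' -> nm (f z - f z') <= L * nm (z - z').
Proof.
move=> /andP[r'0 r'r] hf.
pose r0 := r' + (r - r') / 3; pose r1 := r' + (r - r') * (2 / 3).
have r0r1 : r0 < r1 by rewrite /r0 /r1; lra.
have r00 : 0 < r0 by rewrite /r0; lra.
have r1r : r1 < r by rewrite /r1; lra.
have r'r0 : r' < r0 by rewrite /r0; lra.
have [d d0 /(_ 1 ltr01) [n [v [cv _]]]] := contour_exists r00 r0r1.
have [v0 _ [_ dd] W0] := cv; pose W := winding n v 2^-1.
have Pf := hol_pdiff cv (ltW r1r) hf; have [M M0 hM] := pdiff_bounded Pf.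
exists ((nm W)^-1 * (M * (d^-1 * d^-1) * plen n v)).
  by rewrite !mulr_ge0 ?invr_ge0 ?nm_ge0 ?plen_ge0 ?(ltW d0).
move=> z z' hz hz'.
have hzd ze (h : onp n v ze) := dd _ _ h (K_sub (ltW r'r0) hz).
have hzd' ze (h : onp n v ze) := dd _ _ h (K_sub (ltW r'r0) hz').
have P1 := pdiffM Pf (pdiff_cauchy d0 hzd); have P2 := pdiffM Pf (pdiff_cauchy d0 hzd').
have C1 := Cauchy_formula (ltW r00) r0r1 cv r1r hf r'r0 hz.
have C2 := Cauchy_formula (ltW r00) r0r1 cv r1r hf r'r0 hz'.
have -> : f z - f z' = W^-1 * (-1 * (f z' * W) + f z * W).
  by rewrite mulN1r -mulNr -mulrDl mulrCA mulVf// mulr1 addrC.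
rewrite -C1 -C2 -pint_lin// nmM nmV -[leRHS]mulrA ler_wpM2l ?invr_ge0 ?nm_ge0//.
rewrite [leRHS]mulrAC; apply: pint_bound; first exact: pdiff_lin.
move=> ze hze; have h1 := hzd _ hze; have h2 := hzd' _ hze.
have z1 : ze - z != 0 by rewrite -nm_gt0 (lt_le_trans d0).
have z2 : ze - z' != 0 by rewrite -nm_gt0 (lt_le_trans d0).
have -> : -1 * (f ze / (ze - z')) + f ze / (ze - z) =
    f ze * ((ze - z)^-1 * (ze - z')^-1) * (z - z') by field; rewrite z1 z2.
rewrite nmM ler_wpM2r ?nm_ge0// nmM ler_pM ?nm_ge0 ?hM//.
by rewrite nmM !nmV ler_pM ?invr_ge0 ?nm_ge0// lef_pV2 ?posrE ?nm_gt0.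
Qed.
End HolLipschitz.

Section Periodic.
Variable R : realType.
Local Notation C := (Cplx R).
Variables (N : nat) (phi : 'I_N -> R -> R) (p : 'I_N -> R) (F : 'I_N -> C -> C) (del kap : R).
Hypotheses (del0 : 0 < del) (kap01 : 0 < kap < 1).
Hypotheses (hF : forall i, hol del (F i)).
Hypotheses (FL : forall i z z', K del z -> K del z' ->
  nm (F i z - F i z') <= kap * nm (z - z')).
Hypotheses (Fphi : forall i (x : R), 0 <= x <= 1 -> F i x%:C = (phi i x)%:C).
Hypotheses (phi01 : forall i (x : R), 0 <= x <= 1 -> 0 <= phi i x <= 1).

Lemma FK i z : K del z -> K (kap * del) (F i z).
Proof.
move=> hz; have [x x01 hx] := hz; exists (phi i x); first exact: phi01.
have Kx : K del (x%:C : C) by apply: K_real => //; exact: ltW.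
rewrite -Fphi//; apply: (le_trans (FL i hz Kx)); rewrite ler_wpM2l//.
by have /andP[/ltW] := kap01.
Qed.

Lemma phiw01 w (x : R) : 0 <= x <= 1 -> 0 <= phiw phi w x <= 1.
Proof. by move=> x01; elim: w => //= i w; exact: phi01. Qed.

Lemma Fw_phiw w (x : R) : 0 <= x <= 1 -> Fw F w x%:C = (phiw phi w x)%:C.
Proof. by move=> x01; elim: w => //= i w ->; rewrite Fphi ?phiw01. Qed.

Lemma Kreal (x : R) : 0 <= x <= 1 -> K del (x%:C : C).
Proof. by apply: K_real; exact: ltW. Qed.

Lemma phiw_lip w : lip01 (phiw phi w) (kap ^+ size w).
Proof.
move=> x y x01 y01; rewrite -!nm_real.
have cB (a b : R) : (a - b)%:C = a%:C - b%:C :> C by exact: rmorphB.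
rewrite !cB -!Fw_phiw//.
by apply: (Fw_lip del0 kap01 FK FL); exact: Kreal.
Qed.

Lemma kapX_ge0 n : 0 <= kap ^+ n.
Proof. by have /andP[/ltW k0 _] := kap01; rewrite exprn_ge0. Qed.

(** The intermediate value theorem gives a fixed point for every word, the empty one included;
    [fixpt_uniq] adds uniqueness for the others. *)
Lemma fixptP w : 0 <= fixpt phi w <= 1 /\ phiw phi w (fixpt phi w) = fixpt phi w.
Proof.
have [x x01 fx] := lip01_fixed (kapX_ge0 (size w)) (phiw_lip w) (@phiw01 w).
rewrite /fixpt; case: xgetP => [y _ [] /=|/(_ x)]; first by rewrite in_itv.
by case; split; rewrite //= in_itv.
Qed.

Lemma fixpt_uniq w x : (0 < size w)%N -> 0 <= x <= 1 -> phiw phi w x = x -> x = fixpt phi w.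
Proof.
move=> w0 x01 fx; have [y01 fy] := fixptP w; have := phiw_lip w x01 y01.
rewrite fx fy => h; apply/eqP; rewrite -subr_eq0 -normr_eq0 eq_le normr_ge0 andbT.
have k1 : kap ^+ size w < 1.
  by have /andP[k0 k1] := kap01; rewrite exprn_ilt1 ?(ltW k0)// -lt0n.
by have := normr_ge0 (x - fixpt phi w); nra.
Qed.

Definition zfix (w : seq 'I_N) : C := (fixpt phi w)%:C.

Lemma zfixK w : K (kap * del) (zfix w).
Proof. by apply: K_real; [have /andP[k0 _] := kap01; rewrite ltW// mulr_gt0|case: (fixptP w)]. Qed.

Lemma zfixE w : Fw F w (zfix w) = zfix w.
Proof. by have [x01 fx] := fixptP w; rewrite Fw_phiw// fx. Qed.

Definition dfix (w : seq 'I_N) : C := xget 0 [set d | cder (Fw F w) (zfix w) d].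

Lemma kdel' : kap * del <= del. Proof. exact/ltW/(kdel del0 kap01). Qed.

Lemma dfixE w : cder (Fw F w) (zfix w) (dfix w).
Proof.
have [d dE] := Fw_hol del0 kap01 hF FK w (K_sub kdel' (zfixK w)).
by rewrite /dfix; case: xgetP => [? _|/(_ d)]//.
Qed.

Lemma dfix_le w : (0 < size w)%N -> nm (dfix w) <= kap ^+ size w.
Proof.
exact: (D_le del0 kap01 FK FL (fun w _ => zfixK w) (fun w _ => dfixE w)).
Qed.

(** Real difference quotients are among the complex ones, so they tend to [dfix w], which is
    therefore real; this covers the one-sided limit at an endpoint as well. *)
Lemma dphiwE w : (dphiw phi w)%:C = dfix w.
Proof.
have [x01 fx] := fixptP w; set x := fixpt phi w in x01 fx *.
set f := phiw phi w.
have key e : 0 < e -> exists2 dl : R, 0 < dl & forall y : R, 0 <= y <= 1 -> y != x ->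
    `|y - x| < dl -> nm (((f y - f x) / (y - x))%:C - dfix w) <= e.
  move=> e0; have [dl dl0 h] := dfixE w e0; exists dl => // y y01 yx ydl.
  have yx0 : y - x != 0 by rewrite subr_eq0.
  have yxC : (y - x)%:C != 0 :> C by rewrite -nm_gt0 nm_real normr_gt0.
  have := h y%:C; rewrite -rmorphB nm_real => /(_ ydl).
  rewrite !Fw_phiw// -/f -/x -rmorphB.
  have -> : (f y - f x)%:C - dfix w * (y - x)%:C =
      (((f y - f x) / (y - x))%:C - dfix w) * (y - x)%:C.
    by rewrite mulrBl -[X in _ = X - _]rmorphM /= divfK.
  by rewrite nmM nm_real ler_pM2r// normr_gt0.
(* [0,1] accumulates at [x] even at an endpoint: step away from the nearer end by at most 1/2. The
   punctured filter is then proper and the limit is unique. *)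
have exy (dl : R) : 0 < dl -> exists y : R, [/\ 0 <= y <= 1, y != x & `|y - x| < dl].
  move=> dl0; pose s := Num.min dl 1 / 2.
  have s0 : 0 < s by rewrite divr_gt0// lt_min dl0 ltr01.
  have sd : s < dl by rewrite ltr_pdivrMr// (@le_lt_trans _ _ dl) ?ge_min ?lexx// ltr_pMr// ltr1n.
  have s1 : s <= 1 / 2 by rewrite ler_pM2r// ge_min lexx orbT.
  have [x2|x2] := lerP x (1 / 2).
    exists (x + s); split; first by move: x01; lra.
      by rewrite -subr_eq0 addrC addKr gt_eqF.
    by rewrite addrC addKr gtr0_norm.
  exists (x - s); split; first by move: x01; lra.
    by rewrite -subr_eq0 addrC addKr oppr_eq0 gt_eqF.
  by rewrite addrC addKr normrN gtr0_norm.
have ImD : complex.Im (dfix w) = 0.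
  apply/eqP; rewrite -normr_eq0 eq_le normr_ge0 andbT; apply/ler_addgt0Pr => e e0.
  rewrite add0r; have [dl dl0 h] := key _ e0; have [y [y01 yx ydl]] := exy _ dl0.
  apply: le_trans (h y y01 yx ydl); apply: le_trans (Im_le_nm _).
  by case: (dfix w) => a b /=; rewrite sub0r normrN.
have DE : dfix w = (complex.Re (dfix w))%:C by case: (dfix w) ImD => a b /= ->.
rewrite DE; congr (_%:C); rewrite /dphiw /derive01 -/x -/f.
have PF : ProperFilter (within (`[0%R, 1%R]%classic : set R) x^').
  apply: Build_ProperFilter_ex => A; rewrite /dnbhs /within /= => /nbhs_ballP[dl dl0 h].
  have [y [y01 yx ydl]] := exy _ dl0; exists y; apply: h => //.
    by rewrite /ball /= distrC.
apply: cvg_lim => //; apply/cvgrPdist_le => e e0.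
have [dl dl0 h] := key _ e0.
rewrite /dnbhs /within /=; apply/nbhs_ballP; exists dl => // y.
rewrite /ball /= => ydl yx; rewrite in_itv/= => y01.
rewrite distrC in ydl; have := h y y01 yx ydl.
by rewrite DE -rmorphB nm_real distrC.
Qed.

Lemma dphiw_le w : (0 < size w)%N -> `|dphiw phi w| <= kap ^+ size w.
Proof. by move=> w0; rewrite -nm_real dphiwE; exact: dfix_le. Qed.

Lemma Fw_rcons w i z : Fw F (rcons w i) z = Fw F w (F i z).
Proof. by elim: w => //= j w ->. Qed.

Lemma phiw_rcons w i x : phiw phi (rcons w i) x = phiw phi w (phi i x).
Proof. by elim: w => //= j w ->. Qed.

(** The word [u] maps the fixed point of [i :: u] to that of [rcons u i]; by the chain rule both
    multipliers are products of the same two derivatives in opposite order. *)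
Lemma dphiw_rot1 w : (0 < size w)%N -> dphiw phi (rot 1 w) = dphiw phi w.
Proof.
case: w => // i u _; rewrite rot1_cons.
apply: (@complexI R); rewrite !dphiwE.
have [x01 fx] := fixptP (i :: u); set x := fixpt phi (i :: u) in x01 fx.
have zE : zfix (rcons u i) = Fw F u (zfix (i :: u)).
  rewrite /zfix Fw_phiw//; congr (_%:C); apply/esym/fixpt_uniq; rewrite ?size_rcons ?phiw01//.
  by rewrite phiw_rcons; congr (phiw phi u _); exact: fx.
have Kz := K_sub kdel' (zfixK (i :: u)).
have Kz' := Fw_K del0 kap01 FK u Kz.
have [e1 h1] := Fw_hol del0 kap01 hF FK u Kz; have [e2 h2] := hF i Kz'.
have zz : F i (Fw F u (zfix (i :: u))) = zfix (i :: u) by exact: (zfixE (i :: u)).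
have A : dfix (i :: u) = e2 * e1.
  by apply: (cder_unique (dfixE _)); exact: (cder_comp h1 h2).
have B : dfix (rcons u i) = e1 * e2.
  apply: (cder_unique (dfixE _)); rewrite zE.
  have -> : Fw F (rcons u i) = fun z => Fw F u (F i z) by apply/funext => z; exact: Fw_rcons.
  by apply: (@cder_comp R (F i) (Fw F u)); [exact: h2|rewrite zz].
by rewrite A B mulrC.
Qed.

Lemma dphiw_rot w k : (k <= size w)%N -> dphiw phi (rot k w) = dphiw phi w.
Proof.
elim: k => [|k IH] kw; first by rewrite rot0.
have w0 : (0 < size (rot k w))%N by rewrite size_rot (leq_ltn_trans _ kw).
by rewrite (rotS kw) (dphiw_rot1 w0) (IH (ltnW kw)).
Qed.

(** Cyclic shifts permute the words and preserve weight and multiplier, so the [m] points of an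
    orbit contribute equally; this is why [tau_m / m] appears as a trace limit. *)
Lemma tau_sum g m : tau_ phi p g m =
  m%:R * \sum_(w : m.-tuple 'I_N) pw p w * (g (fixpt phi w) / (1 - dphiw phi w)).
Proof.
rewrite /tau_; under eq_bigr => w _ do rewrite mulr_suml mulr_sumr.
rewrite exchange_big /= -[X in X%:R](card_ord m) -sum1_card natr_sum mulr_suml.
apply: eq_bigr => k _; rewrite mul1r.
rewrite [RHS](reindex (fun w : m.-tuple 'I_N => [tuple of rot k w])) /=; last first.
  exists (fun w : m.-tuple 'I_N => [tuple of rotr k w]) => w _; apply: val_inj => /=; [exact: rotK|exact: rotrK].
apply: eq_bigr => w _; rewrite dphiw_rot ?size_tuple ?(ltnW (ltn_ord k))//.
by rewrite /pw /=; congr (_ * _); apply: perm_big; rewrite perm_sym perm_rot.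
Qed.

End Periodic.

(** * Exponential convergence of the periodic averages *)

Section Rates.
Variable R : realType.
Local Notation C := (Cplx R).
Variables (N : nat) (phi : 'I_N -> R -> R) (p : 'I_N -> R) (F : 'I_N -> C -> C) (del kap : R).
Hypotheses (del0 : 0 < del) (kap01 : 0 < kap < 1).
Hypotheses (hF : forall i, hol del (F i)).
Hypotheses (FL : forall i z z', K del z -> K del z' ->
  nm (F i z - F i z') <= kap * nm (z - z')).
Hypotheses (Fphi : forall i (x : R), 0 <= x <= 1 -> F i x%:C = (phi i x)%:C).
Hypotheses (phi01 : forall i (x : R), 0 <= x <= 1 -> 0 <= phi i x <= 1).
Hypotheses (p0 : forall i, 0 <= p i) (p1 : \sum_i p i = 1).
Variable mu : probability (measurableTypeR R) R.
Hypothesis muS : stationary phi p mu.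

Lemma lip01_comp f L w : 0 <= L -> lip01 f L ->
  lip01 (f \o phiw phi w) (L * kap ^+ size w).
Proof.
move=> L0 h x y x01 y01 /=; apply: le_trans (h _ _ _ _) _; try exact: (phiw01 phi01).
by rewrite -mulrA ler_wpM2l// (phiw_lip del0 kap01 FL Fphi phi01).
Qed.

Lemma int_phiw m f L : 0 <= L -> lip01 f L -> \int[mu]_(x in `[0%R, 1%R]) f x =
  \sum_(w : m.-tuple 'I_N) pw p w * \int[mu]_(x in `[0%R, 1%R]) f (phiw phi w x).
Proof.
elim: m f L => [|m IH] f L L0 h.
  rewrite (big_pred1 [tuple]) => [|w]; last by apply/esym/eqP; exact: tuple0.
  by rewrite /pw big_nil mul1r.
rewrite (sum_tupleS m (fun w => pw p w * \int[mu]_(x in `[0%R, 1%R]) f (phiw phi w x))).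
rewrite (muS.2 f (lip01_within L0 h)) exchange_big; apply: eq_bigr => i _ /=.
have hi := lip01_comp [:: i] L0 h.
have L1 : 0 <= L * kap ^+ size [:: i] by rewrite mulr_ge0// (kapX_ge0 kap01).
rewrite (IH _ _ L1 hi) mulr_sumr; apply: eq_bigr => w _.
by rewrite /pw big_cons mulrA.
Qed.

(** Word by word: [phiw phi w x] is within [kap^m] of the fixed point, which costs [L kap^m], and
    [1 / (1 - D) = 1 + D / (1 - D)] with [|D| <= kap^m] costs [M / (1 - kap) * kap^m]. *)
Lemma periodic_rate g L M m : 0 <= L -> 0 <= M -> lip01 g L ->
  (forall x, 0 <= x <= 1 -> `|g x| <= M) -> (0 < m)%N ->
  `|\sum_(w : m.-tuple 'I_N) pw p w * (g (fixpt phi w) / (1 - dphiw phi w)) -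
    \int[mu]_(x in `[0%R, 1%R]) g x| <= (M / (1 - kap) + L) * kap ^+ m.
Proof.
move=> L0 M0 gL gM m0; have /andP[k0 k1] := kap01; have mu1 := muS.1.
have km : kap ^+ m <= kap by rewrite -[leRHS]expr1 ler_wiXn2l ?(ltW k0)// ltW.
have km0 : 0 <= kap ^+ m := kapX_ge0 kap01 m.
have -> : (M / (1 - kap) + L) * kap ^+ m =
    \sum_(w : m.-tuple 'I_N) pw p w * ((M / (1 - kap) + L) * kap ^+ m).
  by rewrite -mulr_suml (sum_pw p1) mul1r.
rewrite (int_phiw m L0 gL) -sumrB.
apply: le_trans (ler_norm_sum _ _ _) _; apply: ler_sum => w _.
rewrite -mulrBr normrM (ger0_norm (pw_ge0 p0 w)) ler_wpM2l ?(pw_ge0 p0)// distrC.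
have gl0 : 0 <= L * kap ^+ size w by rewrite mulr_ge0// (kapX_ge0 kap01).
have gl := lip01_comp w L0 gL.
apply: (lip01_integral_near mu1 gl0 gl).
move=> x x01 /=; have [z01 zE] := fixptP del0 kap01 FL Fphi phi01 w.
have Dle : `|dphiw phi w| <= kap ^+ m.
  by rewrite -[X in kap ^+ X](size_tuple w); apply: (dphiw_le del0 kap01 hF FL Fphi phi01); rewrite size_tuple.
set D := dphiw phi w in Dle *; set z := fixpt phi w in z01 zE *.
have D1 : 1 - kap <= 1 - D by rewrite lerD2l lerN2 (le_trans (ler_norm _))// (le_trans Dle).
have D0 : 0 < 1 - D by rewrite (lt_le_trans _ D1)// subr_gt0.
have -> : g (phiw phi w x) - g z / (1 - D) = (g (phiw phi w x) - g z) - g z * (D / (1 - D)).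
  by field; rewrite gt_eqF.
rewrite addrC (le_trans (ler_normD _ _))// mulrDl lerD// ?normrN.
  rewrite normrM mulrAC -mulrA ler_pM// ?gM// normrM mulrC normfV (ger0_norm (ltW D0)).
  by rewrite mulrC ler_pM// ?invr_ge0 ?(ltW D0)// lef_pV2// ?posrE// subr_gt0.
rewrite -{1}zE; apply: le_trans (gL _ _ _ _) _; try exact: (phiw01 phi01).
rewrite ler_wpM2l// (le_trans (phiw_lip del0 kap01 FL Fphi phi01 w x01 z01))//.
rewrite size_tuple ler_piMr//.
by move: x01 z01; rewrite ler_norml; lra.
Qed.

End Rates.

(** * The recursions behind the sums over compositions *)

Section Recursions.
Variable R : realType.
Variables (N : nat) (phi : 'I_N -> R -> R) (p : 'I_N -> R).

Lemma a_expc n : a_ phi p n = expc (fun m => t_ phi p m / m%:R) n.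
Proof. by case: n => [|n]; rewrite ?expc0// -composition_expc. Qed.

Lemma alpha_0 g : alpha_ phi p g 0 = 0.
Proof. by rewrite /alpha_ big_geq. Qed.

Lemma a_rec n : n.+1%:R * a_ phi p n.+1 = - \sum_(j < n.+1) a_ phi p (n - j)%N * t_ phi p j.+1.
Proof.
rewrite a_expc expcS; congr (- _); apply: eq_bigr => j _.
by rewrite a_expc; congr (_ * _); rewrite mulrCA divff ?mulr1// pnatr_eq0.
Qed.

Lemma alpha_rec g n : alpha_ phi p g n.+1 =
  - \sum_(j < n.+1) a_ phi p (n - j)%N * (tau_ phi p g j.+1 / j.+1%:R).
Proof.
rewrite /alpha_ (composition_deriv (fun m => t_ phi p m / m%:R) (fun m => tau_ phi p g m / m%:R)).
by congr (- _); apply: eq_bigr => j _; rewrite a_expc.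
Qed.

End Recursions.

(** * Superexponential bounds for the coefficients *)

Section FredholmBounds.
Variable R : realType.
Local Notation C := (Cplx R).

(** The determinant bounds want weights geometric in the index [a] itself. By Bernoulli
    [(1 - 1 / (2 J))^J >= 1 / 2], and the factor 2 pays for the incomplete block of [a %% J]
    indices. *)
Lemma half_pow (J a : nat) : (0 < J)%N ->
  (1 / 2) ^+ (a %/ J) <= 2 * (1 - (2 * J%:R)^-1) ^+ a :> R.
Proof.
move=> J0; have J1 : 1 <= J%:R :> R by rewrite ler1n.
have J2 : 0 < 2 * J%:R :> R by lra.
set s := (2 * J%:R)^-1.
have s01 : 0 <= s <= 1.
  by rewrite invr_ge0 (ltW J2) /= invf_le1//; lra.
have bern n : 1 - n%:R * s <= (1 - s) ^+ n.
  elim: n => [|n IH]; first by rewrite mul0r subr0.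
  have s1 : 0 <= 1 - s by lra.
  rewrite exprS; apply: le_trans (ler_wpM2l s1 IH).
  have n0 : 0 <= n%:R :> R by exact: ler0n.
  have : 0 <= n%:R * s ^+ 2 by rewrite mulr_ge0// sqr_ge0.
  by rewrite -natr1; lra.
have sJ : 1 / 2 <= (1 - s) ^+ J.
  apply: le_trans (bern J); rewrite /s invfM mulrCA divff ?gt_eqF//; last by lra.
  by lra.
have s1 : 0 <= 1 - s <= 1 by lra.
have /andP[s10 s11] := s1.
rewrite {2}(divn_eq a J) exprD mulrCA (mulnC (a %/ J)%N) exprM -[leLHS]mulr1.
apply: ler_pM => //.
  by apply: lerXn2r; rewrite ?nnegrE ?exprn_ge0//; lra.
have : 1 / 2 <= (1 - s) ^+ (a %% J).
  by apply: le_trans sJ _; rewrite ler_wiXn2l// ltnW// ltn_mod.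
by lra.
Qed.

Variables (N : nat) (phi : 'I_N -> R -> R) (p : 'I_N -> R) (F : 'I_N -> C -> C) (del kap : R).
Hypotheses (del0 : 0 < del) (kap01 : 0 < kap < 1).
Hypotheses (hF : forall i, hol del (F i)).
Hypotheses (FL : forall i z z', K del z -> K del z' ->
  nm (F i z - F i z') <= kap * nm (z - z')).
Hypotheses (Fphi : forall i (x : R), 0 <= x <= 1 -> F i x%:C = (phi i x)%:C).
Hypotheses (phi01 : forall i (x : R), 0 <= x <= 1 -> 0 <= phi i x <= 1).
Hypotheses (p0 : forall i, 0 <= p i) (p1 : \sum_i p i = 1).

Lemma periodic_traces r0 r d J v H h : kap * del < r0 -> r0 < r -> r < del ->
  contour r0 r d J v -> (forall k, (k < J)%N -> nm (v k.+1 - v k) <= d / 2) ->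
  hol del H -> (forall x : R, 0 <= x <= 1 -> H x%:C = (h x)%:C) -> forall m,
  clim (fun Q => \tr (tmx F p d J v H Q *m tmx F p d J v (fun=> 1) Q ^+ m))
    (\sum_(w : m.+1.-tuple 'I_N) pw p w * (h (fixpt phi w) / (1 - dphiw phi w)))%:C.
Proof.
move=> r0k r0r rdel cv vs hH Hh m.
have FK := FK del0 kap01 FL Fphi phi01.
have [c c0 hc] := trace_limit del0 kap01 hF FK FL p0 p1 r0k r0r rdel cv vs
  (fun w _ => zfixK del0 kap01 FL Fphi phi01 w) (fun w _ => zfixE del0 kap01 FL Fphi phi01 w)
  (fun w _ => dfixE del0 kap01 hF FL Fphi phi01 w) hH m.
apply: (clim_geom c0) => Q; rewrite (_ : _%:C = \sum_(w : m.+1.-tuple 'I_N)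
  (pw p w)%:C * (H (zfix phi w) / (1 - dfix phi F w)))//.
rewrite rmorph_sum; apply: eq_bigr => w _.
have [z01 _] := fixptP del0 kap01 FL Fphi phi01 w.
by rewrite Hh// -(dphiwE del0 kap01 hF FL Fphi phi01 w) rmorphM fmorph_div rmorphB.
Qed.

Lemma fredholm_bounds g G : hol del G -> (forall x : R, 0 <= x <= 1 -> G x%:C = (g x)%:C) ->
  exists r be : R, [/\ 0 < r < 1, 0 <= be & forall k,
    `|a_ phi p k| <= be ^+ k * r ^+ 'C(k, 2) /\
    `|alpha_ phi p g k.+1| <= be * (be ^+ k * r ^+ 'C(k, 2))].
Proof.
move=> hG Gg; have /andP[k0 k1] := kap01.
have kd : kap * del < del := kdel del0 kap01.
have kd0 : 0 < kap * del by rewrite mulr_gt0.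
pose r0 := kap * del + (del - kap * del) / 3.
pose r1 := kap * del + (del - kap * del) * (2 / 3).
have r0k : kap * del < r0 by rewrite /r0; lra.
have r0r : r0 < r1 by rewrite /r0 /r1; lra.
have rdel : r1 < del by rewrite /r1; lra.
have [d d0 hd] := contour_exists (lt_trans kd0 r0k) r0r.
have [J [v [cv vs]]] := hd (d / 2) (divr_gt0 d0 (ltr0n _ 2)).
have FK := FK del0 kap01 FL Fphi phi01.
have J0 : (0 < J)%N.
  by rewrite lt0n; case: cv => _ _ _; apply: contraNneq => JE; rewrite /winding /pint JE big_ord0.
have J1 : 1 <= J%:R :> R by rewrite ler1n.
pose r : R := 1 - (2 * J%:R)^-1.
have r01 : 0 < r < 1.
  have J2 : 0 < (2 * J%:R : R)^-1 by rewrite invr_gt0; lra.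
  have J3 : (2 * J%:R : R)^-1 < 1 by rewrite invf_lt1; lra.
  by rewrite /r; lra.
have h1 : hol del (fun=> 1 : C) by move=> z _; exists 0; exact: cder_cst.
have [M1 M10 hM1] := pdiff_bounded (hol_pdiff cv (ltW rdel) h1).
have [MG MG0 hMG] := pdiff_bounded (hol_pdiff cv (ltW rdel) hG).
pose A := (nm (winding J v 2^-1))^-1 * (d / 2).
have A0 : 0 <= A by rewrite mulr_ge0 ?invr_ge0 ?nm_ge0// divr_ge0 ?(ltW d0).
(* The sum [M1 + MG] lets one constant serve [H = 1] and [H = G]; 4 is the product of the factors 2
   of [half_pow] in the row and the column index. *)
pose b := A * (M1 + MG) / d * 4.
have b0 : 0 <= b by rewrite mulr_ge0// (divr_ge0 (mulr_ge0 A0 (addr_ge0 M10 MG0)) (ltW d0)).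
have entb H M i j : hol del H -> 0 <= M -> M <= M1 + MG ->
    (forall ze, onp J v ze -> nm (H ze) <= M) ->
    nm (ent F p d J v H i j) <= b * (r ^+ i * r ^+ j).
  move=> hH M0 MM hM.
  apply: le_trans (ent_bound del0 kap01 hF FK p0 p1 r0k rdel cv vs i j hH M0 hM) _.
  rewrite /= -/A (_ : b * _ = A * (M1 + MG) / d * ((2 * r ^+ i) * (2 * r ^+ j))); last first.
    by rewrite /b; ring.
  have xx a : 0 <= (1 / 2) ^+ (a %/ J) :> R by rewrite exprn_ge0// divr_ge0.
  apply: (ler_pM (divr_ge0 (mulr_ge0 A0 M0) (ltW d0)) (mulr_ge0 (xx i) (xx j))).
    by rewrite ler_wpM2r ?invr_ge0 ?(ltW d0)// ler_wpM2l.
  by apply: (ler_pM (xx i) (xx j)); exact: half_pow.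
have tr1 := periodic_traces r0k r0r rdel cv vs h1 (fun _ _ => erefl : 1 = (1 : R)%:C).
have trG := periodic_traces r0k r0r rdel cv vs hG Gg.
pose be := b / (1 - r) / (1 - r).
exists r, be; split => //.
  have r1' : 0 <= 1 - r by have /andP[_ ?] := r01; rewrite subr_ge0 ltW.
  exact: (divr_ge0 (divr_ge0 b0 r1') r1').
move=> k; rewrite -!nm_real.
apply: (@fredholm_limit R (fun Q => (Q * J)%N) (fun Q => tmx F p d J v (fun=> 1) Q)
  (fun Q => tmx F p d J v G Q) (fun m => (t_ phi p m)%:C)
  (fun m => (tau_ phi p g m / m%:R)%:C) (fun m => (a_ phi p m)%:C)
  (fun m => (alpha_ phi p g m)%:C) r b r01 b0).
- by move=> Q i j; rewrite mxE; apply: (entb _ M1) => //; rewrite lerDl.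
- by move=> Q i j; rewrite mxE; apply: (entb _ MG) => //; rewrite lerDr.
- move=> m; have := tr1 m; rewrite /t_ => + e e0 => /(_ e e0)[Q0 h]; exists Q0 => Q /h.
  by rewrite exprS.
- move=> m; rewrite (tau_sum p del0 kap01 hF FL Fphi phi01) mulrAC divff ?pnatr_eq0// mul1r.
  exact: trG.
- by [].
- move=> m; rewrite -(rmorphMn _ m.+1) -mulr_natl a_rec rmorphN rmorph_sum; congr (- _).
  by apply: eq_bigr => j _; rewrite rmorphM.
- move=> m; rewrite alpha_rec rmorphN rmorph_sum; congr (- _).
  by apply: eq_bigr => j _; rewrite rmorphM.
Qed.

End FredholmBounds.

(** * Rates in a common form, and the theorem *)

Section Final.
Variable R : realType.
Local Notation C := (Cplx R).

Lemma superexp_coeffs (a al : nat -> R) r be : 0 < r < 1 -> 0 <= be -> al 0 = 0 ->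
  (forall k, `|a k| <= be ^+ k * r ^+ 'C(k, 2) /\
    `|al k.+1| <= be * (be ^+ k * r ^+ 'C(k, 2))) ->
  exists rho C1 : R, [/\ 0 < rho < 1, 0 <= C1,
    forall n, `|n%:R * a n| <= C1 * rho ^+ (n ^ 2) &
    forall n, `|al n| <= C1 * rho ^+ (n ^ 2)].
Proof.
move=> r01 be0 al0 h; have /andP[r0 r1] := r01.
(* [n <= 2^n] absorbs the factor [n] of [n a_n]; the shift in [al k.+1] costs [r^-k], as
   ['C(k.+1, 2) = 'C(k, 2) + k], and is paid by [be / r]; adding 1 ensures [1 <= B]. *)
pose B := 2 * (be / r) + 1.
have br : 0 <= be / r by rewrite divr_ge0// ltW.
have beb : be <= be / r by rewrite ler_peMr// invf_ge1// ltW.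
have B1 : 1 <= B by rewrite /B; lra.
have [c [rho [rho01 c0 hc]]] := superexp_bound r01 B1.
have rC k : 0 <= r ^+ 'C(k, 2) by rewrite exprn_ge0// ltW.
exists rho, c; split => // [n|[|n]].
- apply: le_trans (hc n); have [ha _] := h n.
  have b2 : 2 * be <= B by rewrite /B; lra.
  have b20 : 0 <= 2 * be by rewrite mulr_ge0.
  rewrite normrM normr_nat; apply: (@le_trans _ _ (2 ^+ n * (be ^+ n * r ^+ 'C(n, 2)))).
    by apply: ler_pM => //; rewrite -natrX ler_nat ltnW// ltn_expl.
  by rewrite mulrA -exprMn ler_wpM2r// lerXn2r// nnegrE// (le_trans b20).
- have /andP[rho0 _] := rho01.
  by rewrite al0 normr0 mulr_ge0// exprn_ge0// ltW.
- apply: le_trans (hc n.+1); have [_ ha] := h n; apply: (le_trans ha).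
  apply: (@le_trans _ _ ((be / r) ^+ n.+1 * r ^+ 'C(n.+1, 2))); last first.
    rewrite ler_wpM2r// lerXn2r// ?nnegrE//; last by rewrite /B; lra.
    by rewrite (le_trans _ B1).
  rewrite binS bin1 exprD expr_div_n mulrA -exprS -mulrA ler_wpM2l ?exprn_ge0//.
  rewrite mulrC -mulrA ler_peMr// exprSr invfM mulrA divff ?mul1r ?invf_ge1 ?(ltW r1)//.
  by rewrite gt_eqF// exprn_gt0.
Qed.

Lemma lip_of_derivative_bound r M (f f' : C -> C) : (forall z, K r z -> cder f z (f' z)) ->
  (forall z, K r z -> nm (f' z) <= M) -> forall z z', K r z -> K r z' ->
  nm (f z - f z') <= M * nm (z - z').
Proof.
move=> ff' fM z z' hz hz'.
have Kp t : 0 <= t <= 1 -> K r (pt z' z t) by exact: K_convex.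
apply: (segi_bound (segi_FTC (f := f') _)) => t /Kp; [exact: ff'|exact: fM].
Qed.

Lemma contraction_rate (N : nat) (calD : set C) (F : 'I_N -> C -> C) :
  (ereal_sup [set ((Normc.normc (derive1 (F i) z) : R)%:E)
                       | i in [set: 'I_N] & z in calD] < 1%:E)%E ->
  exists2 kap : R, 0 < kap < 1 & forall i z, calD z -> nm (derive1 (F i) z) <= kap.
Proof.
set S := (X in ereal_sup X) => S1.
have ub i z : calD z -> ((nm (derive1 (F i) z) : R)%:E <= ereal_sup S)%E.
  by move=> Dz; apply: ereal_sup_ubound; exists i => //; exists z.
case: (ereal_sup S) S1 ub => [s||] // s1 ub.
  (* The supremum is 0 when all the derivatives vanish; the maximum with 1/2 keeps the rate
     positive. *)
  exists (Num.max (1 / 2) s).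
    by rewrite lt_max gt_max; rewrite lte_fin in s1; rewrite s1 andbT; lra.
  by move=> i z /(ub i); rewrite lee_fin le_max => ->; rewrite orbT.
by exists (1 / 2) => [|i z /(ub i)]; [lra|rewrite leeNy_eq].
Qed.

End Final.

Theorem theorem2p3 (R : realType) (N : nat) (hN : (2 <= N)%N)
    (phi : 'I_N -> R -> R) (p : 'I_N -> R) (calD : set (Cplx R)) (g : R -> R)
    (mu : probability (measurableTypeR R) R) :
  is_ifs phi ->
  complex_contracting_on phi calD ->
  probability_vector p ->
  in_C_Phi phi calD g ->
  stationary phi p mu ->
  exists C lambda : R, [/\ 0 < C, 0 < lambda &
    forall k : nat, (1 <= k)%N ->
      `|\int[mu]_(x in `[0%R, 1%R]) g x - mu_ phi p g k|
        < C * expR (- lambda * k%:R ^+ 2)].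
Proof.
move=> ifs [_ [F [Fext _ Fsup]]] [p01 p1] [D [oD _ DcalD ID _] [G [Ghol Gext] _]] muS.
have [kap kap01 hkap] := contraction_rate Fsup.
have [del del0 KD] := K_in_open oD ID.
have FD i z : K del z -> cder (F i) z (derive1 (F i) z).
  move=> /KD/DcalD Dz; apply/is_derive_cder; rewrite derive1E.
  by apply: derivableP; exact: (Fext i).1.
have hF i : hol del (F i) by move=> z /FD; exists (derive1 (F i) z).
have hG : hol del G by move=> z /KD/Ghol/derivable_cder.
have FL i := lip_of_derivative_bound (FD i) (fun z Kz => hkap i z (DcalD _ (KD _ Kz))).
have Fphi i (x : R) : 0 <= x <= 1 -> F i x%:C%C = (phi i x)%:C%C.
  by move=> x01; apply: (Fext i).2; rewrite /= in_itv.
have Gg (x : R) : 0 <= x <= 1 -> G x%:C%C = (g x)%:C%C.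
  by move=> x01; apply: Gext; rewrite /= in_itv.
have phi01 i (x : R) : 0 <= x <= 1 -> 0 <= phi i x <= 1.
  by move=> x01; have := (ifs i).1 x; rewrite /= !in_itv/=; apply.
have p0 i : 0 <= p i by have /andP[/ltW] := p01 i.
have [L L0 gL] : exists2 L, 0 <= L & lip01 g L.
  have del2 : 0 < del / 2 < del by lra.
  have [L L0 hL] := hol_lipschitz del2 hG; exists L => // x y x01 y01.
  rewrite -!nm_real.
  have cB (a b : R) : (a - b)%:C%C = a%:C%C - b%:C%C :> Cplx R by exact: rmorphB.
  rewrite !cB -!Gg//.
  by apply: hL; apply: K_real => //; rewrite divr_ge0// ltW.
pose M := `|g 0| + L.
have M0 : 0 <= M by rewrite addr_ge0.
have gM x : 0 <= x <= 1 -> `|g x| <= M.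
  move=> x01; have i0 : 0 <= (0 : R) <= 1 by rewrite lexx ler01.
  rewrite -[g x](subrK (g 0)) addrC (le_trans (ler_normD _ _))// lerD2l.
  apply: (le_trans (gL _ _ x01 i0)); rewrite subr0 ler_piMr//.
  by have /andP[x0 x1] := x01; rewrite ger0_norm.
have [r [be [r01 be0 hbe]]] := fredholm_bounds del0 kap01 hF FL Fphi phi01 p0 p1 hG Gg.
have [rho [C1 [rho01 C10 aS alS]]] := superexp_coeffs r01 be0 (alpha_0 phi p g) hbe.
have k1 : 0 < 1 - kap by have /andP[_ ?] := kap01; rewrite subr_gt0.
(* The summands are the constants of [periodic_rate] for the function 1, with bound 1 and Lipschitz
   constant 0, and for [g]. *)
pose C := 1 / (1 - kap) + (M / (1 - kap) + L).
have Ct : 0 <= 1 / (1 - kap) by rewrite divr_ge0// ltW.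
have Cu : 0 <= M / (1 - kap) + L by rewrite addr_ge0// divr_ge0// ltW.
have int1 : \int[mu]_(x in `[0%R, 1%R]) (1 : R) = 1.
  by rewrite Rintegral_cst//= muS.1 /= mulr1.
have tb n : `|t_ phi p n.+1 - 1| <= C * kap ^+ n.+1.
  have c1 : lip01 (fun=> 1 : R) 0 by move=> x y _ _; rewrite subrr normr0 mul0r.
  have c1M (x : R) : 0 <= x <= 1 -> `|1 : R| <= 1 by rewrite normr1.
  have := periodic_rate del0 kap01 hF FL Fphi phi01 p0 p1 muS (lexx 0) ler01 c1
    c1M (ltn0Sn n).
  rewrite int1 addr0 => h; apply: (le_trans h).
  by rewrite ler_wpM2r ?(kapX_ge0 kap01)// lerDl.
have ub n : `|tau_ phi p g n.+1 / n.+1%:R - \int[mu]_(x in `[0%R, 1%R]) g x| <= C * kap ^+ n.+1.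
  rewrite (tau_sum p del0 kap01 hF FL Fphi phi01) mulrAC divff ?pnatr_eq0// mul1r.
  have := periodic_rate del0 kap01 hF FL Fphi phi01 p0 p1 muS L0 M0 gL gM (ltn0Sn n).
  by move=> h; apply: (le_trans h); rewrite ler_wpM2r ?(kapX_ge0 kap01)// lerDr.
have [c [lam [c0 lam0 hc]]] := @ratio_rate R _ (fun m => tau_ phi p g m / m%:R)
  _ _ _ _ _ kap01 (addr_ge0 Ct Cu) (erefl : a_ phi p 0 = 1)
  (alpha_0 phi p g) (a_rec phi p) (alpha_rec phi p g) tb ub
  _ _ rho01 C10 aS alS.
by exists c, lam; split => // k _; rewrite /mu_ !big_mkord; exact: hc.
Qed.
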